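(* Let $\delta>0$ be fixed. Let $u_0\in H^{1/2}(\mathbb R)$ and let $u=u(x,t)$ be the global in time solution of the initial value problem for the ILW equation with $u(\cdot,0)=u_0$, such that $$u\in C(\mathbb R:H^{1/2}(\mathbb R))\cap L^\infty(\mathbb R:H^{1/2}(\mathbb R)).$$ Then, for every $0<b<\frac23$, $$\liminf_{t\to\infty}\int_{B_{t^b}(0)}\left(u^2(x,t)+|q(\partial_x)u(x,t)|^2\right)dx=0,$$ where $B_{t^b}(0)=\{x\in\mathbb R:|x|<t^b\}$.
   Context: The Intermediate Long Wave (ILW) equation, with fixed parameter $\delta>0$, is $$\partial_t u+\mathcal T_\delta\partial_x^2u+\frac1\delta\partial_xu+u\,\partial_xu=0,\qquad (x,t)\in\mathbb R\times\mathbb R,$$ for a real-valued function $u=u(x,t)$, where $$\mathcal T_\delta f(x)=-\frac1{2\delta}\,\mathrm{p.v.}\int_{\mathbb R}\coth\Big(\frac{\pi(x-y)}{2\delta}\Big)f(y)\,dy .$$ Equivalently, with $\widehat f(\xi)=\int e^{-ix\xi}f(x)\,dx$, the operator $\mathcal T_\delta\partial_x^2+\frac1\delta\partial_x$ is the Fourier multiplier with symbol $-i\,\Omega_\delta(\xi)$, $\Omega_\delta(\xi)=\xi^2\coth(\delta\xi)-\xi/\delta$. The function $\Omega_\delta'$ is even and nonnegative, with $\Omega_\delta'(\xi)>0$ for $\xi\ne0$; $q(\partial_x)$ denotes the Fourier multiplier $\widehat{q(\partial_x)f}(\xi)=q(\xi)\widehat f(\xi)$, where $q$ is the even, Lipschitz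 function with $q(\xi)>0$ for $\xi>0$ and $\Omega_\delta'(\xi)=q(\xi)^2$, i.e. $q(\xi)=\sqrt{\Omega_\delta'(\xi)}$. $H^s(\mathbb R)=(1-\partial_x^2)^{-s/2}L^2(\mathbb R)$ is the Sobolev space. The initial value problem is globally well posed in $H^s(\mathbb R)$ for every $s\ge0$ (Ifrim–Saut): for each $T>0$ the data-to-solution map on smooth ($H^\infty$) data extends uniquely to a continuous map $H^s(\mathbb R)\to C([-T,T]:H^s(\mathbb R))$; ''solution'' means the one given by this map. Solutions conserve the $L^2$-norm. *)

(* Defs.v *)
From HB Require Import structures.
From mathcomp Require Import all_boot all_order all_algebra.
From mathcomp Require Export all_classical all_reals all_analysis.
From mathcomp Require Export complex.

Set Implicit Arguments.
Unset Strict Implicit.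
Unset Printing Implicit Defensive.
Import Order.TTheory GRing.Theory Num.Theory.
Import numFieldNormedType.Exports.

Local Open Scope classical_set_scope.
Local Open Scope ring_scope.

Section Fourier.
Context {R : realType}.
Local Notation mu := (@lebesgue_measure R).

Definition cnorm2 (F : R -> R[i]) : \bar R :=
  Lnorm mu 2%:E (fun xi => (Normc.normc (F xi))%:E).

(* \int_{-n}^n e^{-i x xi} f(x) dx *)
Definition fourier_trunc (f : R -> R) (n : nat) (xi : R) : R[i] :=
  Complex (\int[mu]_(x in `[- n%:R, n%:R]) (f x * cos (x * xi)))
          (- \int[mu]_(x in `[- n%:R, n%:R]) (f x * sin (x * xi))).

Definition is_fourier (f : R -> R) (F : R -> R[i]) : Prop :=
  [/\ measurable_fun setT (fun xi => complex.Re (F xi)),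
      measurable_fun setT (fun xi => complex.Im (F xi)) &
      cnorm2 (fun xi => fourier_trunc f n xi - F xi) @[n --> \oo] --> 0%E].

(* The Fourier-Plancherel transform of f in L^2 (a representative of its class,
   which is unique up to a null set); the value is irrelevant for other f. *)
Definition fourier (f : R -> R) : R -> R[i] := xget (cst 0) (is_fourier f).

(* m(D_x) f for a symbol m with m(-xi) = conj (m xi), so that the result is
   real-valued: a representative of the g in L^2 with g^ = m f^, whenever
   f and m f^ are in L^2. *)
Definition fmult (m : R -> R[i]) (f : R -> R) : R -> R :=
  xget (cst 0) [set g | g \in Lfun mu 2%:E /\
    {ae mu, forall xi, fourier g xi = m xi * fourier f xi}].

(* Up to the factor (2 pi)^{-1/2}, the norm of H^s *)
Definition Hnorm (s : R) (f : R -> R) : \bar R :=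
  cnorm2 (fun xi => Complex ((1 + xi ^+ 2) `^ (s / 2)) 0 * fourier f xi).

(* Only used for 0 <= s *)
Definition Hs (s : R) : set (R -> R) :=
  [set f | f \in Lfun mu 2%:E /\ (Hnorm s f < +oo)%E].

(* C(R : H^s); space-time functions are written u t x *)
Definition C_Hs (s : R) (u : R -> R -> R) : Prop :=
  (forall t, Hs s (u t)) /\
  (forall t0, Hnorm s (u t \- u t0) @[t --> t0] --> 0%E).

Definition Linfty_Hs (s : R) (u : R -> R -> R) : Prop :=
  exists M : R, {ae mu, forall t, (Hnorm s (u t) <= M%:E)%E}.

Definition Dx : (R -> R) -> R -> R := fmult (fun xi => Complex 0 xi).

End Fourier.

Section ILW.
Context {R : realType}.
Variable delta : R.
Local Notation mu := (@lebesgue_measure R).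

Definition coth (x : R) : R :=
  (expR x + expR (- x)) / (expR x - expR (- x)).

(* At xi = 0 the conventional value 0^-1 = 0 gives the right value 0. *)
Definition Omega (xi : R) : R := xi ^+ 2 * coth (delta * xi) - xi / delta.

(* T_delta \partial_x^2 + delta^{-1} \partial_x *)
Definition ILW_op : (R -> R) -> R -> R :=
  fmult (fun xi => Complex 0 (- Omega xi)).

Definition q (xi : R) : R := Num.sqrt (derive1 Omega xi).

Definition qDx : (R -> R) -> R -> R := fmult (fun xi => Complex (q xi) 0).

(* Global H^infty solutions of u_t + (T_delta u_xx + u_x / delta) + u u_x = 0:
   curves in C(R : H^s) for every s, whose L^2-valued time derivative exists
   and is given by the equation. *)
Definition smooth_solution (u : R -> R -> R) : Prop :=
  (forall s, 0 <= s -> C_Hs s u) /\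
  (forall t,
    Lnorm mu 2%:E (fun x => ((u (t + h) x - u t x) / h
        + ILW_op (u t) x + u t x * Dx (u t) x)%:E) @[h --> 0^'] --> 0%E).

(* u is the solution in H^s with datum u0, i.e. the value at u0 of the
   continuous extension to H^s -> C([-T,T] : H^s), for each T > 0, of the
   data-to-solution map on H^infty: on each [-T,T], u is the uniform limit in
   H^s of smooth solutions whose data converge to u0 in H^s. *)
Definition ILW_solution (s : R) (u0 : R -> R) (u : R -> R -> R) : Prop :=
  [/\ Hs s u0, C_Hs s u, {ae mu, forall x, u 0 x = u0 x} &
    forall T : R, 0 < T -> exists v : nat -> R -> R -> R,
      [/\ forall n, smooth_solution (v n),
          Hnorm s (v n 0 \- u0) @[n --> \oo] --> 0%E &
          ereal_sup [set Hnorm s (v n t \- u t) | t in `[- T, T]]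
            @[n --> \oo] --> 0%E]].

End ILW.

(* Main.v *)
From HB Require Import structures.
Require Import Defs.
From mathcomp Require Import all_boot all_order all_algebra.
From mathcomp Require Import all_classical all_reals all_analysis.
From mathcomp Require Import measurable_realfun.
From mathcomp Require Import ring lra.
Set Implicit Arguments.
Unset Strict Implicit.
Unset Printing Implicit Defensive.
Import Order.TTheory GRing.Theory Num.Theory.
Import numFieldNormedType.Exports.
Local Open Scope classical_set_scope.
Local Open Scope ring_scope.

(** The proof is a virial argument. Let [w] be an odd weight, bounded by [Lam] and
    square-integrable, with derivative at least [1/2 - lam / Lam] on [|x| < lam] and
    at least [- lam / Lam] everywhere, where [lam < Lam]. Along a smooth solution [v] put
    [K = A \int v w - \int v^2 w]. Then
      [K' = (A/2) \int w' v^2 + \int w' (q v)^2 - (2/3) \int w' v^3 + error],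
    where the error consists of the linear term [- A \int w L v], small because
    [Omega] is quadratic at the low frequencies that make up [w], and of a commutator
    of [L] with [w], small because [w'] varies on the scale [lam]
    ([weight_transport], [weight_cubic], [weight_dispersion], [weight_linear]). The
    cubic term is at most [c \int |w'| v^2 + c^-1 \int v^4], and [\int v^4] is
    controlled by the H^1/2 norm ([L4_bound]); with [c] large and [A] large against
    [c] the mass term absorbs it. Hence [K'] is at least half of the energy
    [\int (v^2 + (q v)^2)] over [|x| < lam], up to a small error ([virial_rate]).

    On the other hand [|K|] is at most of order [lam^(1/2) Lam] ([virial_bound]).
    If the energy over [|x| < t^b] stayed above some [e > 0] for all large [t], then
    the mean value theorem on [[T, 2T]], with [lam = (2T)^b], would give
    [e T <= C lam^(1/2) Lam] ([virial_growth]). When [Lam] is only slightly larger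
    than [lam] the right-hand side is close to [T^(3b/2)], which is [o(T)] exactly
    when [b < 2/3] ([virial_parameters]). The rough solution [u] is replaced by a
    smooth one that is uniformly close to it on the time interval in question; the
    weight is fixed there, so no integration in time is needed.

    All space identities are proved on the frequency side. There [w] is a
    superposition of [sin (s x)], and for each [s] the identity for a multiplier with
    odd symbol [Phi] involves only [Phi (x + s) - Phi x] ([sin_commutator]); for
    [Phi = Omega] this is [s q(x) q(x + s)] up to an error that follows from the
    Hoelder continuity of [q] ([Omega_commutator_symbol]). In place of the Fourier
    transform the proofs use the Hartley transform, its real and symmetric variant.
    Plancherel's theorem for it is obtained from an explicit computation for step
    functions ([sinc_kernel], [ip_sgnstep_hat]), the density of these
    ([step_dense]) and Fatou's lemma ([hart1_isometry]). *)

(** * Integrable functions on the line *)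

Lemma ae_filter_lebesgue {R : realType} :
  Filter (almost_everywhere (@lebesgue_measure R)).
Proof. exact: ae_filter_ringOfSetsType. Qed.
(* type class resolution does not unfold the Lebesgue measure to one on a ring of sets *)
#[global] Hint Extern 0 (Filter (almost_everywhere _)) =>
  (apply: ae_filter_lebesgue) : typeclass_instances.
#[global] Hint Extern 0 (Filter (nbhs (almost_everywhere _))) =>
  (apply: ae_filter_lebesgue) : typeclass_instances.

Section Integration.
Context {R : realType}.
Local Notation mu := (@lebesgue_measure R).
Implicit Types (f g h : R -> R) (a b c : R).

Definition L1 f := mu.-integrable setT (EFin \o f).

Definition intR f : R := \int[mu]_x f x.

Lemma L1_meas f : L1 f -> measurable_fun setT f.
Proof. by move=> /integrableP[/measurable_EFinP]. Qed.

Lemma L1_fin f : measurable_fun setT f ->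
  (\int[mu]_x `|f x|%:E < +oo)%E -> L1 f.
Proof. by move=> mf fi; apply/integrableP; split => //; exact/measurable_EFinP. Qed.

Lemma L1_lty f : L1 f -> (\int[mu]_x `|f x|%:E < +oo)%E.
Proof. by move=> /integrableP[]. Qed.

Lemma L1_le f g : measurable_fun setT f -> L1 g -> (forall x, `|f x| <= g x) ->
  L1 f.
Proof.
move=> mf g1 fg; apply: le_integrable g1 => //; first exact/measurable_EFinP.
by move=> x _; rewrite /= lee_fin (le_trans (fg x))// ler_norm.
Qed.

Lemma L1D f g : L1 f -> L1 g -> L1 (fun x => f x + g x).
Proof. by move=> f1 g1; exact: (integrableD measurableT f1 g1). Qed.

Lemma L1Z c f : L1 f -> L1 (fun x => c * f x).
Proof. by move=> f1; exact: (integrableZl measurableT c f1). Qed.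

Lemma L1N f : L1 f -> L1 (fun x => - f x).
Proof. by move=> /(L1Z (-1)); under eq_fun do rewrite mulN1r. Qed.

Lemma L1B f g : L1 f -> L1 g -> L1 (fun x => f x - g x).
Proof. by move=> f1 g1; apply: L1D => //; exact: L1N. Qed.

Lemma L1_norm f : L1 f -> L1 (fun x => `|f x|).
Proof. exact: integrable_norm. Qed.

Lemma L1_0 : L1 (fun=> 0).
Proof. exact: integrable0. Qed.

Lemma L1Ml c f g : measurable_fun setT f -> (forall x, `|f x| <= c) -> L1 g ->
  L1 (fun x => f x * g x).
Proof.
move=> mf fc g1; apply: (@L1_le _ (fun x => c * `|g x|)).
- by apply: measurable_funM => //; exact: L1_meas.
- by apply: L1Z; exact: L1_norm.
- by move=> x; rewrite normrM ler_wpM2r.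
Qed.

Lemma intRE f : L1 f -> ((intR f)%:E = \int[mu]_x (f x)%:E)%E.
Proof. by move=> f1; rewrite fineK//; exact: integrable_fin_num. Qed.

Lemma intRD f g : L1 f -> L1 g -> intR (fun x => f x + g x) = intR f + intR g.
Proof. by move=> f1 g1; exact: RintegralD. Qed.

Lemma intRB f g : L1 f -> L1 g -> intR (fun x => f x - g x) = intR f - intR g.
Proof. by move=> f1 g1; exact: RintegralB. Qed.

Lemma intRZ c f : L1 f -> intR (fun x => c * f x) = c * intR f.
Proof. by move=> f1; exact: RintegralZl. Qed.

Lemma intRN f : L1 f -> intR (fun x => - f x) = - intR f.
Proof. by move=> f1; rewrite -mulN1r -intRZ//; under [RHS]eq_Rintegral do rewrite mulN1r. Qed.

Lemma intR0 : intR (fun=> 0) = 0.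
Proof. by rewrite /intR Rintegral_cst// mul0r. Qed.

Lemma intR_ge0 f : (forall x, 0 <= f x) -> 0 <= intR f.
Proof. by move=> f0; apply: Rintegral_ge0. Qed.

Lemma intR_le f g : L1 f -> L1 g -> (forall x, f x <= g x) -> intR f <= intR g.
Proof. by move=> f1 g1 fg; apply: le_Rintegral. Qed.

Lemma intR_norm f : L1 f -> `|intR f| <= intR (fun x => `|f x|).
Proof. by move=> f1; exact: le_normr_Rintegral. Qed.

Lemma intR_norm_le f g : L1 f -> L1 g -> (forall x, `|f x| <= g x) ->
  `|intR f| <= intR g.
Proof.
move=> f1 g1 fg; apply: le_trans (intR_norm f1) _.
by apply: intR_le => //; exact: L1_norm.
Qed.

Lemma intR_ext f g : f =1 g -> intR f = intR g.
Proof. by move=> /funext->. Qed.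

Lemma intR_ae f g : measurable_fun setT f -> measurable_fun setT g ->
  {ae mu, forall x, f x = g x} -> intR f = intR g.
Proof.
move=> mf mg fg; congr fine; apply: ae_eq_integral => //; try exact/measurable_EFinP.
by apply: filterS fg => x; rewrite /= => ->.
Qed.

Lemma L1_ae f g : measurable_fun setT g -> {ae mu, forall x, f x = g x} ->
  L1 f -> L1 g.
Proof.
move=> mg fg f1; apply: L1_fin => //; apply: le_lt_trans (L1_lty f1).
rewrite le_eqVlt; apply/orP; left; apply/eqP; apply: ae_eq_integral => //.
- by apply/measurable_EFinP; exact: measurableT_comp.
- apply/measurable_EFinP; apply: measurableT_comp => //; exact: L1_meas.
- by apply: filterS fg => x; rewrite /= => ->.
Qed.

Lemma intR_eq0 f : L1 f -> (forall x, 0 <= f x) -> intR f = 0 ->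
  {ae mu, forall x, f x = 0}.
Proof.
move=> f1 f0 if0; have mf := L1_meas f1.
have : (\int[mu]_x `|(f x)%:E| = 0)%E.
  transitivity (\int[mu]_x (f x)%:E)%E; last by rewrite -intRE// if0.
  by apply: eq_integral => x _; rewrite /= ger0_norm.
move/(ae_eq_integral_abs mu measurableT).
move=> /(_ ltac:(exact/measurable_EFinP)).
by apply: filterS => x /(_ I) [].
Qed.

End Integration.
Arguments L1 {R} f.
Arguments intR {R} f.

Section Invariance.
Context {R : realType}.
Local Notation mu := (@lebesgue_measure R).
Implicit Types (f g h : R -> R) (a b c : R).

Lemma lebesgue_measure_shift a (A : set R) : measurable A ->
  pushforward mu ((fun x => x + a) : measurableTypeR R -> measurableTypeR R) A
  = mu A.
Proof.
have ma : measurable_fun setT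
    ((fun x => x + a) : measurableTypeR R -> measurableTypeR R).
  by apply: measurable_funD.
move=> mA; apply/esym/lebesgue_measure_unique => //= _ [[c d]] _ <-.
rewrite /pushforward/=.
have -> : (fun x : R => x + a) @^-1` `]c, d] = `]c - a, d - a]%classic.
  by apply/seteqP; split => x /=; rewrite !in_itv/= ltrBlDr lerBrDr.
rewrite !lebesgue_measure_itv/= !lte_fin ltrD2r.
by case: ifP => // _; congr (_%:E); ring.
Qed.

Lemma ge0_integral_shift a (f : R -> \bar R) : measurable_fun setT f ->
  (forall x, 0 <= f x)%E -> (\int[mu]_x f ((x : R) + a)%R = \int[mu]_x f x)%E.
Proof.
move=> mf f0.
have ma : measurable_fun setT
    ((fun x => x + a) : measurableTypeR R -> measurableTypeR R).
  by apply: measurable_funD.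
transitivity (\int[pushforward mu ((fun x : R => (x + a)%R) : measurableTypeR R -> measurableTypeR R)]_x f x)%E.
  by rewrite ge0_integral_pushforward// preimage_setT.
by apply: eq_measure_integral => //= A mA _; exact: lebesgue_measure_shift.
Qed.

Lemma ge0_integral_refl (f : R -> \bar R) : measurable_fun setT f ->
  (forall x, 0 <= f x)%E -> (\int[mu]_x f (- (x : R))%R = \int[mu]_x f x)%E.
Proof.
move=> mf f0.
transitivity (\int[pushforward mu (-%R : _ -> measurableTypeR R)]_x f x)%E.
  by rewrite ge0_integral_pushforward// preimage_setT.
by apply: eq_measure_integral => //= A mA _; exact: lebesgue_measureN.
Qed.

Lemma meas_shift a d (T : measurableType d) (f : R -> T) : measurable_fun setT f ->
  measurable_fun setT (fun x : R => f (x + a)).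
Proof. by move=> mf; apply: (measurableT_comp mf); exact: measurable_funD. Qed.

Lemma meas_refl d (T : measurableType d) (f : R -> T) : measurable_fun setT f ->
  measurable_fun setT (fun x : R => f (- x)).
Proof. by move=> mf; apply: (measurableT_comp mf). Qed.

Lemma L1_shift a f : L1 f -> L1 (fun x => f (x + a)).
Proof.
move=> f1; have mf := L1_meas f1; apply: L1_fin; first exact: meas_shift.
rewrite (ge0_integral_shift a (f := fun x => `|f x|%:E)) ?L1_lty//.
by apply/measurable_EFinP; exact: measurableT_comp.
Qed.

Lemma L1_refl f : L1 f -> L1 (fun x => f (- x)).
Proof.
move=> f1; have mf := L1_meas f1; apply: L1_fin; first exact: meas_refl.
rewrite (ge0_integral_refl (f := fun x => `|f x|%:E)) ?L1_lty//.
by apply/measurable_EFinP; exact: measurableT_comp.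
Qed.

Lemma intR_shift a f : measurable_fun setT f ->
  intR (fun x => f (x + a)) = intR f.
Proof.
move=> mf; rewrite /intR /Rintegral integralE [in RHS]integralE.
rewrite -(ge0_integral_shift a (f := (fun x => (f x)%:E)^\+)%E)//; last first.
  by apply: measurable_funepos; exact/measurable_EFinP.
rewrite -(ge0_integral_shift a (f := (fun x => (f x)%:E)^\-)%E)//; last first.
  by apply: measurable_funeneg; exact/measurable_EFinP.
congr fine; congr (_ - _)%E; by apply: eq_integral => x _; rewrite ?funeposE ?funenegE.
Qed.

Lemma intR_refl f : measurable_fun setT f ->
  intR (fun x => f (- x)) = intR f.
Proof.
move=> mf; rewrite /intR /Rintegral integralE [in RHS]integralE.
rewrite -(ge0_integral_refl (f := (fun x => (f x)%:E)^\+)%E)//; last first.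
  by apply: measurable_funepos; exact/measurable_EFinP.
rewrite -(ge0_integral_refl (f := (fun x => (f x)%:E)^\-)%E)//; last first.
  by apply: measurable_funeneg; exact/measurable_EFinP.
congr fine; congr (_ - _)%E; by apply: eq_integral => x _; rewrite ?funeposE ?funenegE.
Qed.

Lemma intR_odd f : measurable_fun setT f -> (forall x, f (- x) = - f x) ->
  intR f = 0.
Proof.
move=> mf fN; have := intR_refl mf.
rewrite (_ : (fun x => f (- x)) = (fun x => - f x)); last exact/funext.
suff -> : intR (fun x => - f x) = - intR f by lra.
rewrite /intR /Rintegral integralE [in RHS]integralE.
have -> : ((fun x => (- f x)%:E)^\+ = (fun x => (f x)%:E)^\-)%E.
  by apply/funext => x; rewrite funeposE funenegE /=.
have -> : ((fun x => (- f x)%:E)^\- = (fun x => (f x)%:E)^\+)%E.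
  by apply/funext => x; rewrite funeposE funenegE /= opprK.
have E : (\int[mu]_x ((fun x => (f x)%:E)^\-) x = \int[mu]_x ((fun x => (f x)%:E)^\+) x)%E.
  rewrite -(ge0_integral_refl (f := (fun x => (f x)%:E)^\+)%E)//; last first.
    by apply: measurable_funepos; exact/measurable_EFinP.
  by apply: eq_integral => x _; rewrite funeposE funenegE /= fN.
rewrite !E; set J := (\int[mu]_x _)%E.
by case: J => [r| |] /=; rewrite ?oppr0 ?subrr ?oppr0.
Qed.

Lemma ae_shift a (P : R -> Prop) : {ae mu, forall x, P x} ->
  {ae mu, forall x, P (x + a)}.
Proof.
move=> [N [mN N0 PN]].
have ma : measurable_fun setT
    ((fun x => x + a) : measurableTypeR R -> measurableTypeR R).
  by apply: measurable_funD.
exists ((fun x => x + a) @^-1` N); split.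
- by rewrite -[X in measurable X]setTI; exact: ma.
- by have := lebesgue_measure_shift a mN; rewrite /pushforward => ->.
- by move=> x /= Px; apply: PN.
Qed.

Lemma ae_refl (P : R -> Prop) : {ae mu, forall x, P x} ->
  {ae mu, forall x, P (- x)}.
Proof.
move=> [N [mN N0 PN]].
exists (-%R @^-1` N); split.
- rewrite -[X in measurable X]setTI; exact: (@oppr_measurable R setT).
- by have := lebesgue_measureN mN; rewrite /pushforward => ->.
- by move=> x /= Px; apply: PN.
Qed.

Lemma intR_cvg (F : nat -> R -> R) f g : (forall n, measurable_fun setT (F n)) ->
  measurable_fun setT f -> L1 g ->
  {ae mu, forall x, F n x @[n --> \oo] --> f x} ->
  (forall n x, `|F n x| <= g x) ->
  intR (F n) @[n --> \oo] --> intR f.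
Proof.
move=> mF mf g1 Ff Fg.
have mFe n : measurable_fun setT (fun x => (F n x)%:E) by exact/measurable_EFinP.
have mfe : measurable_fun setT (EFin \o f) by exact/measurable_EFinP.
have FfE : {ae mu, forall x, setT x -> (F n x)%:E @[n --> \oo] --> (EFin \o f) x}.
  apply: filterS Ff => x Fx _; apply: cvg_EFin => //; exact: nearW.
have FgE : {ae mu, forall x n, setT x -> (`|(F n x)%:E| <= (EFin \o g) x)%E}.
  by apply: aeW => x n _; rewrite /= lee_fin.
have [f1 _ C] := @dominated_convergence _ _ R mu setT measurableT _ _ _ mFe mfe FfE g1 FgE.
by rewrite -intRE// in C; exact: fine_cvg C.
Qed.

End Invariance.

Section FubiniReal.
Context {R : realType}.
Local Notation mu := (@lebesgue_measure R).

Lemma meas_pair1 (K : R -> R -> R) x :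
  measurable_fun setT (fun p : R * R => K p.1 p.2) -> measurable_fun setT (K x).
Proof.
move=> mK; apply: (@measurableT_comp _ _ _ _ _ _ (fun p : R * R => K p.1 p.2) _
  (fun y => (x, y)) mK); exact: measurable_pair1.
Qed.

Lemma meas_pair2 (K : R -> R -> R) y :
  measurable_fun setT (fun p : R * R => K p.1 p.2) ->
  measurable_fun setT (K ^~ y).
Proof.
move=> mK; apply: (@measurableT_comp _ _ _ _ _ _ (fun p : R * R => K p.1 p.2) _
  (fun x => (x, y)) mK); exact: measurable_pair2.
Qed.

(** Domination by a tensor product makes every section integrable, not only
    almost every one. *)
Lemma fubini_dom (K : R -> R -> R) (f g : R -> R) :
  measurable_fun setT (fun p : R * R => K p.1 p.2) -> L1 f -> L1 g ->
  (forall x y, `|K x y| <= f x * g y) ->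
  [/\ forall x, L1 (K x), forall y, L1 (K ^~ y),
      L1 (fun x => intR (K x)), L1 (fun y => intR (K ^~ y)) &
      intR (fun x => intR (K x)) = intR (fun y => intR (K ^~ y))].
Proof.
move=> mK f1 g1 Kfg.
have K1 x : L1 (K x).
  by apply: (@L1_le _ _ (fun y => f x * g y)) => //; [exact: meas_pair1|exact: L1Z].
have K2 y : L1 (K ^~ y).
  apply: (@L1_le _ _ (fun x => g y * f x)) => //; [exact: meas_pair2|exact: L1Z|].
  by move=> x; rewrite mulrC.
have mKe : measurable_fun setT (fun p : R * R => (K p.1 p.2)%:E).
  exact/measurable_EFinP.
have Kint : (mu \x mu)%E.-integrable setT (fun p : R * R => (K p.1 p.2)%:E).
  apply/(integrable12ltyP mu mu mKe) => /=.
  apply: (@le_lt_trans _ _ (\int[mu]_x (`|f x| * intR (fun y => `|g y|))%:E)%E).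
    apply: ge0_le_integral => //.
    - by move=> x _; exact: integral_ge0.
    - have mKa : measurable_fun setT (fun p : R * R => `|K p.1 p.2|%:E).
        by apply/measurable_EFinP; exact: measurableT_comp.
      by apply: (@measurable_fun_fubini_tonelli_F _ _ _ _ _ mu _ mKa) => p.
    - apply/measurable_EFinP; apply: measurable_funM => //.
      by apply: measurableT_comp => //; exact: L1_meas.
    move=> x _; rewrite EFinM intRE; last exact: L1_norm.
    rewrite -integralZl//; last exact: L1_norm.
    apply: ge0_le_integral => //.
    - by apply/measurable_EFinP; apply: measurableT_comp => //; exact: meas_pair1.
    - apply/measurable_EFinP; apply: measurable_funM => //.
      by apply: measurableT_comp => //; exact: L1_meas.
    move=> y _; rewrite -EFinM lee_fin -normrM.
    exact: le_trans (Kfg x y) (ler_norm _).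
  have h1 : L1 (fun x => `|f x| * intR (fun y => `|g y|)).
    by under eq_fun do rewrite mulrC; apply: L1Z; exact: L1_norm.
  by rewrite -intRE// ltry.
have i1 : L1 (fun x => intR (K x)).
  have := integrable_fubini_F Kint.
  by apply: eq_integrable => // x _; rewrite /fubini_F /= intRE.
have i2 : L1 (fun y => intR (K ^~ y)).
  apply: (@L1_le _ _ (fun y => intR f * g y)); last 2 first.
  - exact: L1Z.
  - move=> y; apply: le_trans (intR_norm_le (K2 y) (L1Z (g y) f1) _) _.
      by move=> x; rewrite mulrC.
    by rewrite intRZ// mulrC.
  apply/measurable_EFinP.
  have := measurable_fubini_G Kint.
  apply: eq_measurable_fun => y _; rewrite /fubini_G /= intRE//.
split; [exact: K1|exact: K2|exact: i1|exact: i2|].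
apply: EFin_inj; rewrite (intRE i1) (intRE i2).
under eq_integral do rewrite intRE//.
under [RHS]eq_integral do rewrite intRE//.
exact: (Fubini Kint).
Qed.

End FubiniReal.

(** * Square-integrable functions *)

Section L2space.
Context {R : realType}.
Local Notation mu := (@lebesgue_measure R).
Implicit Types (f g h : R -> R) (a b c : R).

Definition L2 f := measurable_fun setT f /\ L1 (fun x => f x ^+ 2).

Definition ip f g := intR (fun x => f x * g x).

Definition nrm f := Num.sqrt (ip f f).

Lemma L2_meas f : L2 f -> measurable_fun setT f.
Proof. by case. Qed.

Lemma L2_sq f : L2 f -> L1 (fun x => f x ^+ 2).
Proof. by case. Qed.

Lemma L2_le f g : measurable_fun setT f -> L2 g ->
  (forall x, `|f x| <= `|g x|) -> L2 f.
Proof.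
move=> mf [mg g2] fg; split=> //.
apply: (L1_le _ g2); first exact: measurable_funX.
by move=> x; rewrite normrX -[leRHS]real_normK ?num_real// lerXn2r ?nnegrE.
Qed.

Lemma L2M f g : L2 f -> L2 g -> L1 (fun x => f x * g x).
Proof.
move=> [mf f2] [mg g2]; apply: (L1_le _ (L1D f2 g2)).
  exact: measurable_funM.
move=> x; rewrite normrM -[f x ^+ 2]real_normK ?num_real//.
rewrite -[g x ^+ 2]real_normK ?num_real//.
set p := `|f x|; set q := `|g x|; have p0 : 0 <= p by exact: normr_ge0.
have q0 : 0 <= q by exact: normr_ge0.
nra.
Qed.

Lemma L2_sqr f : L2 f -> L1 (fun x => f x * f x).
Proof. by move=> f2; exact: L2M. Qed.

Lemma L2Z c f : L2 f -> L2 (fun x => c * f x).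
Proof.
move=> [mf f2]; split; first exact: measurable_funM.
by under eq_fun do rewrite exprMn; exact: L1Z.
Qed.

Lemma L2N f : L2 f -> L2 (fun x => - f x).
Proof. by move=> /(L2Z (-1)); under eq_fun do rewrite mulN1r. Qed.

Lemma L2D f g : L2 f -> L2 g -> L2 (fun x => f x + g x).
Proof.
move=> f2 g2; split; first by apply: measurable_funD; exact: L2_meas.
under eq_fun do rewrite sqrrD.
apply: L1D; last exact: L2_sq.
apply: L1D; first exact: L2_sq.
by under eq_fun do rewrite -mulr_natl; apply: L1Z; exact: L2M.
Qed.

Lemma L2B f g : L2 f -> L2 g -> L2 (fun x => f x - g x).
Proof. by move=> f2 g2; apply: L2D => //; exact: L2N. Qed.

Lemma L2_0 : L2 (fun=> 0).
Proof. by split => //; under eq_fun do rewrite expr0n/=; exact: L1_0. Qed.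

Lemma L2Ml c f g : measurable_fun setT f -> (forall x, `|f x| <= c) -> L2 g ->
  L2 (fun x => f x * g x).
Proof.
move=> mf fc g2; apply: (@L2_le _ (fun x => c * g x)).
- by apply: measurable_funM => //; exact: L2_meas.
- exact: L2Z.
- move=> x; rewrite !normrM ler_wpM2r// (le_trans (fc x))// ler_norm//.
Qed.

Lemma L2_shift a f : L2 f -> L2 (fun x => f (x + a)).
Proof.
move=> [mf f2]; split; first exact: meas_shift.
exact: (L1_shift a f2).
Qed.

Lemma L2_refl f : L2 f -> L2 (fun x => f (- x)).
Proof.
move=> [mf f2]; split; first exact: meas_refl.
exact: (L1_refl f2).
Qed.

Lemma L2_ae f g : measurable_fun setT g -> {ae mu, forall x, f x = g x} ->
  L2 f -> L2 g.
Proof.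
move=> mg fg [mf f2]; split => //; apply: L1_ae f2.
  exact: measurable_funX.
by apply: filterS fg => x ->.
Qed.

Lemma ipC f g : ip f g = ip g f.
Proof. by apply: intR_ext => x; rewrite mulrC. Qed.

Lemma ipDl f g h : L2 f -> L2 g -> L2 h ->
  ip (fun x => f x + g x) h = ip f h + ip g h.
Proof.
move=> f2 g2 h2; rewrite /ip -intRD; try exact: L2M.
by apply: intR_ext => x; rewrite mulrDl.
Qed.

Lemma ipDr f g h : L2 f -> L2 g -> L2 h ->
  ip h (fun x => f x + g x) = ip h f + ip h g.
Proof. by move=> f2 g2 h2; rewrite ipC ipDl// !(ipC h). Qed.

Lemma ipZl c f g : L2 f -> L2 g -> ip (fun x => c * f x) g = c * ip f g.
Proof.
move=> f2 g2; rewrite /ip -intRZ; last exact: L2M.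
by apply: intR_ext => x; rewrite mulrA.
Qed.

Lemma ipZr c f g : L2 f -> L2 g -> ip g (fun x => c * f x) = c * ip g f.
Proof. by move=> f2 g2; rewrite ipC ipZl// ipC. Qed.

Lemma ipNl f g : L2 f -> L2 g -> ip (fun x => - f x) g = - ip f g.
Proof.
move=> f2 g2; rewrite -mulN1r -ipZl//; apply: intR_ext => x.
by rewrite mulN1r.
Qed.

Lemma ipBl f g h : L2 f -> L2 g -> L2 h ->
  ip (fun x => f x - g x) h = ip f h - ip g h.
Proof. by move=> f2 g2 h2; rewrite ipDl// ?ipNl//; exact: L2N. Qed.

Lemma ipBr f g h : L2 f -> L2 g -> L2 h ->
  ip h (fun x => f x - g x) = ip h f - ip h g.
Proof. by move=> f2 g2 h2; rewrite ipC ipBl// !(ipC h). Qed.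

Lemma ip_ge0 f : 0 <= ip f f.
Proof. by apply: intR_ge0 => x; rewrite -expr2 sqr_ge0. Qed.

Lemma nrm_ge0 f : 0 <= nrm f.
Proof. exact: sqrtr_ge0. Qed.

Lemma nrm_sqr f : nrm f ^+ 2 = ip f f.
Proof. by rewrite sqr_sqrtr// ip_ge0. Qed.

Lemma ip_sqr f : ip f f = intR (fun x => f x ^+ 2).
Proof. by apply: intR_ext => x; rewrite expr2. Qed.

Lemma nrm_le c f : 0 <= c -> ip f f <= c ^+ 2 -> nrm f <= c.
Proof. by move=> c0 fc; rewrite -(ger0_norm c0) -sqrtr_sqr ler_wsqrtr. Qed.

Lemma nrm_le_mono f g : L2 f -> L2 g -> (forall x, `|f x| <= `|g x|) ->
  nrm f <= nrm g.
Proof.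
move=> f2 g2 fg; apply: ler_wsqrtr; apply: intR_le; try exact: L2M.
move=> x; rewrite -!expr2 -[f x ^+ 2]real_normK ?num_real//.
by rewrite -[g x ^+ 2]real_normK ?num_real// lerXn2r ?nnegrE.
Qed.

Lemma cauchy_schwarz_sqr f g : L2 f -> L2 g -> ip f g ^+ 2 <= ip f f * ip g g.
Proof.
move=> f2 g2.
have Q t : 0 <= ip f f + 2 * t * ip f g + t ^+ 2 * ip g g.
  have := ip_ge0 (fun x => f x + t * g x).
  rewrite ipDl// ?ipDr// ?(ipZl, ipZr)//; try (by repeat apply: L2Z); try (by apply: L2D => //; exact: L2Z).
  by rewrite (ipC g f); congr (_ <= _); ring.
have := ip_ge0 g; rewrite le_eqVlt => /predU1P[g0|g0].
  rewrite -g0 mulr0; have [->|fg0] := eqVneq (ip f g) 0; first by rewrite expr0n.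
  have := Q (- (ip f f + 1) / (2 * ip f g)); rewrite -g0 mulr0 addr0.
  rewrite (_ : 2 * (- (ip f f + 1) / (2 * ip f g)) * ip f g = - (ip f f + 1)); last by field.
  lra.
have := Q (- ip f g / ip g g).
rewrite (_ : _ + _ = (ip f f * ip g g - ip f g ^+ 2) / ip g g); last by field; rewrite gt_eqF.
by rewrite pmulr_lge0 ?invr_gt0// subr_ge0.
Qed.

Lemma cauchy_schwarz f g : L2 f -> L2 g -> `|ip f g| <= nrm f * nrm g.
Proof.
move=> f2 g2; rewrite -sqrtrM ?ip_ge0// -sqrtr_sqr ler_wsqrtr//.
exact: cauchy_schwarz_sqr.
Qed.

Lemma nrmD f g : L2 f -> L2 g -> nrm (fun x => f x + g x) <= nrm f + nrm g.
Proof.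
move=> f2 g2; apply: nrm_le; first by rewrite addr_ge0// nrm_ge0.
rewrite ipDl// ?ipDr//; last exact: L2D.
rewrite sqrrD !nrm_sqr (ipC g f).
have := le_trans (ler_norm _) (cauchy_schwarz f2 g2); lra.
Qed.

Lemma nrmZ c f : L2 f -> nrm (fun x => c * f x) = `|c| * nrm f.
Proof.
move=> f2; rewrite /nrm ipZl//; last exact: L2Z.
by rewrite ipZr// mulrA -expr2 sqrtrM ?sqr_ge0// sqrtr_sqr.
Qed.

Lemma nrmN f : nrm (fun x => - f x) = nrm f.
Proof. by congr Num.sqrt; apply: intR_ext => x; rewrite mulrNN. Qed.

Lemma nrm_sym f g : nrm (fun x => f x - g x) = nrm (fun x => g x - f x).
Proof. by rewrite -nrmN; congr nrm; apply/funext => x; rewrite opprB. Qed.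

Lemma nrm_tri g f h : L2 f -> L2 g -> L2 h ->
  nrm (fun x => f x - h x) <= nrm (fun x => f x - g x) + nrm (fun x => g x - h x).
Proof.
move=> f2 g2 h2.
rewrite (_ : (fun x => f x - h x) = (fun x => (f x - g x) + (g x - h x))).
  by rewrite nrmD//; exact: L2B.
by apply/funext => x; ring.
Qed.

Lemma nrm_dist f g : L2 f -> L2 g -> `|nrm f - nrm g| <= nrm (fun x => f x - g x).
Proof.
move=> f2 g2.
have H u v : L2 u -> L2 v -> nrm u <= nrm (fun x => u x - v x) + nrm v.
  move=> u2 v2; rewrite [leLHS](_ : _ = nrm (fun x => (u x - v x) + v x)).
    by rewrite nrmD//; exact: L2B.
  by congr nrm; apply/funext => x; ring.
have := H _ _ f2 g2; have := H _ _ g2 f2; rewrite (nrm_sym g f).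
rewrite ler_norml; lra.
Qed.

Lemma nrm_ae f g : measurable_fun setT f -> measurable_fun setT g ->
  {ae mu, forall x, f x = g x} -> nrm f = nrm g.
Proof.
move=> mf mg fg; congr Num.sqrt; apply: intR_ae; try exact: measurable_funM.
by apply: filterS fg => x ->.
Qed.

Lemma nrm_eq0 f : L2 f -> nrm f = 0 -> {ae mu, forall x, f x = 0}.
Proof.
move=> f2 f0; have : ip f f = 0 by rewrite -nrm_sqr f0 expr0n.
move/(intR_eq0 (L2_sqr f2)); move=> /(_ (fun x => _)).
have H x : 0 <= f x * f x by rewrite -expr2 sqr_ge0.
by move=> /(_ H); apply: filterS => x /eqP; rewrite mulf_eq0 orbb => /eqP.
Qed.

Lemma nrm_ae_eq f g : L2 f -> L2 g -> nrm (fun x => f x - g x) = 0 ->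
  {ae mu, forall x, f x = g x}.
Proof.
move=> f2 g2 /(nrm_eq0 (L2B f2 g2)); apply: filterS => x /eqP.
by rewrite subr_eq0 => /eqP.
Qed.

Lemma nrm0_ae f g : measurable_fun setT f -> measurable_fun setT g ->
  {ae mu, forall x, f x = g x} -> nrm (fun x => f x - g x) = 0.
Proof.
move=> mf mg fg.
rewrite (@nrm_ae _ (fun=> 0)) ?/nrm ?/ip//; last 2 first.
- exact: measurable_funB.
- by apply: filterS fg => x ->; rewrite subrr.
by under intR_ext do rewrite mulr0; rewrite intR0 sqrtr0.
Qed.

(** Test against [f - g]. *)
Lemma ip_ae_eq f g : L2 f -> L2 g -> (forall h, L2 h -> ip f h = ip g h) ->
  {ae mu, forall x, f x = g x}.
Proof.
move=> f2 g2 fg; apply: nrm_ae_eq => //.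
by rewrite /nrm ipBl ?fg ?subrr ?sqrtr0//; exact: L2B.
Qed.

Lemma ip_ae f g h : measurable_fun setT f -> measurable_fun setT g ->
  measurable_fun setT h -> {ae mu, forall x, f x = g x} -> ip f h = ip g h.
Proof.
move=> mf mg mh fg; apply: intR_ae; try exact: measurable_funM.
by apply: filterS fg => x ->.
Qed.

Lemma nrm_shift a f : measurable_fun setT f -> nrm (fun x => f (x + a)) = nrm f.
Proof.
move=> mf; congr Num.sqrt.
by apply: (intR_shift a (f := fun x => f x * f x)); exact: measurable_funM.
Qed.

Lemma nrm_refl f : measurable_fun setT f -> nrm (fun x => f (- x)) = nrm f.
Proof.
move=> mf; congr Num.sqrt.
by apply: (intR_refl (f := fun x => f x * f x)); exact: measurable_funM.
Qed.

Lemma intR_fatou (F : nat -> R -> R) f c : (forall n, L1 (F n)) ->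
  (forall n x, 0 <= F n x) -> measurable_fun setT f ->
  {ae mu, forall x, F n x @[n --> \oo] --> f x} -> (forall x, 0 <= f x) ->
  (\forall n \near \oo, intR (F n) <= c) -> L1 f /\ intR f <= c.
Proof.
move=> F1 F0 mf Ff f0 Fc.
have mFe n : measurable_fun setT (fun x => (F n x)%:E).
  by apply/measurable_EFinP; exact: L1_meas.
have FT := @fatou _ _ R mu setT measurableT (fun n x => (F n x)%:E) mFe
  (fun n x _ => F0 n x).
have E : (\int[mu]_x limn_einf (fun n => (F n x)%:E) = \int[mu]_x (f x)%:E)%E.
  apply: ae_eq_integral => //.
  - apply: measurableT_comp => //.
    apply: (@measurable_fun_limn_esup _ _ _ setT (fun n x => - (F n x)%:E)%E) => n.
    exact: measurableT_comp.
  - exact/measurable_EFinP.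
  apply: filterS Ff => x Fx _.
  have C : (F n x)%:E @[n --> \oo] --> (f x)%:E.
    by apply: cvg_EFin => //; exact: nearW.
  rewrite is_cvg_limn_einfE; last by apply/cvg_ex; exists (f x)%:E.
  exact/cvg_lim.
rewrite E in FT.
have B : (\int[mu]_x (f x)%:E <= c%:E)%E.
  apply: le_trans FT _; rewrite limn_einf_lim; apply: lime_le.
    exact: is_cvg_einfs.
  near=> n; apply: le_trans (ereal_inf_lbound _) _; first by exists n => //=.
  by rewrite -intRE// lee_fin; near: n.
have f1 : L1 f.
  apply: L1_fin => //; apply: le_lt_trans (ltry c); apply: le_trans B.
  by rewrite le_eqVlt; apply/orP; left; apply/eqP; apply: eq_integral => x _; rewrite ger0_norm.
by split=> //; rewrite -lee_fin intRE.
Unshelve. all: by end_near. Qed.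

End L2space.
Arguments L2 {R} f.
Arguments ip {R} f g.
Arguments nrm {R} f.

Section Complete.
Context {R : realType}.
Local Notation mu := (@lebesgue_measure R).

Lemma nrm_sum (d : nat -> R -> R) n : (forall k, L2 (d k)) ->
  L2 (fun x => \sum_(k < n) d k x) /\
  nrm (fun x => \sum_(k < n) d k x) <= \sum_(k < n) nrm (d k).
Proof.
move=> d2; elim: n => [|n [IH1 IH2]].
  under eq_fun do rewrite big_ord0; rewrite big_ord0; split; first exact: L2_0.
  by apply: nrm_le => //; rewrite /ip; under intR_ext do rewrite mulr0; rewrite intR0 expr0n.
under eq_fun do rewrite big_ord_recr/=; rewrite big_ord_recr/=.
split; first exact: L2D.
by apply: le_trans (nrmD _ _) _ => //; rewrite lerD2r.
Qed.

(** A sequence whose consecutive distances are summable converges almost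
    everywhere: the sum of the consecutive distances is square integrable, hence
    finite almost everywhere. *)
Lemma L2_fast_cvg (g : nat -> R -> R) : (forall k, L2 (g k)) ->
  (forall k, nrm (fun x => g k.+1 x - g k x) <= 2^-1 ^+ k) ->
  {ae mu, forall x, cvgn (fun k => g k x)}.
Proof.
move=> g2 gk.
pose d k x := `|g k.+1 x - g k x|.
have d2 k : L2 (d k).
  apply: (@L2_le _ _ (fun x => g k.+1 x - g k x)); last by move=> x; rewrite normr_id.
    by apply: measurableT_comp => //; apply: L2_meas; exact: L2B.
  exact: L2B.
have nd k : nrm (d k) <= 2^-1 ^+ k.
  apply: le_trans (gk k); apply: nrm_le_mono => //; first exact: L2B.
  by move=> x; rewrite normr_id.
pose G n x := \sum_(k < n) d k x.
have G2 n : L2 (G n) by have [] := nrm_sum n d2.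
have nG n : nrm (G n) <= 2.
  have [_] := nrm_sum n d2; move/le_trans; apply.
  apply: (@le_trans _ _ (\sum_(k < n) 2^-1 ^+ k)); first by apply: ler_sum => k _.
  have -> : \sum_(k < n) 2^-1 ^+ k = 2 - 2 * 2^-1 ^+ n :> R.
    elim: n => [|n IH]; first by rewrite big_ord0 expr0; ring.
    by rewrite big_ord_recr/= IH exprS; field.
  by rewrite gerBl mulr_ge0// exprn_ge0// invr_ge0.
have G0 n x : 0 <= G n x by apply: sumr_ge0 => k _; exact: normr_ge0.
have Gnd x : nondecreasing_seq (fun n => G n x).
  by apply/nondecreasing_seqP => n; rewrite /G big_ord_recr/= lerDl normr_ge0.
pose H n x := ((G n x) ^+ 2)%:E.
have mH n : measurable_fun setT (H n).
  apply/measurable_EFinP; apply: measurable_funX; exact: (L2_meas (G2 n)).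
have H0 n x : (0 <= H n x)%E by rewrite lee_fin sqr_ge0.
have Hnd x : nondecreasing_seq (H^~ x).
  by move=> n m nm; rewrite lee_fin lerXn2r ?nnegrE ?G0//; exact: Gnd.
have MC : (\int[mu]_x limn (H^~ x) = limn (fun n => \int[mu]_x H n x))%E.
  by apply: monotone_convergence => // x _; exact: Hnd.
have Hle : (\int[mu]_x limn (H^~ x) <= 4%:E)%E.
  rewrite MC; apply: lime_le.
    apply: ereal_nondecreasing_is_cvgn => n m nm; apply: ge0_le_integral => //;
      [exact: mH|exact: mH|by move=> x _; exact: (Hnd x n m nm)].
  apply: nearW => n; rewrite -intRE; last exact: L2_sq.
  rewrite lee_fin -ip_sqr -nrm_sqr (_ : 4 = 2 ^+ 2); last by rewrite -natrX.
  by rewrite lerXn2r ?nnegrE ?nrm_ge0.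
have mlim : measurable_fun setT (fun x => limn (H^~ x)).
  apply: (emeasurable_fun_cvg H) => // x _.
  exact: ereal_nondecreasing_is_cvgn.
have : mu.-integrable setT (fun x => limn (H^~ x)).
  apply/integrableP; split => //; apply: le_lt_trans (ltry 4).
  apply: le_trans Hle; rewrite le_eqVlt; apply/orP; left; apply/eqP.
  apply: eq_integral => x _; rewrite gee0_abs//.
  apply: lime_ge; first exact: ereal_nondecreasing_is_cvgn.
  by apply: nearW => n.
move/(integrable_ae measurableT); apply: filterS => x /(_ I) Hx.
have [M HM] : exists M, forall n, (G n x) ^+ 2 <= M.
  exists (fine (limn (H^~ x))) => n; rewrite -lee_fin fineK//.
  apply: lime_ge; first exact: ereal_nondecreasing_is_cvgn.
  by exists n => //= m nm; exact: (Hnd x n m nm).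
have GM n : G n x <= 1 + M.
  have := HM n; have := G0 n x; have := HM 0%N; have := sqr_ge0 (G 0%N x); nra.
have cG : cvgn (fun n => G n x).
  by apply: nondecreasing_is_cvgn => //; exists (1 + M) => _ [n _ <-].
have cS : cvgn (series (fun k => g k.+1 x - g k x)).
  apply: normed_cvg; rewrite [X in cvgn X](_ : _ = (fun n => G n x))//.
  by apply/funext => n; rewrite /G /d -(big_mkord xpredT (fun k => `|g k.+1 x - g k x|)).
rewrite (_ : g^~ x = (fun k => g 0%N x + series (fun k => g k.+1 x - g k x) k)); last first.
  apply/funext => k; rewrite /series/= telescope_sumr//; ring.
by apply: is_cvgD => //; exact: is_cvg_cst.
Qed.

(** A rapidly converging subsequence has a pointwise limit, and Fatou's lemma
    carries the Cauchy estimates over to it. *)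
Lemma L2_complete (u : nat -> R -> R) : (forall n, L2 (u n)) ->
  (forall e, 0 < e -> exists N, forall n m, (N <= n)%N -> (N <= m)%N ->
     nrm (fun x => u n x - u m x) <= e) ->
  exists2 f, L2 f & nrm (fun x => u n x - f x) @[n --> \oo] --> 0.
Proof.
move=> u2 uC.
have e0 k : 0 < 2^-1 ^+ k :> R by rewrite exprn_gt0.
have [phi phiP] := choice (fun k => uC _ (e0 k)).
pose psi k := (\sum_(i < k.+1) phi i)%N.
have psi_phi k : (phi k <= psi k)%N by rewrite /psi big_ord_recr/= leq_addl.
have psi_nd k l : (k <= l)%N -> (psi k <= psi l)%N.
  move=> /subnKC <-; elim: (l - k)%N => [|m IH]; first by rewrite addn0.
  by rewrite addnS (leq_trans IH)// {2}/psi big_ord_recr/= leq_addr.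
pose g k := u (psi k).
have g2 k : L2 (g k) by exact: u2.
have gk k : nrm (fun x => g k.+1 x - g k x) <= 2^-1 ^+ k.
  by apply: phiP; rewrite ?psi_phi// (leq_trans (psi_phi k))// psi_nd.
have gae := L2_fast_cvg g2 gk.
(* an upper limit is measurable whether or not the sequence converges *)
pose f x := fine (limn_esup (fun k => (g k x)%:E)).
have mf : measurable_fun setT f.
  apply: measurableT_comp => //.
  apply: (@measurable_fun_limn_esup _ _ _ setT (fun k x => (g k x)%:E)) => k.
  by apply/measurable_EFinP; exact: L2_meas.
have gf : {ae mu, forall x, g k x @[k --> \oo] --> f x}.
  apply: filterS gae => x gx.
  have C : (g n x)%:E @[n --> \oo] --> (limn (fun k => g k x))%:E.
    by apply: cvg_EFin => //; exact: nearW.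
  suff -> : f x = limn (fun k => g k x) by [].
  rewrite /f is_cvg_limn_esupE; last by apply/cvg_ex; eexists; exact: C.
  by move/cvg_lim : C => ->.
have K n k : (phi k <= n)%N -> L2 (fun x => u n x - f x) /\
    nrm (fun x => u n x - f x) <= 2^-1 ^+ k.
  move=> kn.
  have [] := @intR_fatou _ (fun l x => (u n x - g l x) ^+ 2)
    (fun x => (u n x - f x) ^+ 2) ((2^-1 ^+ k) ^+ 2).
  - by move=> l; apply: L2_sq; exact: L2B.
  - by move=> l x; exact: sqr_ge0.
  - by apply: measurable_funX; apply: measurable_funB => //; exact: L2_meas.
  - apply: filterS gf => x gx; rewrite expr2; under eq_fun do rewrite expr2.
    by apply: cvgM; (apply: cvgB => //; exact: cvg_cst).
  - by move=> x; exact: sqr_ge0.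
  - exists k => //= l kl; rewrite -ip_sqr -nrm_sqr lerXn2r ?nnegrE ?nrm_ge0 ?(ltW (e0 k))//.
    by apply: phiP => //; rewrite (leq_trans (psi_phi k))// psi_nd.
  move=> h1 h2; split.
    by split => //; apply: measurable_funB => //; exact: L2_meas.
  by apply: nrm_le; [exact: ltW|rewrite ip_sqr].
have f2 : L2 f.
  have [h _] := K (phi 0%N) 0%N (leqnn _).
  have := L2B (u2 (phi 0%N)) h; congr L2; apply/funext => x; ring.
exists f => //.
apply/cvgrPdist_le => e e_gt0.
have [k ke] : exists k, 2^-1 ^+ k <= e.
  have [k _ /(_ k (leqnn k))] : \forall k \near \oo, 2^-1 ^+ k <= e.
    have /cvgrPdist_le/(_ _ e_gt0) : (2^-1 : R) ^+ k @[k --> \oo] --> 0.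
      by apply: cvg_expr; rewrite ger0_norm// invf_lt1// ltr1n.
    by apply: filterS => k; rewrite sub0r normrN ger0_norm// ltW.
  by exists k.
exists (phi k) => //= n kn; rewrite sub0r normrN ger0_norm ?nrm_ge0//.
by apply: le_trans ke; have [] := K n k kn.
Qed.

Lemma LnormE (f : R -> R) : L2 f ->
  Lnorm mu 2%:E (EFin \o f) = (nrm f)%:E.
Proof.
move=> f2; have [mf _] := f2.
have := @poweR_Lnorm _ _ R mu (EFin \o f) 2 ltac:(by []).
have -> : (\int[mu]_x (`|(EFin \o f) x| `^ 2) = (ip f f)%:E)%E.
  rewrite intRE; last exact: L2_sqr.
  by apply: eq_integral => x _; rewrite /= powR_mulrn// real_normK ?num_real.
have := Lnorm_ge0 mu 2%:E (EFin \o f).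
case: (Lnorm mu 2%:E (EFin \o f)) => [r| |]//=.
- rewrite lee_fin => r0 [] /esym; rewrite powR_mulrn// => rE.
  by rewrite /nrm rE sqrtr_sqr ger0_norm.
- by move=> _; rewrite pnatr_eq0.
Qed.

Lemma Lnorm_L2 (f : R -> R) : measurable_fun setT f ->
  (Lnorm mu 2%:E (EFin \o f) < +oo)%E -> L2 f.
Proof.
move=> mf Lf; split => //; apply: L1_fin; first exact: measurable_funX.
rewrite (_ : integral _ _ _ = \int[mu]_x (`|(EFin \o f) x| `^ 2))%E; last first.
  apply: eq_integral => x _; rewrite /= powR_mulrn// real_normK ?num_real//.
  by rewrite ger0_norm// sqr_ge0.
rewrite -poweR_Lnorm//.
exact: poweR_lty.
Qed.

Lemma LfunP2 (f : R -> R) : f \in Lfun mu 2%:E <-> L2 f.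
Proof.
split.
  move=> /andP[]; rewrite !inE/= => mf; exact: Lnorm_L2.
move=> f2; apply/andP; split; rewrite inE/=; first exact: L2_meas.
by rewrite /finite_norm LnormE// ltry.
Qed.

End Complete.

(** * Some explicit integrals *)

Section HalfLine.
Context {R : realType}.
Local Notation mu := (@lebesgue_measure R).
Implicit Types (f F : R -> R) (a u : R).

Lemma meas_inv d (T : measurableType d) (f : T -> R) : measurable_fun setT f ->
  measurable_fun setT (fun x => (f x)^-1).
Proof.
move=> mf; apply: (@measurableT_comp _ _ _ _ _ _ (@GRing.inv R) _ f) => //.
rewrite -(setUv [set (0:R)]); apply/measurable_funU => //; first exact: measurableC.
split; first exact: measurable_fun_set1.
apply: open_continuous_measurable_fun.
  by apply: closed_openC; exact: closed_eq.
by move=> x; rewrite inE/= => /eqP x0; exact: inv_continuous.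
Qed.

Lemma cont_of_derive f F : (forall x : R, is_derive x 1 f (F x)) -> continuous f.
Proof.
move=> df x; apply: differentiable_continuous; apply/derivable1_diffP.
by have [] := df x.
Qed.

(** An antiderivative on the whole line spares the one-sided derivative at [0]. *)
Lemma half_line_FTC (f F : R -> R) (l : R) : (forall x, 0 <= x -> 0 <= f x) ->
  continuous f -> (forall x : R, is_derive x 1 F (f x)) ->
  F x @[x --> +oo%R] --> l ->
  (\int[mu]_(x in `[0%R, +oo[) (f x)%:E = (l - F 0)%:E)%E.
Proof.
move=> f0 cf dF Fl.
have cF : continuous F by exact: cont_of_derive dF.
rewrite (@ge0_continuous_FTC2y _ f F 0 l)//.
- by apply: continuous_subspaceT.
- by apply: cvg_at_right_filter; exact: cF.
- by move=> x _; rewrite derive1E; exact: (@derive_val _ _ _ _ _ _ _ (dF x)).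
Qed.

Lemma even_line f (c : R) : measurable_fun setT f -> (forall x, 0 <= f x) ->
  (forall x, f (- x) = f x) ->
  (\int[mu]_(x in `[0%R, +oo[) (f x)%:E = c%:E)%E -> L1 f /\ intR f = 2 * c.
Proof.
move=> mf f0 fe fc.
have mfe : measurable_fun setT (EFin \o f) by exact/measurable_EFinP.
have E : (\int[mu]_x (f x)%:E = (2 * c)%:E)%E.
  have mpos : measurable [set x : R | 0 <= x] by rewrite -set_itvcy.
  rewrite -(setUv [set x : R | 0 <= x]) ge0_integral_setU//= ; last 4 first.
  - exact: measurableC.
  - by rewrite setUv.
  - by move=> x _; rewrite lee_fin.
  - exact/disj_setPCl.
  rewrite -set_itvcy// setCitvr fc.
  rewrite integral_itv_bndo_bndc; last exact: measurable_funTS.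
  rewrite (_ : \int[mu]_(x in `]-oo, 0%R]) (f x)%:E = c%:E)%E.
    by rewrite -EFinD; congr (_%:E); ring.
  rewrite -fc (ge0_integration_by_substitution0 (f := EFin \o f))//.
  by apply: eq_integral => x _; rewrite /= fe.
have f1 : L1 f.
  apply: L1_fin => //.
  rewrite (_ : integral _ _ _ = (2 * c)%:E) ?ltry// -E.
  by apply: eq_integral => x _; rewrite ger0_norm.
by split=> //; apply: EFin_inj; rewrite intRE.
Qed.

Lemma cvg_expRNM u : 0 < u -> expR (- (u * x)) @[x --> +oo%R] --> (0 : R).
Proof.
move=> u0.
apply: (@cvg_comp _ _ _ (fun x => u * x) (fun x => expR (- x)) _ (+oo%R)).
  by apply: gt0_cvgMry => //; exact: cvg_id.
exact: cvgr_expR.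
Qed.

Lemma expR_half_line u : 0 < u ->
  (\int[mu]_(x in `[0%R, +oo[) (expR (- (u * x)))%:E = (u^-1)%:E)%E.
Proof.
move=> u0.
rewrite [LHS](half_line_FTC (F := fun x => - u^-1 * expR (- (u * x))) (l := 0) _ _ _ _).
- by rewrite mulr0 oppr0 expR0 mulr1 sub0r opprK.
- by move=> x _; exact: expR_ge0.
- by apply: (@cont_of_derive _ (fun x => - u * expR (- (u * x)))) => x; apply: is_derive_eq; rewrite /GRing.scale/=; ring.
- move=> x; apply: is_derive_eq.
  rewrite /GRing.scale/=; field; lra.
- by rewrite -(mulr0 (- u^-1)); apply: cvgM; [exact: cvg_cst|exact: cvg_expRNM].
Qed.

Lemma expR_even_line u : 0 < u ->
  L1 (fun x => expR (- (u * `|x|))) /\ intR (fun x => expR (- (u * `|x|))) = 2 / u.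
Proof.
move=> u0; apply: even_line.
- apply: measurableT_comp => //; apply: measurableT_comp => //.
  by apply: measurable_funM => //; exact: measurableT_comp.
- by move=> x; exact: expR_ge0.
- by move=> x; rewrite normrN.
rewrite -expR_half_line//; apply: eq_integral => x; rewrite inE/= in_itv/= andbT => x0.
by rewrite ger0_norm.
Qed.

Lemma inv_oneDsqr : L1 (fun x : R => (1 + x ^+ 2)^-1) /\
  intR (fun x : R => (1 + x ^+ 2)^-1) = pi.
Proof.
have -> : pi = 2 * (pi / 2) :> R by field.
apply: even_line.
- apply: continuous_measurable_fun => x.
  apply: cvgV; first by rewrite gt_eqF// ltr_pwDl// sqr_ge0.
  by apply: cvgD; [exact: cvg_cst|exact: exprn_continuous].
- by move=> x; rewrite invr_ge0 addr_ge0// sqr_ge0.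
- by move=> x; rewrite sqrrN.
- exact: integral0y_oneDsqr.
Qed.

Lemma cvg0_mul_bounded T (F : set_system T) (FF : Filter F) (f g : T -> R) c :
  f x @[x --> F] --> 0 -> (\forall x \near F, `|g x| <= c) ->
  f x * g x @[x --> F] --> 0.
Proof.
move=> f0 gc; apply/cvgrPdist_le => e e0.
have c0 : 0 < `|c| + 1 by rewrite ltr_wpDl.
have /cvgrPdist_le/(_ (e / (`|c| + 1)) ltac:(exact: divr_gt0)) := f0.
apply: filterS2 gc => x gc; rewrite !sub0r !normrN normrM => fe.
rewrite -(@divfK _ (`|c| + 1) _ e) ?gt_eqF//.
apply: ler_pM => //; apply: le_trans gc _.
by apply: le_trans (ler_norm _) _; rewrite lerDl.
Qed.

Lemma sinc_kernel_inner a u : 0 < u ->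
  (\int[mu]_(x in `[0%R, +oo[) (expR (- (u * x)) * (1 - cos (a * x)))%:E
   = (u^-1 - u / (u ^+ 2 + a ^+ 2))%:E)%E.
Proof.
move=> u0.
have d0 : u ^+ 2 + a ^+ 2 != 0 by rewrite gt_eqF// ltr_pwDl ?exprn_gt0 ?sqr_ge0.
rewrite [LHS](half_line_FTC (F := fun x => expR (- (u * x)) *
  (- u^-1 + (u * cos (a * x) - a * sin (a * x)) / (u ^+ 2 + a ^+ 2))) (l := 0) _ _ _ _).
- rewrite !mulr0 oppr0 expR0 cos0 sin0 mulr1 mulr0 subr0 mul1r; congr (_%:E); ring.
- by move=> x _; rewrite mulr_ge0 ?expR_ge0// subr_ge0 cos_le1.
- apply: (@cont_of_derive _ (fun x => - u * expR (- (u * x)) * (1 - cos (a * x)) +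
    expR (- (u * x)) * (a * sin (a * x)))) => x.
  by apply: is_derive_eq; rewrite /GRing.scale/=; ring.
- move=> x; apply: is_derive_eq; rewrite /GRing.scale/=.
  by field; rewrite d0 gt_eqF.
- apply: (@cvg0_mul_bounded _ _ _ _ _ (u^-1 + (u + `|a|) / (u ^+ 2 + a ^+ 2))).
    exact: cvg_expRNM.
  apply: nearW => x; apply: le_trans (ler_normD _ _) _.
  rewrite normrN (gtr0_norm (x := u^-1)) ?invr_gt0// lerD2l normrM.
  have dp : 0 < u ^+ 2 + a ^+ 2 by rewrite ltr_pwDl ?exprn_gt0 ?sqr_ge0.
  rewrite (gtr0_norm (x := _^-1)) ?invr_gt0// ler_pM2r ?invr_gt0//.
  apply: le_trans (ler_normB _ _) _; rewrite !normrM (gtr0_norm u0).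
  apply: lerD; first by rewrite ler_piMr ?(ltW u0)// ler_norml cos_geN1 cos_le1.
  by rewrite ler_piMr// ler_norml sin_geN1 sin_le1.
Qed.

Lemma inv_sqr_kernel x : 0 < x ->
  (\int[mu]_(u in `[0%R, +oo[) (u * expR (- (x * u)))%:E = ((x ^+ 2)^-1)%:E)%E.
Proof.
move=> x0.
rewrite [LHS](half_line_FTC (F := fun u => expR (- (x * u)) *
  (- u / x - (x ^+ 2)^-1)) (l := 0) _ _ _ _).
- by rewrite !mulr0 oppr0 expR0 mul0r mul1r !sub0r opprK.
- by move=> u u0; rewrite mulr_ge0 ?expR_ge0.
- apply: (@cont_of_derive _ (fun u => expR (- (x * u)) * (1 - x * u))) => u.
  by apply: is_derive_eq; rewrite /GRing.scale/=; ring.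
- move=> u; apply: is_derive_eq; rewrite /GRing.scale/=.
  by field; rewrite gt_eqF.
have x20 : 0 < x / 2 by rewrite divr_gt0.
(* half of the exponential absorbs the linear factor *)
have -> : (fun u => expR (- (x * u)) * (- u / x - (x ^+ 2)^-1)) =
    (fun u => expR (- (x / 2 * u)) *
    (expR (- (x / 2 * u)) * (- u / x - (x ^+ 2)^-1))).
  by apply/funext => u; rewrite mulrA -expRD; congr (expR _ * _); field.
apply: (@cvg0_mul_bounded _ _ _ _ _ (3 / x ^+ 2)); first exact: cvg_expRNM.
near=> u.
have u0 : 0 <= u by near: u; exact: nbhs_pinfty_ge.
have E1 : expR (- (x / 2 * u)) * (x / 2 * u) <= 1.
  rewrite expRN [leLHS]mulrC ler_pdivrMr ?expR_gt0// mul1r.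
  by apply: le_trans (expR_ge1Dx _); rewrite lerDr.
have E2 : expR (- (x / 2 * u)) <= 1.
  by rewrite -[leRHS]expR0 ler_expR oppr_le0; exact: mulr_ge0 (ltW x20) u0.
rewrite ler0_norm; last first.
  rewrite mulr_ge0_le0 ?expR_ge0// subr_le0 mulNr.
  by apply: (@le_trans _ _ 0); rewrite ?oppr_le0 ?divr_ge0 ?invr_ge0 ?exprn_ge0// ltW.
have -> : - (expR (- (x / 2 * u)) * (- u / x - (x ^+ 2)^-1)) =
  (2 * (expR (- (x / 2 * u)) * (x / 2 * u)) + expR (- (x / 2 * u))) / x ^+ 2.
  by field; rewrite gt_eqF.
rewrite ler_pM2r ?invr_gt0 ?exprn_gt0//; lra.
Unshelve. all: by end_near. Qed.

Lemma atan_kernel a : a != 0 ->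
  (\int[mu]_(u in `[0%R, +oo[) (a ^+ 2 / (u ^+ 2 + a ^+ 2))%:E = (`|a| * (pi / 2))%:E)%E.
Proof.
move=> a0; have na0 : 0 < `|a| by rewrite normr_gt0.
have d0 (u : R) : 0 < u ^+ 2 + a ^+ 2.
  by rewrite ltr_wpDl ?sqr_ge0// lt_neqAle sqr_ge0 eq_sym sqrf_eq0 a0.
rewrite [LHS](half_line_FTC (F := fun u => `|a| * atan (u / `|a|)) (l := `|a| * (pi / 2)) _ _ _ _).
- by rewrite mul0r atan0 mulr0 subr0.
- by move=> u _; rewrite divr_ge0 ?sqr_ge0// ltW.
- move=> u; apply: cvgM; first exact: cvg_cst.
  apply: cvgV; first by rewrite gt_eqF.
  by apply: cvgD; [exact: exprn_continuous|exact: cvg_cst].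
- move=> u; apply: is_derive_eq; rewrite /GRing.scale/=.
  have := d0 u; rewrite -(real_normK (num_real a)) => dd.
  by field; rewrite !gt_eqF.
apply: cvgM; first exact: cvg_cst.
apply: (@cvg_comp _ _ _ (fun x => x / `|a|) atan _ (+oo%R)); last exact: cvgy_atan.
by apply: gt0_cvgMly; [rewrite invr_gt0|exact: cvg_id].
Qed.

Let D : set R := `]0, +oo[%classic.

Let intD_indic (f : R -> R) : measurable_fun setT f ->
  (\int[mu]_(x in `[0%R, +oo[) (f x)%:E = \int[mu]_x (\1_D x * f x)%:E)%E.
Proof.
move=> mf; rewrite -integral_itv_obnd_cbnd; last first.
  exact/measurable_EFinP/measurable_funTS.
rewrite integral_mkcond; apply: eq_integral => x _.
by rewrite patchE indicE -/D; case: (x \in D); rewrite ?mul1r ?mul0r.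
Qed.

(** Dirichlet's integral in its nonnegative form: write [1 / x ^+ 2] as the
    Laplace transform of [u] and integrate in [x] first. *)
Lemma sinc_kernel a : L1 (fun x => (1 - cos (a * x)) / x ^+ 2) /\
  intR (fun x => (1 - cos (a * x)) / x ^+ 2) = pi * `|a|.
Proof.
have -> : pi * `|a| = 2 * (`|a| * (pi / 2)) by field.
have mc : measurable_fun setT (fun x : R => 1 - cos (a * x)).
  apply: continuous_measurable_fun; apply: (@cont_of_derive _ (fun x => a * sin (a * x))) => x.
  by apply: is_derive_eq; rewrite /GRing.scale/=; ring.
have mD : measurable D by exact: measurable_itv.
have mI : measurable_fun setT (\1_D : R -> R) by exact: measurable_indic.
apply: even_line.
- apply: measurable_funM => //; apply: meas_inv.
  exact: measurable_funX.
- by move=> x; rewrite divr_ge0 ?sqr_ge0// subr_ge0 cos_le1.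
- by move=> x; rewrite mulrN cosN sqrrN.
have [->|a0] := eqVneq a 0.
  rewrite normr0 mul0r; apply: integral0_eq => x _.
  by rewrite mul0r cos0 subrr mul0r.
have mL : measurable_fun setT (fun x : R => (1 - cos (a * x)) / x ^+ 2).
  apply: measurable_funM => //; apply: meas_inv.
  exact: measurable_funX.
have mA : measurable_fun setT (fun u : R => a ^+ 2 / (u ^+ 2 + a ^+ 2)).
  apply: measurable_funM => //; apply: meas_inv.
  by apply: measurable_funD => //; exact: measurable_funX.
have mE (x : R) : measurable_fun setT (fun u : R => u * expR (- (x * u))).
  apply: measurable_funM => //; apply: measurableT_comp => //.
  by apply: measurableT_comp => //; exact: measurable_funM.
have mEc (u : R) : measurable_fun setT (fun x : R => expR (- (u * x)) * (1 - cos (a * x))).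
  apply: measurable_funM => //; apply: measurableT_comp => //.
  by apply: measurableT_comp => //; exact: measurable_funM.
rewrite -(atan_kernel a0) !intD_indic//.
pose K (p : R * R) := \1_D p.1 * \1_D p.2 * (p.2 * expR (- (p.1 * p.2)) * (1 - cos (a * p.1))).
have mK : measurable_fun setT (fun p => (K p)%:E).
  apply/measurable_EFinP; apply: measurable_funM.
    by apply: measurable_funM; exact: (measurableT_comp mI).
  apply: measurable_funM; last exact: (measurableT_comp mc).
  apply: measurable_funM => //; apply: measurableT_comp => //.
  by apply: measurableT_comp => //; exact: measurable_funM.
have DP (x : R) : x \in D -> 0 < x by rewrite inE /D/= in_itv/= andbT.
have K0 p : (0 <= (K p)%:E)%E.
  rewrite lee_fin /K !indicE; have [p2|] := boolP (p.2 \in D); last by rewrite mulr0 mul0r.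
  rewrite mulr1 mulr_ge0// mulr_ge0 ?subr_ge0 ?cos_le1// mulr_ge0 ?expR_ge0//.
  exact/ltW/DP.
transitivity (\int[mu]_x \int[mu]_u (K (x, u))%:E)%E.
  apply: eq_integral => x _; rewrite indicE.
  have [xD|xD] := boolP (x \in D); last first.
    rewrite mul0r integral0_eq// => u _.
    by rewrite /K indicE (negbTE xD)/= !mul0r.
  have x0 := DP _ xD.
  rewrite mul1r mulrC EFinM -(inv_sqr_kernel x0) muleC.
  rewrite intD_indic// -ge0_integralZl ?lee_fin ?subr_ge0 ?cos_le1//; last 2 first.
  - by apply/measurable_EFinP; apply: measurable_funM => //; exact: mE.
  - move=> u _; rewrite lee_fin indicE.
    have [uD|_] := boolP (u \in D); last by rewrite mul0r.
    by rewrite mul1r mulr_ge0 ?expR_ge0// ltW// DP.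
  apply: eq_integral => u _; rewrite -EFinM.
  by rewrite /K/= [\1_D x]indicE xD mul1r; congr (_%:E); ring.
transitivity (\int[mu]_u \int[mu]_x (K (x, u))%:E)%E.
  exact: (@fubini_tonelli _ _ _ _ _ mu mu (fun p => (K p)%:E) mK K0).
apply: eq_integral => u _; rewrite indicE.
have [uD|uD] := boolP (u \in D); last first.
  rewrite mul0r integral0_eq// => x _.
  by rewrite /K/= [\1_D u]indicE (negbTE uD)/= mulr0 !mul0r.
have u0 := DP _ uD.
have dp : 0 < u ^+ 2 + a ^+ 2 by rewrite ltr_pwDl ?exprn_gt0 ?sqr_ge0.
rewrite mul1r (_ : _ / _ = u * (u^-1 - u / (u ^+ 2 + a ^+ 2))); last by field; rewrite !gt_eqF.
rewrite EFinM -(sinc_kernel_inner a u0) intD_indic// -ge0_integralZl ?lee_fin ?(ltW u0)//; last first.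
  by apply/measurable_EFinP; apply: measurable_funM => //; exact: mEc.
apply: eq_integral => x _; rewrite -EFinM.
by rewrite /K/= [\1_D u]indicE uD mulr1 (mulrC (x : R) u); congr (_%:E); ring.
Qed.

End HalfLine.

(** * The Hartley transform of integrable functions *)

Section Hartley1.
Context {R : realType}.
Local Notation mu := (@lebesgue_measure R).
Implicit Types (f g : R -> R) (a b c x xi : R).

(** The Hartley transform is real-valued, symmetric and, up to a factor, its own
    inverse, so that with it all identities below are between real functions. Its
    even and odd parts are the real part and minus the imaginary part of the
    Fourier transform. *)
Definition cas x := cos x + sin x.

Definition hart1 f xi := intR (fun x => f x * cas (x * xi)).

Lemma cas_le2 x : `|cas x| <= 2.
Proof.
have := cos_le1 x; have := cos_geN1 x; have := sin_le1 x; have := sin_geN1 x.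
by rewrite /cas ler_norml => ? ? ? ?; apply/andP; split; lra.
Qed.

Lemma continuous_cas : continuous cas.
Proof. by move=> x; apply: cvgD; [exact: continuous_cos|exact: continuous_sin]. Qed.

Lemma meas_cas : measurable_fun setT cas.
Proof. exact: continuous_measurable_fun continuous_cas. Qed.

Lemma meas_casM xi : measurable_fun setT (fun x => cas (x * xi)).
Proof. by apply: (measurableT_comp meas_cas); exact: measurable_funM. Qed.

Lemma casM_int f xi : L1 f -> L1 (fun x => f x * cas (x * xi)).
Proof.
move=> f1; under eq_fun do rewrite mulrC.
by apply: (@L1Ml _ 2) => //; [exact: meas_casM|move=> x; exact: cas_le2].
Qed.

Lemma hart1D f g xi : L1 f -> L1 g ->
  hart1 (fun x => f x + g x) xi = hart1 f xi + hart1 g xi.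
Proof.
move=> f1 g1; rewrite /hart1 -intRD; try exact: casM_int.
by apply: intR_ext => x; rewrite mulrDl.
Qed.

Lemma hart1Z c f xi : L1 f -> hart1 (fun x => c * f x) xi = c * hart1 f xi.
Proof.
move=> f1; rewrite /hart1 -intRZ; last exact: casM_int.
by apply: intR_ext => x; rewrite mulrA.
Qed.

Lemma hart1N f xi : L1 f -> hart1 (fun x => - f x) xi = - hart1 f xi.
Proof.
move=> f1; rewrite -mulN1r -hart1Z//; apply: intR_ext => x; rewrite mulN1r//.
Qed.

Lemma hart1B f g xi : L1 f -> L1 g ->
  hart1 (fun x => f x - g x) xi = hart1 f xi - hart1 g xi.
Proof. by move=> f1 g1; rewrite hart1D ?hart1N//; exact: L1N. Qed.

Lemma hart1_bound f xi : L1 f -> `|hart1 f xi| <= 2 * intR (fun x => `|f x|).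
Proof.
move=> f1; rewrite -intRZ; last exact: L1_norm.
apply: intR_norm_le; [exact: casM_int|by apply: L1Z; exact: L1_norm|].
by move=> x; rewrite normrM mulrC ler_wpM2r// cas_le2.
Qed.

Lemma meas_fst_fun (f : R -> R) : measurable_fun setT f ->
  measurable_fun setT (fun p : R * R => f p.1).
Proof. by move=> mf; apply: (measurableT_comp mf). Qed.

Lemma meas_snd_fun (f : R -> R) : measurable_fun setT f ->
  measurable_fun setT (fun p : R * R => f p.2).
Proof. by move=> mf; apply: (measurableT_comp mf). Qed.

Lemma meas_cas2 : measurable_fun setT (fun p : R * R => cas (p.1 * p.2)).
Proof. by apply: (measurableT_comp meas_cas); exact: measurable_funM. Qed.

(** Fubini for [f x * g y * cas (x * y)]: the transform is self-adjoint. *)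
Lemma hart1_adjoint f g : L1 f -> L1 g ->
  [/\ L1 (fun x => f x * hart1 g x), L1 (fun y => hart1 f y * g y) &
   intR (fun x => f x * hart1 g x) = intR (fun y => hart1 f y * g y)].
Proof.
move=> f1 g1; have mf := L1_meas f1; have mg := L1_meas g1.
have mK : measurable_fun setT (fun p : R * R => f p.1 * g p.2 * cas (p.1 * p.2)).
  apply: measurable_funM; last exact: meas_cas2.
  by apply: measurable_funM; [exact: meas_fst_fun|exact: meas_snd_fun].
have [] := @fubini_dom _ (fun x y => f x * g y * cas (x * y))
   (fun x => 2 * `|f x|) (fun y => `|g y|) mK.
- by apply: L1Z; exact: L1_norm.
- exact: L1_norm.
- move=> x y; rewrite !normrM [leLHS]mulrC -[leRHS]mulrA ler_wpM2r ?cas_le2 ?mulr_ge0//.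
move=> _ _.
have -> : (fun x => intR (fun y => f x * g y * cas (x * y))) =
          (fun x => f x * hart1 g x).
  apply/funext => x; rewrite /hart1 -intRZ; last exact: casM_int.
  by apply: intR_ext => y; rewrite mulrA (mulrC x).
suff -> : (fun y => intR (fun x => f x * g y * cas (x * y))) =
          (fun y => hart1 f y * g y) by [].
apply/funext => y; rewrite mulrC /hart1 -intRZ; last exact: casM_int.
by apply: intR_ext => x; rewrite mulrA (mulrC (f x)).
Qed.

(** Fubini's theorem gives measurability after multiplication by a positive
    integrable function. *)
Lemma meas_hart1 f : L1 f -> measurable_fun setT (hart1 f).
Proof.
move=> f1; have [w1 _] := @inv_oneDsqr R.
have [_ /L1_meas + _] := hart1_adjoint f1 w1.
have m2 : measurable_fun setT (fun x : R => 1 + x ^+ 2).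
  by apply: measurable_funD => //; exact: measurable_funX.
move=> /(measurable_funM m2); apply: eq_measurable_fun => x _.
by rewrite /= mulrCA divff ?mulr1// gt_eqF// ltr_pwDl// sqr_ge0.
Qed.

Lemma indic_itv a b : a <= b ->
  L1 (\1_`]a, b] : R -> R) /\ intR (\1_`]a, b] : R -> R) = b - a.
Proof.
move=> ab; have h : L1 (\1_`]a, b] : R -> R) by exact: integrable_indic_itv.
split => //; apply: EFin_inj; rewrite intRE//.
transitivity (mu `]a, b]%classic); first by rewrite integral_indic// setIT.
rewrite lebesgue_measure_itv/= lte_fin.
move: ab; rewrite le_eqVlt => /predU1P[->|->]; last by rewrite EFinB.
by rewrite ltxx subrr.
Qed.

Lemma hart1_indic a b xi : a <= b -> xi != 0 ->
  hart1 (\1_`]a, b]) xi =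
  (sin (b * xi) - cos (b * xi) - (sin (a * xi) - cos (a * xi))) / xi.
Proof.
rewrite le_eqVlt => /predU1P[->|ab] xi0.
  rewrite subrr mul0r set_itvoc0 /hart1 indic0.
  by under intR_ext do rewrite mul0r; rewrite intR0.
have dF x : is_derive x 1 (fun x => (sin (x * xi) - cos (x * xi)) / xi) (cas (x * xi)).
  by apply: is_derive_eq; rewrite /GRing.scale/= /cas; field.
have E : (\int[mu]_(x in `[a, b]) (cas (x * xi))%:E =
   ((sin (b * xi) - cos (b * xi)) / xi)%:E - ((sin (a * xi) - cos (a * xi)) / xi)%:E)%E.
  have cF : continuous (fun x => (sin (x * xi) - cos (x * xi)) / xi).
    exact: (cont_of_derive dF).
  apply: (@continuous_FTC2 _ _ (fun x => (sin (x * xi) - cos (x * xi)) / xi)) => //.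
  - apply: continuous_subspaceT => x.
    by apply: (@continuous_comp R R R (fun x => x * xi) cas); [exact: mulrr_continuous|exact: continuous_cas].
  - split.
    + by move=> x _; have [] := dF x.
    + by apply: cvg_at_right_filter; exact: cF.
    + by apply: cvg_at_left_filter; exact: cF.
  - by move=> x _; rewrite derive1E; exact: (@derive_val _ _ _ _ _ _ _ (dF x)).
apply: EFin_inj; rewrite /hart1 intRE; last first.
  by apply: casM_int; have [] := indic_itv (ltW ab).
rewrite mulrBl EFinB -E -integral_itv_obnd_cbnd; last first.
  by apply: measurable_funTS; apply/measurable_EFinP; exact: meas_casM.
rewrite [RHS]integral_mkcond; apply: eq_integral => x _.
by rewrite patchE indicE; case: (x \in _); rewrite ?mul1r ?mul0r.
Qed.

(** Generators of the step functions, normalized at [0]: the inner product of two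
    of them, or of their transforms, is a combination of [`|a|], [`|b|] and
    [`|a - b|]. *)
Definition sgnstep a : R -> R :=
  if 0 <= a then \1_`]0, a] else (fun x => - \1_`]a, 0] x).

Definition sgnstep_hat a xi := (sin (a * xi) - cos (a * xi) + 1) / xi.

Lemma sgnstep_int a : L1 (sgnstep a).
Proof.
rewrite /sgnstep; have [a0|a0] := leP 0 a; first by have [] := indic_itv a0.
by apply: L1N; have [] := indic_itv (ltW a0).
Qed.

Lemma hart1_sgnstep a xi : xi != 0 -> hart1 (sgnstep a) xi = sgnstep_hat a xi.
Proof.
move=> xi0; rewrite /sgnstep /sgnstep_hat; have [a0|/ltW a0] := leP 0 a.
  by rewrite hart1_indic// mul0r sin0 cos0; congr (_ / _); ring.
rewrite hart1N; last by have [] := indic_itv a0.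
by rewrite hart1_indic// mul0r sin0 cos0; field.
Qed.

Lemma sgnstep_L2 a : L2 (sgnstep a).
Proof.
split; first exact: L1_meas (sgnstep_int a).
have -> : (fun x => sgnstep a x ^+ 2) = (fun x => `|sgnstep a x|).
  apply/funext => x; rewrite /sgnstep; case: ifP => _;
  rewrite indicE; case: (x \in _); rewrite ?(mulr1n, mulr0n, sqrrN, normrN, expr1n, normr1, expr0n, normr0)//.
exact: L1_norm (sgnstep_int a).
Qed.

Lemma ip_sgnstep a b : ip (sgnstep a) (sgnstep b) = (`|a| + `|b| - `|a - b|) / 2.
Proof.
wlog : a b / b <= a.
  move=> W; have [ba|/ltW ab] := leP b a; first exact: W.
  by rewrite ipC W// (distrC a) (addrC `|a|).
move=> ba; rewrite /ip /sgnstep (ger0_norm (_ : 0 <= a - b)) ?subr_ge0//.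
have [a0|a0] := leP 0 a; have [b0|b0] := leP 0 b.
- rewrite (_ : (fun x => _) = (\1_`]0, b] : R -> R)).
    by rewrite (indic_itv b0).2 !ger0_norm//; field.
  apply/funext => x; rewrite !indicE -natrM mulnb; congr (_%:R); congr nat_of_bool.
  apply/andP/idP; rewrite !inE/= !in_itv/=; first by case.
  by move=> /andP[x0 xb]; rewrite x0 xb (le_trans xb).
- rewrite (_ : (fun x => _) = (fun=> 0)).
    by rewrite intR0 ger0_norm// ltr0_norm//; field.
  apply/funext => x; rewrite !indicE mulrN -natrM mulnb.
  suff -> : (x \in `]0, a]%classic) && (x \in `]b, 0]%classic) = false by rewrite mulr0n oppr0.
  apply/negbTE/negP => /andP[]; rewrite !inE/= !in_itv/= => /andP[+ _] /andP[_].
  by move=> x0 /(lt_le_trans x0); rewrite ltxx.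
- by have := le_lt_trans ba a0; rewrite ltNge b0.
- rewrite (_ : (fun x => _) = (\1_`]a, 0] : R -> R)).
    by rewrite (indic_itv (ltW a0)).2 !ltr0_norm//; field.
  apply/funext => x; rewrite !indicE mulrNN -natrM mulnb; congr (_%:R); congr nat_of_bool.
  apply/andP/idP; rewrite !inE/= !in_itv/=; first by case.
  by move=> /andP[x0 xb]; rewrite x0 xb (le_lt_trans ba).
Qed.

Lemma sgnstep_hat_L2 a : L2 (sgnstep_hat a).
Proof.
have m : measurable_fun setT (sgnstep_hat a).
  apply: measurable_funM; last exact: meas_inv.
  apply: measurable_funD => //; apply: measurable_funB.
    by apply: (measurableT_comp (continuous_measurable_fun (@continuous_sin R))); exact: measurable_funM.
  by apply: (measurableT_comp (continuous_measurable_fun (@continuous_cos R))); exact: measurable_funM.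
split => //; have [k1 _] := @sinc_kernel R a.
apply: (@L1_le _ _ (fun x => 4 * ((1 - cos (a * x)) / x ^+ 2))).
- exact: measurable_funX.
- exact: L1Z.
move=> x; rewrite ger0_norm ?sqr_ge0// /sgnstep_hat exprMn exprVn mulrA.
rewrite ler_wpM2r ?invr_ge0 ?sqr_ge0//.
have := cos2Dsin2 (a * x); set co := cos _; set si := sin _ => E.
have := sqr_ge0 (1 - co - si); nra.
Qed.

(** Adding up the integrand at [x] and at [- x] leaves the kernels
    [(1 - cos (c * x)) / x ^+ 2] only. *)
Lemma ip_sgnstep_hat a b :
  ip (sgnstep_hat a) (sgnstep_hat b) = 2 * pi * ip (sgnstep a) (sgnstep b).
Proof.
rewrite ip_sgnstep; have [ka1 kaE] := @sinc_kernel R a.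
have [kb1 kbE] := @sinc_kernel R b; have [kc1 kcE] := @sinc_kernel R (a - b).
have L := L2M (sgnstep_hat_L2 a) (sgnstep_hat_L2 b).
have : intR (fun x => sgnstep_hat a x * sgnstep_hat b x +
     sgnstep_hat a (- x) * sgnstep_hat b (- x)) =
  2 * ip (sgnstep_hat a) (sgnstep_hat b).
  rewrite intRD//; last exact: L1_refl L.
  by rewrite (intR_refl (L1_meas L)) /ip; ring.
rewrite (_ : (fun x => _) = (fun x => 2 * ((1 - cos (a * x)) / x ^+ 2 +
    (1 - cos (b * x)) / x ^+ 2 - (1 - cos ((a - b) * x)) / x ^+ 2))).
  rewrite intRZ; last by apply: L1B => //; exact: L1D.
  by rewrite intRB// ?intRD// ?kaE ?kbE ?kcE; [nra|exact: L1D].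
apply/funext => x; rewrite /sgnstep_hat !mulrN !sinN !cosN.
rewrite (_ : (a - b) * x = a * x - b * x); last by ring.
rewrite cosB.
have [->|x0] := eqVneq x 0; first by rewrite expr0n/= oppr0 invr0 !mulr0 addr0 subr0 mulr0.
by field.
Qed.

End Hartley1.

(** * Density of step functions *)

Section StepFunctions.
Context {R : realType}.
Local Notation mu := (@lebesgue_measure R).
Implicit Types (f g : R -> R) (a b c x xi : R) (s t : seq (R * R)).

Definition stepf s x := \sum_(p <- s) p.1 * sgnstep p.2 x.
Definition stepf_hat s x := \sum_(p <- s) p.1 * sgnstep_hat p.2 x.

Lemma stepf_nil : stepf [::] = (fun=> 0).
Proof. by apply/funext => x; rewrite /stepf big_nil. Qed.

Lemma stepf_hat_nil : stepf_hat [::] = (fun=> 0).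
Proof. by apply/funext => x; rewrite /stepf_hat big_nil. Qed.

Lemma stepf_cons p s : stepf (p :: s) = (fun x => p.1 * sgnstep p.2 x + stepf s x).
Proof. by apply/funext => x; rewrite /stepf big_cons. Qed.

Lemma stepf_hat_cons p s :
  stepf_hat (p :: s) = (fun x => p.1 * sgnstep_hat p.2 x + stepf_hat s x).
Proof. by apply/funext => x; rewrite /stepf_hat big_cons. Qed.

Lemma stepf_cat s t x : stepf (s ++ t) x = stepf s x + stepf t x.
Proof. by rewrite /stepf big_cat. Qed.

Definition scale_step c s := [seq (c * p.1, p.2) | p <- s].

Lemma stepf_scale c s x : stepf (scale_step c s) x = c * stepf s x.
Proof. by rewrite /stepf big_map mulr_sumr; apply: eq_bigr => p _; rewrite mulrA. Qed.

Lemma stepf_L1 s : L1 (stepf s).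
Proof.
elim: s => [|p s IH]; first by rewrite stepf_nil; exact: L1_0.
by rewrite stepf_cons; apply: L1D => //; apply: L1Z; exact: sgnstep_int.
Qed.

Lemma stepf_L2 s : L2 (stepf s).
Proof.
elim: s => [|p s IH]; first by rewrite stepf_nil; exact: L2_0.
by rewrite stepf_cons; apply: L2D => //; apply: L2Z; exact: sgnstep_L2.
Qed.

Lemma stepf_hat_L2 s : L2 (stepf_hat s).
Proof.
elim: s => [|p s IH]; first by rewrite stepf_hat_nil; exact: L2_0.
by rewrite stepf_hat_cons; apply: L2D => //; apply: L2Z; exact: sgnstep_hat_L2.
Qed.

Lemma hart1_stepf s xi : xi != 0 -> hart1 (stepf s) xi = stepf_hat s xi.
Proof.
move=> xi0; elim: s => [|p s IH].
  by rewrite stepf_nil stepf_hat_nil /hart1; under intR_ext do rewrite mul0r; rewrite intR0.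
rewrite stepf_cons stepf_hat_cons hart1D ?IH ?hart1Z ?hart1_sgnstep//.
- exact: sgnstep_int.
- by apply: L1Z; exact: sgnstep_int.
- exact: stepf_L1.
Qed.

Lemma ip_stepf_hat s t :
  ip (stepf_hat s) (stepf_hat t) = 2 * pi * ip (stepf s) (stepf t).
Proof.
have H0 f : ip (fun=> 0) f = 0.
  by rewrite /ip; under intR_ext do rewrite mul0r; rewrite intR0.
have E a : ip (stepf_hat s) (sgnstep_hat a) = 2 * pi * ip (stepf s) (sgnstep a).
  elim: s => [|p s IH]; first by rewrite stepf_nil stepf_hat_nil !H0 mulr0.
  rewrite stepf_cons stepf_hat_cons !ipDl ?IH ?ipZl ?ip_sgnstep_hat; first by ring.
  all: do ?[exact: sgnstep_L2|exact: sgnstep_hat_L2|exact: stepf_L2|exact: stepf_hat_L2|apply: L2Z].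
elim: t => [|p t IH]; first by rewrite stepf_nil stepf_hat_nil !(ipC _ (fun=> 0)) !H0 mulr0.
rewrite stepf_cons stepf_hat_cons !ipDr ?IH ?ipZr ?E; first by ring.
all: do ?[exact: sgnstep_L2|exact: sgnstep_hat_L2|exact: stepf_L2|exact: stepf_hat_L2|apply: L2Z].
Qed.

(** Both norms are needed at once: closeness in L1 controls the transform
    pointwise, closeness in L2 carries the isometry. *)
Definition step_approx f := forall e, 0 < e -> exists s,
  intR (fun x => `|f x - stepf s x|) <= e /\ nrm (fun x => f x - stepf s x) <= e.

Lemma step_approx_closed f : L1 f -> L2 f ->
  (forall e, 0 < e -> exists g, [/\ L1 g, L2 g, step_approx g,
     intR (fun x => `|f x - g x|) <= e & nrm (fun x => f x - g x) <= e]) ->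
  step_approx f.
Proof.
move=> f1 f2 H e e0; have e2 : 0 < e / 2 by rewrite divr_gt0.
have [g [g1 g2 /(_ _ e2) [s [s1 s2]] fg1 fg2]] := H _ e2.
have t1 := stepf_L1 s; have t2 := stepf_L2 s.
exists s; split; rewrite [leRHS](_ : e = e / 2 + e / 2); try by field.
  apply: le_trans (lerD fg1 s1); rewrite -intRD; try by apply: L1_norm; exact: L1B.
  apply: intR_le; first by apply: L1_norm; exact: L1B.
    by apply: L1D; apply: L1_norm; exact: L1B.
  by move=> x; apply: le_trans (ler_normD _ _); rewrite addrA subrK.
by apply: le_trans (nrm_tri f2 g2 t2) _; exact: lerD.
Qed.

(** Dominated convergence, in both norms. *)
Lemma step_approx_lim f (F : nat -> R -> R) g : L1 g -> L2 g -> L1 f -> L2 f ->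
  (forall n, L1 (F n)) -> (forall n, L2 (F n)) -> (forall n, step_approx (F n)) ->
  (forall n x, `|f x - F n x| <= g x) ->
  (forall x, F n x @[n --> \oo] --> f x) -> step_approx f.
Proof.
move=> g1 g2 f1 f2 F1 F2 FA Fg Ff; apply: step_approx_closed => // e e0.
have C0 x : f x - F n x @[n --> \oo] --> 0.
  by rewrite -(subrr (f x)); apply: cvgB; [exact: cvg_cst|exact: Ff].
have C1 : intR (fun x => `|f x - F n x|) @[n --> \oo] --> 0.
  rewrite -(@intR0 R); apply: (intR_cvg (g := g)) => //.
  - by move=> n; apply: measurableT_comp => //; apply: L1_meas; exact: L1B.
  - by apply: aeW => x; rewrite -(normr0 R); apply: cvg_norm; exact: C0.
  - by move=> n x; rewrite normr_id.
have C2 : ip (fun x => f x - F n x) (fun x => f x - F n x) @[n --> \oo] --> 0.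
  rewrite -(@intR0 R); apply: (intR_cvg (g := fun x => g x ^+ 2)) => //.
  - by move=> n; apply: L1_meas; apply: L2M; exact: L2B.
  - exact: L2_sq.
  - by apply: aeW => x; rewrite -(mulr0 (0:R)); apply: cvgM; exact: C0.
  - move=> n x; rewrite -expr2 normrX lerXn2r ?nnegrE//.
    exact: le_trans (normr_ge0 _) (Fg n x).
have e20 : 0 < e ^+ 2 by rewrite exprn_gt0.
move/cvgrPdist_le : C1 => /(_ _ e0) C1; move/cvgrPdist_le : C2 => /(_ _ e20) C2.
have [N _ HN] : \forall n \near \oo, `|0 - intR (fun x => `|f x - F n x|)| <= e /\
   `|0 - ip (fun x => f x - F n x) (fun x => f x - F n x)| <= e ^+ 2.
  by near=> n; split; near: n.
have [h1 h2] := HN N (leqnn N).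
exists (F N); split => //.
  by move: h1; rewrite sub0r normrN ger0_norm//; exact: intR_ge0.
apply: nrm_le; first exact: ltW.
by move: h2; rewrite sub0r normrN ger0_norm// ip_ge0.
Unshelve. all: by end_near. Qed.

Lemma step_approx_stepf s : step_approx (stepf s).
Proof.
move=> e e0; exists s; rewrite (_ : (fun x => _) = (fun=> 0)); last first.
  by apply/funext => x; rewrite subrr normr0.
rewrite intR0; split; first exact: ltW.
rewrite (_ : (fun x => _) = (fun=> 0)); last by apply/funext => x; rewrite subrr.
by rewrite /nrm /ip; under intR_ext do rewrite mulr0; rewrite intR0 sqrtr0 ltW.
Qed.

Lemma indic_stepf a b : a <= b -> exists s, stepf s =1 \1_`]a, b].
Proof.
move=> ab; exists [:: (1, b); (- 1, a)] => x.
rewrite !stepf_cons stepf_nil/= mul1r mulN1r addr0 /sgnstep.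
have E (c d y : R) : \1_`]c, d] y = ((c < y) && (y <= d))%:R :> R.
  by rewrite indicE; congr (_%:R); congr nat_of_bool; apply/idP/idP; rewrite inE/= in_itv.
have [b0|b0] := leP 0 b; have [a0|a0] := leP 0 a; rewrite !E !(leNgt x).
all: by case: (ltP 0 x) => ?; case: (ltP a x) => ?; case: (ltP b x) => ? /=; lra.
Qed.

Let indicE' (c d y : R) : \1_`]c, d] y = ((c < y) && (y <= d))%:R :> R.
Proof.
by rewrite indicE; congr (_%:R); congr nat_of_bool; apply/idP/idP; rewrite inE/= in_itv.
Qed.

(** The left-endpoint Riemann approximation of [g] on a regular grid. *)
Lemma riemann_step g a d k : 0 <= d -> exists s,
  [/\ forall x, x <= a -> stepf s x = 0,
      forall x, a + k%:R * d < x -> stepf s x = 0 &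
      forall x, a < x -> x <= a + k%:R * d ->
        exists y, [/\ stepf s x = g y, y < x & x <= y + d]].
Proof.
move=> d0; elim: k => [|k [s [H1 H2 H3]]].
  exists [::]; rewrite stepf_nil; split => // x ax; rewrite mul0r addr0 => xa.
  by have := lt_le_trans ax xa; rewrite ltxx.
have kd : a + k%:R * d <= a + k.+1%:R * d.
  by rewrite lerD2l ler_wpM2r// ler_nat.
have ak : a <= a + k%:R * d by rewrite lerDl mulr_ge0.
have [t tE] := indic_stepf kd.
exists (scale_step (g (a + k%:R * d)) t ++ s).
have E x : stepf (scale_step (g (a + k%:R * d)) t ++ s) x =
    g (a + k%:R * d) * ((a + k%:R * d < x) && (x <= a + k.+1%:R * d))%:R + stepf s x.
  by rewrite stepf_cat stepf_scale tE indicE'.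
split => x.
- move=> xa; rewrite E H1// addr0 (_ : a + k%:R * d < x = false) ?mulr0//.
  by apply/negbTE; rewrite -leNgt (le_trans xa).
- move=> xk; rewrite E H2 ?addr0; last exact: le_lt_trans xk.
  by rewrite (leNgt x) xk andbF mulr0.
move=> ax xk; have [xk'|kx] := leP x (a + k%:R * d).
  have [y [yE y1 y2]] := H3 x ax xk'; exists y; split => //.
  by rewrite E (ltNge _ x) xk'/= mulr0 add0r.
exists (a + k%:R * d); split => //.
  by rewrite E kx xk/= mulr1 H2// addr0.
by move: xk; rewrite -natr1 mulrDl mul1r addrA.
Qed.

Lemma L1L2_indic c a b f : a <= b -> measurable_fun setT f ->
  (forall x, `|f x| <= c * \1_`]a, b] x) -> L1 f /\ L2 f.
Proof.
move=> ab mf fc; have [i1 _] := indic_itv ab.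
split; first by apply: (L1_le mf _ fc); exact: L1Z.
split => //; apply: (@L1_le _ _ (fun x => c ^+ 2 * \1_`]a, b] x)).
- exact: measurable_funX.
- exact: L1Z.
move=> x; have := fc x; rewrite normrX indicE'; case: (_ && _).
  rewrite !mulr1 => fx; rewrite lerXn2r ?nnegrE//.
  exact: le_trans (normr_ge0 _) fx.
rewrite !mulr0 normr_le0 => /eqP->; rewrite normr0 expr0n//.
Qed.

(** Riemann approximations converge pointwise, by continuity. *)
Lemma step_approx_continuous g a b c : a < b -> continuous g ->
  (forall x, `|g x| <= c) -> step_approx (fun x => \1_`]a, b] x * g x).
Proof.
move=> ab cg gc; have c0 : 0 <= c := le_trans (normr_ge0 _) (gc 0).
pose d n : R := (b - a) / n.+1%:R.
have d0 n : 0 <= d n by rewrite divr_ge0// subr_ge0 ltW.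
have db n : a + n.+1%:R * d n = b by rewrite /d; field; rewrite nat1r pnatr_eq0.
have [s sP] := choice (fun n => riemann_step g a n.+1 (d0 n)).
have i1 := (indic_itv (ltW ab)).1.
have mg : measurable_fun setT (fun x => \1_`]a, b] x * g x).
  apply: measurable_funM; first exact: L1_meas.
  exact: continuous_measurable_fun.
have gb x : `|\1_`]a, b] x * g x| <= c * \1_`]a, b] x.
  rewrite normrM mulrC (ger0_norm (x := \1__ _)) ?indicE ?ler0n//.
  by rewrite ler_wpM2r.
have sb n x : `|stepf (s n) x| <= c * \1_`]a, b] x.
  have [H1 H2 H3] := sP n; rewrite indicE'.
  have [ax|xa] := ltP a x; last by rewrite H1// normr0 mulr0.
  have [xb|bx] := leP x b; last by rewrite H2 ?db// normr0 mulr0.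
  by rewrite /= mulr1; have [|y [-> _ _]] := H3 x ax; rewrite ?db.
have [G1 G2] := @L1L2_indic (2 * c) a b (fun x => 2 * c * \1_`]a, b] x) (ltW ab)
  (L1_meas (L1Z _ i1)) (fun x => ltac:(by rewrite ger0_norm// mulr_ge0 ?mulr_ge0// indicE ler0n)).
have [f1 f2] := L1L2_indic (ltW ab) mg gb.
apply: (@step_approx_lim _ (fun n => stepf (s n)) (fun x => 2 * c * \1_`]a, b] x)) => //.
- by move=> n; exact: stepf_L1.
- by move=> n; exact: stepf_L2.
- by move=> n; exact: step_approx_stepf.
- move=> n x; apply: le_trans (ler_normB _ _) _.
  by rewrite [leRHS](_ : _ = c * \1_`]a, b] x + c * \1_`]a, b] x); [exact: lerD|ring].
move=> x; rewrite indicE'.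
have [ax|xa] := ltP a x; last first.
  rewrite mul0r (_ : (fun n => _) = (fun=> 0)); first exact: cvg_cst.
  by apply/funext => n; have [H1 _ _] := sP n; rewrite H1.
have [xb|bx] := leP x b; last first.
  rewrite mul0r (_ : (fun n => _) = (fun=> 0)); first exact: cvg_cst.
  by apply/funext => n; have [_ H2 _] := sP n; rewrite H2 ?db.
rewrite mul1r; apply/cvgrPdist_le => e e0.
have /cvgrPdist_le/(_ _ e0) := cg x; rewrite near_simpl => /nbhs_ballP[r /= r0 Hr].
have : (b - a) * n.+1%:R^-1 @[n --> \oo] --> (b - a) * 0.
  by apply: cvgM; [exact: cvg_cst|exact: cvg_harmonic].
rewrite mulr0 => /cvgrPdist_lt/(_ _ r0); apply: filterS => n.
rewrite sub0r normrN ger0_norm -/(d n) ?d0// => dr.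
have [_ _ H3] := sP n; have [|y [-> y1 y2]] := H3 x ax; first by rewrite db.
by apply: Hr; rewrite /ball/= ger0_norm ?subr_ge0 ?ltW//; lra.
Qed.

(** A continuous function close to [f] in L1 and clipped to the bounds of [f] is
    also close to it in L2. *)
Lemma step_approx_bounded f a b c : a < b -> measurable_fun setT f ->
  (forall x, `|f x| <= c * \1_`]a, b] x) -> step_approx f.
Proof.
move=> ab mf fc.
have [f1 f2] := L1L2_indic (ltW ab) mf fc.
have [c0|c0] := ltP c 0.
  suff -> : f = stepf [::] by exact: step_approx_stepf.
  rewrite stepf_nil; apply/funext => x; apply/eqP; rewrite -normr_le0.
  by apply: le_trans (fc x) _; rewrite mulr_le0_ge0 ?(ltW c0)//.
apply: step_approx_closed => // e e0.
have mE : measurable (`]a, b] : set R) by exact: measurable_itv.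
have Efin : (mu `]a, b]%classic < +oo)%E.
  by rewrite lebesgue_measure_itv/= lte_fin ab -EFinB ltry.
have fE : mu.-integrable `]a, b] (EFin \o f) by exact: integrableS f1.
have [g [cg ig gf]] := approximation_continuous_integrable mE Efin fE.
pose h n x := Num.max (- c) (Num.min c (g n x)).
have ch n : continuous (h n).
  apply: (@max_fun_continuous _ _ _ (fun=> - c)); first by move=> x; exact: cvg_cst.
  apply: (@min_fun_continuous _ _ _ (fun=> c)) => //; by move=> x; exact: cvg_cst.
have hc n x : `|h n x| <= c.
  by rewrite ler_norml /h le_max lexx/= ge_max ge_min lexx/= andbT; lra.
have hf n x : `|f x - \1_`]a, b] x * h n x| <= `|f x - g n x| * \1_`]a, b] x.
  have := fc x; rewrite indicE'; case: (_ && _); last first.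
    by rewrite !(mul0r, mulr0) normr_le0 => /eqP ->; rewrite subr0 normr0.
  rewrite mul1r !mulr1 => fx; rewrite /h.
  move: fx; rewrite ler_norml => /andP[f3 f4].
  have [h1|h1] := leP c (g n x).
    have -> : Num.max (- c) c = c by apply: max_r; lra.
    rewrite !ler0_norm; lra.
  have [h2|h2] := leP (- c) (g n x); first by [].
  rewrite !ger0_norm; lra.
have hb n x : `|\1_`]a, b] x * h n x| <= c * \1_`]a, b] x.
  rewrite indicE'; case: (_ && _); rewrite ?mul0r ?normr0 ?mulr0// mul1r mulr1.
  exact: hc.
have mh n : measurable_fun setT (fun x => \1_`]a, b] x * h n x).
  apply: measurable_funM; first exact: L1_meas (indic_itv (ltW ab)).1.
  exact: continuous_measurable_fun.
have hL n := L1L2_indic (ltW ab) (mh n) (hb n).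
pose eta := Num.min e (e ^+ 2 / (2 * c + 1)).
have eta0 : 0 < eta.
  by rewrite lt_min e0 divr_gt0 ?exprn_gt0// ltr_wpDl// mulr_ge0.
have [n Hn] : exists n, (\int[mu]_(z in `]a, b]) `|(f z - g n z)%:E| <= eta%:E)%E.
  move/fine_cvgP : gf => [[N1 _ FN]] /cvgrPdist_le/(_ _ eta0)[N2 _ GN].
  exists (maxn N1 N2); have := GN _ (leq_maxr N1 N2); have := FN _ (leq_maxl N1 N2).
  move=> /= fn; rewrite sub0r normrN => /(le_trans (ler_norm _)).
  by rewrite -lee_fin fineK.
have D1 := L1B f1 (hL n).1; have D2 := L2B f2 (hL n).2.
have I1 : intR (fun x => `|f x - \1_`]a, b] x * h n x|) <= eta.
  rewrite -lee_fin intRE; last exact: L1_norm.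
  apply: le_trans Hn; rewrite [leRHS]integral_mkcond; apply: ge0_le_integral => //.
  - by apply/measurable_EFinP; apply: measurableT_comp => //; exact: L1_meas.
  - apply/(measurable_restrictT _ mE); apply: measurableT_comp => //.
    apply/measurable_EFinP/measurable_funTS; apply: measurable_funB => //.
    exact: continuous_measurable_fun.
  move=> x _; rewrite patchE; have := hf n x; rewrite indicE.
  by case: (x \in _); rewrite ?mulr1 ?mulr0 lee_fin.
have [q1 q2] := hL n.
exists (fun x => \1_`]a, b] x * h n x); split => //.
- exact: (step_approx_continuous ab (ch n) (hc n)).
- by apply: le_trans I1 _; rewrite /eta ge_min lexx.
apply: nrm_le; first exact: ltW.
have cp : 0 < 2 * c + 1 by rewrite ltr_wpDl// mulr_ge0.
apply: (@le_trans _ _ ((2 * c) * intR (fun x => `|f x - \1_`]a, b] x * h n x|))).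
  rewrite -intRZ; last exact: L1_norm.
  apply: intR_le; [exact: L2M|by apply: L1Z; exact: L1_norm|move=> x].
  rewrite -expr2 -real_normK ?num_real// expr2 ler_wpM2r//.
  apply: le_trans (ler_normB _ _) _; rewrite mulr_natl mulr2n; apply: lerD.
    apply: le_trans (fc x) _; rewrite indicE'; case: (_ && _); rewrite ?mulr1 ?mulr0//.
  apply: le_trans (hb n x) _; rewrite indicE'; case: (_ && _); rewrite ?mulr1 ?mulr0//.
apply: (@le_trans _ _ ((2 * c) * (e ^+ 2 / (2 * c + 1)))).
  rewrite ler_wpM2l ?mulr_ge0//; apply: le_trans I1 _.
  by rewrite /eta ge_min lexx orbT.
rewrite mulrA ler_pdivrMr//; have := sqr_ge0 e; nra.
Qed.

(** Cut off the domain and the values. *)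
Theorem step_dense f : L1 f -> L2 f -> step_approx f.
Proof.
move=> f1 f2; have mf := L1_meas f1.
pose c n : R := n.+1%:R.
pose F n x := \1_`]- c n, c n] x * Num.max (- c n) (Num.min (c n) (f x)).
have c0 n : 0 < c n by rewrite ltr0n.
have mF n : measurable_fun setT (F n).
  have [i1 _] := @indic_itv R (- c n) (c n) ltac:(rewrite ge0_cp ?ltW//).
  apply: measurable_funM; first exact: L1_meas.
  by apply: measurable_maxr => //; exact: measurable_minr.
have Fb n x : `|F n x| <= c n * \1_`]- c n, c n] x.
  rewrite /F indicE'; case: (_ && _); rewrite ?mul0r ?normr0 ?mulr0// mul1r mulr1.
  by rewrite ler_norml le_max lexx/= ge_max ge_min lexx/= andbT; have := c0 n; lra.
have Ff n x : `|f x - F n x| <= `|f x|.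
  rewrite /F indicE'; case: (_ && _); rewrite ?mul0r ?subr0// mul1r.
  have cn := c0 n.
  have [h1|h1] := leP (c n) (f x).
    have -> : Num.max (- c n) (c n) = c n by apply: max_r; lra.
    rewrite !ger0_norm; lra.
  have [h2|h2] := leP (- c n) (f x); first by rewrite subrr normr0.
  rewrite !ler0_norm; lra.
have cc n : - c n < c n by have := c0 n; lra.
have FL n := L1L2_indic (ltW (cc n)) (mF n) (Fb n).
apply: (@step_approx_lim f F (fun x => `|f x|)) => //.
- exact: L1_norm.
- apply: L2_le f2 _; [exact: measurableT_comp|by move=> x; rewrite normr_id].
- by move=> n; have [] := FL n.
- by move=> n; have [] := FL n.
- by move=> n; exact: step_approx_bounded (cc n) (mF n) (Fb n).
move=> x; apply: cvg_near_cst.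
have [N _ HN] : \forall n \near \oo, `|x| + `|f x| <= n%:R by exact: nbhs_infty_ger.
exists N => // n /HN /= xc.
have cn : c n = n%:R + 1 by rewrite /c natr1.
have := normr_ge0 x; have := normr_ge0 (f x) => h1 h2.
have /ler_normlP[x1 x2] : `|x| <= n%:R by lra.
have /ler_normlP[f3 f4] : `|f x| <= n%:R by lra.
rewrite /F indicE' (_ : (_ && _) = true); last by apply/andP; split; lra.
by rewrite mul1r min_r ?max_r//; lra.
Qed.

End StepFunctions.

(** * Plancherel's theorem *)

Section Plancherel1.
Context {R : realType}.
Local Notation mu := (@lebesgue_measure R).
Implicit Types (f g : R -> R).

Let s2pi : R := Num.sqrt (2 * pi).

Let nrm_stepf_hatB (s t : seq (R * R)) :
  nrm (fun x => stepf_hat s x - stepf_hat t x) = s2pi * nrm (fun x => stepf s x - stepf t x).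
Proof.
rewrite /s2pi /nrm -sqrtrM ?mulr_ge0 ?pi_ge0//.
have s1 := stepf_L2 s; have s2 := stepf_L2 t.
have s3 := stepf_hat_L2 s; have s4 := stepf_hat_L2 t.
rewrite !ipBl ?ipBr//; try exact: L2B.
by rewrite !ip_stepf_hat; congr Num.sqrt; ring.
Qed.

Let nrm_stepf_hat (s : seq (R * R)) : nrm (stepf_hat s) = s2pi * nrm (stepf s).
Proof. by rewrite /s2pi /nrm -sqrtrM ?mulr_ge0 ?pi_ge0// ip_stepf_hat. Qed.

Lemma ae_neq0 : {ae mu, forall x : R, x != 0}.
Proof.
exists [set 0]; split; [exact: measurable_set1|exact: lebesgue_measure_set1|].
by move=> x /= /negP/negPn/eqP.
Qed.

(** The transforms of approximating step functions are Cauchy in L2 and converge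
    pointwise, so Fatou's lemma carries the isometry over to the limit. *)
Lemma hart1_isometry f : L1 f -> L2 f ->
  L2 (hart1 f) /\ nrm (hart1 f) = Num.sqrt (2 * pi) * nrm f.
Proof.
move=> f1 f2; rewrite -/s2pi.
have s0 : 0 <= s2pi by exact: sqrtr_ge0.
have e0 n : 0 < (n.+1%:R)^-1 :> R by rewrite invr_gt0.
have [s sP] := choice (fun n => step_dense f1 f2 (e0 n)).
have t1 n := stepf_L1 (s n); have t2 n := stepf_L2 (s n).
have h2 n := stepf_hat_L2 (s n).
have inv_cvg : (n.+1%:R^-1 : R) @[n --> \oo] --> 0 by exact: cvg_harmonic.
have P : {ae mu, forall x, stepf_hat (s n) x @[n --> \oo] --> hart1 f x}.
  apply: filterS ae_neq0 => x x0.
  have -> : (fun n => stepf_hat (s n) x) = (fun n => hart1 (stepf (s n)) x).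
    by apply/funext => n; rewrite hart1_stepf.
  apply/cvgrPdist_le => e e_gt0; have e2 : 0 < e / 2 by rewrite divr_gt0.
  move/cvgrPdist_le : inv_cvg => /(_ _ e2); apply: filterS => n.
  rewrite sub0r normrN ger0_norm// => ne.
  rewrite -hart1B//; apply: le_trans (hart1_bound _ (L1B f1 (t1 n))) _.
  have [i1 _] := sP n; rewrite [leRHS](_ : e = 2 * (e / 2)); last by field.
  by rewrite ler_pM2l//; exact: le_trans i1 ne.
have K n : L2 (fun x => hart1 f x - stepf_hat (s n) x) /\
    nrm (fun x => hart1 f x - stepf_hat (s n) x) <= 2 * s2pi * n.+1%:R^-1.
  have [] := @intR_fatou _ (fun l x => (stepf_hat (s l) x - stepf_hat (s n) x) ^+ 2)
    (fun x => (hart1 f x - stepf_hat (s n) x) ^+ 2) ((2 * s2pi * n.+1%:R^-1) ^+ 2).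
  - by move=> l; apply: L2_sq; exact: L2B.
  - by move=> l x; exact: sqr_ge0.
  - by apply: measurable_funX; apply: measurable_funB; [exact: meas_hart1|exact: L2_meas].
  - apply: filterS P => x Px; rewrite expr2; under eq_fun do rewrite expr2.
    by apply: cvgM; apply: cvgB => //; exact: cvg_cst.
  - by move=> x; exact: sqr_ge0.
  - exists n => //= l nl; rewrite -ip_sqr -nrm_sqr lerXn2r ?nnegrE ?nrm_ge0 ?mulr_ge0//.
    rewrite nrm_stepf_hatB [leRHS]mulrAC [leRHS]mulrC ler_wpM2l//.
    have [_ l1] := sP l; have [_ n1] := sP n.
    apply: le_trans (nrm_tri (t2 l) f2 (t2 n)) _.
    rewrite nrm_sym mulr_natl mulr2n; apply: lerD => //; apply: le_trans l1 _.
    by rewrite lef_pV2 ?posrE// ler_nat.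
  move=> k1 k2; split.
    by split => //; apply: measurable_funB; [exact: meas_hart1|exact: L2_meas].
  by apply: nrm_le; [rewrite !mulr_ge0|rewrite ip_sqr].
have H2 : L2 (hart1 f).
  have := L2D (K 0%N).1 (h2 0%N); congr L2; apply/funext => x; ring.
split => //; apply/eqP; rewrite -subr_eq0 -normr_le0.
apply/ler_addgt0Pr => e e_gt0; rewrite add0r.
have C : (3 * s2pi) * n.+1%:R^-1 @[n --> \oo] --> (3 * s2pi) * 0.
  by apply: cvgM => //; exact: cvg_cst.
rewrite mulr0 in C; move/cvgrPdist_le : C => /(_ _ e_gt0)[N _ /(_ N (leqnn N))].
rewrite sub0r normrN ger0_norm ?mulr_ge0//; apply: le_trans.
have A1 := le_trans (nrm_dist H2 (h2 N)) (K N).2.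
have A2 : `|nrm (stepf_hat (s N)) - s2pi * nrm f| <= s2pi * N.+1%:R^-1.
  rewrite nrm_stepf_hat -mulrBr normrM (ger0_norm s0) ler_wpM2l//.
  apply: le_trans (nrm_dist (t2 N) f2) _; rewrite nrm_sym; exact: (sP N).2.
rewrite (_ : nrm _ - _ = (nrm (hart1 f) - nrm (stepf_hat (s N))) +
   (nrm (stepf_hat (s N)) - s2pi * nrm f)); last by ring.
apply: le_trans (ler_normD _ _) _; apply: le_trans (lerD A1 A2) _.
by rewrite -mulrDl -[X in _ + X]mul1r -mulrDl (_ : 2 + 1 = 3)//; ring.
Qed.

End Plancherel1.

(** * Convergence in L2 *)

Section L2limits.
Context {R : realType}.
Local Notation mu := (@lebesgue_measure R).
Implicit Types (f g : R -> R) (F G : nat -> R -> R).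

Definition cvg2 F f := [/\ forall n, L2 (F n), L2 f &
  nrm (fun x => F n x - f x) @[n --> \oo] --> 0].

Lemma cvg0_le (a b : nat -> R) : (forall n, 0 <= a n) -> (forall n, a n <= b n) ->
  b n @[n --> \oo] --> 0 -> a n @[n --> \oo] --> 0.
Proof.
move=> a0 ab b0; apply: (squeeze_cvgr _ (cvg_cst 0) b0).
by apply: nearW => n; rewrite a0 ab.
Qed.

Lemma cvg2_map F f (A : (R -> R) -> (R -> R)) c : cvg2 F f ->
  (forall g, L2 g -> L2 (A g)) ->
  (forall g h, L2 g -> L2 h ->
     nrm (fun x => A g x - A h x) <= c * nrm (fun x => g x - h x)) ->
  cvg2 (fun n => A (F n)) (A f).
Proof.
move=> [F2 f2 Ff] A2 AB; split; [by move=> n; exact: A2|exact: A2|].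
apply: (@cvg0_le _ (fun n => c * nrm (fun x => F n x - f x))).
- by move=> n; exact: nrm_ge0.
- by move=> n; exact: AB.
- by rewrite -(mulr0 c); apply: cvgM => //; exact: cvg_cst.
Qed.

Lemma cvg2D F f G g : cvg2 F f -> cvg2 G g ->
  cvg2 (fun n x => F n x + G n x) (fun x => f x + g x).
Proof.
move=> [F2 f2 Ff] [G2 g2 Gg]; split; [by move=> n; exact: L2D|exact: L2D|].
apply: (@cvg0_le _ (fun n => nrm (fun x => F n x - f x) + nrm (fun x => G n x - g x))).
- by move=> n; exact: nrm_ge0.
- move=> n; rewrite (_ : (fun x => _) = (fun x => (F n x - f x) + (G n x - g x))).
    by apply: nrmD; exact: L2B.
  by apply/funext => x; ring.
- by rewrite -(addr0 0); apply: cvgD.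
Qed.

Lemma cvg2Z F f c : cvg2 F f -> cvg2 (fun n x => c * F n x) (fun x => c * f x).
Proof.
move=> Ff; apply: (@cvg2_map F f (fun g x => c * g x) `|c|) => //.
  by move=> g g2; exact: L2Z.
move=> g h g2 h2; rewrite -nrmZ; last exact: L2B.
by rewrite le_eqVlt; apply/orP; left; apply/eqP; congr nrm; apply/funext => x; ring.
Qed.

Lemma cvg2_refl F f : cvg2 F f -> cvg2 (fun n x => F n (- x)) (fun x => f (- x)).
Proof.
move=> Ff; apply: (@cvg2_map F f (fun g x => g (- x)) 1) => //.
  by move=> g g2; exact: L2_refl.
move=> g h g2 h2; rewrite mul1r (nrm_refl (f := fun x => g x - h x))//.
by apply: L2_meas; exact: L2B.
Qed.

Lemma cvg2_shift F f a : cvg2 F f -> cvg2 (fun n x => F n (x + a)) (fun x => f (x + a)).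
Proof.
move=> Ff; apply: (@cvg2_map F f (fun g x => g (x + a)) 1) => //.
  by move=> g g2; exact: L2_shift.
move=> g h g2 h2; rewrite mul1r (nrm_shift a (f := fun x => g x - h x))//.
by apply: L2_meas; exact: L2B.
Qed.

Lemma cvg2_unique F f g : cvg2 F f -> cvg2 F g -> {ae mu, forall x, f x = g x}.
Proof.
move=> [F2 f2 Ff] [_ g2 Fg]; apply: nrm_ae_eq => //; apply/eqP.
rewrite eq_le nrm_ge0 andbT.
have S : nrm (fun x => F n x - f x) + nrm (fun x => F n x - g x) @[n --> \oo] --> 0.
  by rewrite -(addr0 0); apply: cvgD.
move/cvgrPdist_le : S => C; apply/ler_addgt0Pr => e e0; rewrite add0r.
have [N _ /(_ N (leqnn N))] := C _ e0; rewrite sub0r normrN; apply: le_trans.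
apply: le_trans (ler_norm _); rewrite (nrm_sym (F N) f).
exact: nrm_tri.
Qed.

Lemma ip_cvg2 F f G g : cvg2 F f -> cvg2 G g ->
  ip (F n) (G n) @[n --> \oo] --> ip f g.
Proof.
move=> [F2 f2 Ff] [G2 g2 Gg].
have E n : ip (F n) (G n) = ip (fun x => F n x - f x) (fun x => G n x - g x) +
   ip (fun x => F n x - f x) g + ip f (fun x => G n x - g x) + ip f g.
  by rewrite !ipBl ?ipBr//; try exact: L2B; ring.
under eq_fun do rewrite E; rewrite -[ip f g]add0r; under eq_fun do rewrite add0r.
apply: cvgD; last exact: cvg_cst.
have Z (a b : nat -> R) : (forall n, `|a n| <= b n) -> b n @[n --> \oo] --> 0 ->
    a n @[n --> \oo] --> 0.
  move=> ab b0; apply/norm_cvg0P; apply: cvg0_le b0 => // n.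
have h1 n : L2 (fun x => F n x - f x) by exact: L2B.
have h2 n : L2 (fun x => G n x - g x) by exact: L2B.
rewrite -(addr0 0); apply: cvgD; first (rewrite -(addr0 0); apply: cvgD).
- apply: Z (fun n => cauchy_schwarz (h1 n) (h2 n)) _.
  by rewrite -(mulr0 0); apply: cvgM.
- apply: Z (fun n => cauchy_schwarz (h1 n) g2) _.
  by rewrite -(mul0r (nrm g)); apply: cvgM => //; exact: cvg_cst.
- apply: Z (fun n => cauchy_schwarz f2 (h2 n)) _.
  by rewrite -(mulr0 (nrm f)); apply: cvgM => //; exact: cvg_cst.
Qed.

Lemma nrm_cvg2 F f : cvg2 F f -> nrm (F n) @[n --> \oo] --> nrm f.
Proof.
move=> Ff; rewrite /nrm; apply: (@cvg_comp _ _ _ (fun n => ip (F n) (F n)) Num.sqrt).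
  exact: (ip_cvg2 Ff Ff).
exact: sqrt_continuous.
Qed.

Definition trunc f n x := \1_`[- n%:R, n%:R] x * f x.

Lemma meas_indic_itv (i : interval R) : measurable_fun setT (\1_[set` i] : R -> R).
Proof. exact: measurable_indic. Qed.

Lemma indic_le1 (A : set R) x : `|\1_A x : R| <= 1.
Proof. by rewrite indicE; case: (x \in A); rewrite ?normr1 ?normr0. Qed.

Lemma trunc_L2 f n : L2 f -> L2 (trunc f n).
Proof.
move=> f2; by apply: (@L2Ml _ 1) => // x; exact: indic_le1.
Qed.

Lemma indic_itv_L2 (n : nat) : L2 (\1_`[- n%:R, n%:R] : R -> R).
Proof.
split; first exact: meas_indic_itv.
have -> : (fun x : R => \1_`[- n%:R, n%:R] x ^+ 2 : R) = \1_`[- n%:R, n%:R].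
  by apply/funext => x; rewrite indicE; case: (x \in _); rewrite ?expr1n ?expr0n.
exact: integrable_indic_itv.
Qed.

Lemma trunc_L1 f n : L2 f -> L1 (trunc f n).
Proof. by move=> f2; apply: L2M => //; exact: indic_itv_L2. Qed.

Lemma trunc_cvg2 f : L2 f -> cvg2 (trunc f) f.
Proof.
move=> f2; split=> //; first by move=> n; exact: trunc_L2.
have C2 : ip (fun x => trunc f n x - f x) (fun x => trunc f n x - f x) @[n --> \oo] --> 0.
  rewrite -(@intR0 R); apply: (intR_cvg (g := fun x => f x ^+ 2)) => //.
  - by move=> n; apply: L1_meas; apply: L2M; apply: L2B => //; exact: trunc_L2.
  - exact: L2_sq.
  - apply: aeW => x; apply: cvg_near_cst.
    have [N _ HN] : \forall n \near \oo, `|x| <= n%:R by exact: nbhs_infty_ger.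
    exists N => // n /HN /= xn; rewrite /trunc indicE mem_set ?mul1r ?subrr ?mulr0//.
    by rewrite /= in_itv/= -ler_norml.
  - move=> n x; rewrite /trunc indicE; case: (x \in _).
      by rewrite mul1r subrr mulr0 normr0 sqr_ge0.
    by rewrite mul0r sub0r mulrNN -expr2 ger0_norm// sqr_ge0.
rewrite -(@sqrtr0 R); apply: (@cvg_comp _ _ _ _ Num.sqrt _ _ _ C2).
exact: sqrt_continuous.
Qed.

End L2limits.

(** * Plancherel's theorem on L2 *)

(** The real combination of the Fourier transform that [hart1] computes on
    integrable functions. It is locked to keep conversion from unfolding the choice
    operator behind [fourier]. *)
HB.lock Definition hart {R : realType} (f : R -> R) (xi : R) : R :=
  complex.Re (fourier f xi) - complex.Im (fourier f xi).

Section Hartley2.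
Context {R : realType}.
Local Notation mu := (@lebesgue_measure R).
Implicit Types (f g : R -> R).

Lemma hart1_isometryB f g : L1 f -> L2 f -> L1 g -> L2 g ->
  nrm (fun x => hart1 f x - hart1 g x) = Num.sqrt (2 * pi) * nrm (fun x => f x - g x).
Proof.
move=> f1 f2 g1 g2; have [_ <-] := hart1_isometry (L1B f1 g1) (L2B f2 g2).
by congr nrm; apply/funext => x; rewrite hart1B.
Qed.

Lemma hart_exists f : L2 f -> exists h, cvg2 (fun n => hart1 (trunc f n)) h.
Proof.
move=> f2; have [T2 _ TC] := trunc_cvg2 f2.
have T1 n := trunc_L1 n f2.
have H2 n : L2 (hart1 (trunc f n)) by have [] := hart1_isometry (T1 n) (T2 n).
suff C : forall e, 0 < e -> exists N, forall n m, (N <= n)%N -> (N <= m)%N ->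
    nrm (fun x => hart1 (trunc f n) x - hart1 (trunc f m) x) <= e.
  by have [h h2 hC] := L2_complete H2 C; exists h; split.
move=> e e0; have s0 : 0 < Num.sqrt (2 * pi) :> R by rewrite sqrtr_gt0 mulr_gt0 ?pi_gt0.
have d0 : 0 < e / (2 * Num.sqrt (2 * pi)) by rewrite divr_gt0// mulr_gt0.
move/cvgrPdist_le : TC => /(_ _ d0)[N _ HN]; exists N => n m Nn Nm.
rewrite hart1_isometryB//; apply: le_trans (ler_wpM2l (ltW s0) (nrm_tri (T2 n) f2 (T2 m))) _.
have D k : (N <= k)%N -> nrm (fun x => trunc f k x - f x) <= e / (2 * Num.sqrt (2 * pi)).
  by move=> /HN /=; rewrite sub0r normrN ger0_norm// nrm_ge0.
apply: (le_trans (ler_wpM2l (ltW s0) (lerD (D n Nn) _))).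
  by rewrite nrm_sym; exact: D.
by rewrite le_eqVlt; apply/orP; left; apply/eqP; field; rewrite gt_eqF.
Qed.

Lemma normc_sqr (z : R[i]) :
  Normc.normc z ^+ 2 = complex.Re z ^+ 2 + complex.Im z ^+ 2.
Proof. by case: z => a b /=; rewrite sqr_sqrtr// addr_ge0// sqr_ge0. Qed.

Lemma cnorm2E (F : R -> R[i]) : L2 (fun x => complex.Re (F x)) ->
  L2 (fun x => complex.Im (F x)) ->
  L2 (fun x => Normc.normc (F x)) /\
  nrm (fun x => Normc.normc (F x)) ^+ 2 =
    nrm (fun x => complex.Re (F x)) ^+ 2 + nrm (fun x => complex.Im (F x)) ^+ 2.
Proof.
move=> F2 G2.
have E : (fun x => Normc.normc (F x)) =
   (fun x => Num.sqrt (complex.Re (F x) ^+ 2 + complex.Im (F x) ^+ 2)).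
  by apply/funext => x; case: (F x).
have N2 : L2 (fun x => Normc.normc (F x)).
  split; last first.
    under eq_fun do rewrite normc_sqr.
    by apply: L1D; exact: L2_sq.
  rewrite E; apply: measurableT_comp; first exact: (continuous_measurable_fun (@sqrt_continuous R)).
  by apply: measurable_funD; apply: measurable_funX; exact: L2_meas.
split => //; rewrite !nrm_sqr !ip_sqr -intRD; [|exact: L2_sq..].
by apply: intR_ext => x; rewrite normc_sqr.
Qed.

Lemma cnorm2_nrm (F : R -> R[i]) : L2 (fun x => complex.Re (F x)) ->
  L2 (fun x => complex.Im (F x)) ->
  cnorm2 F = (nrm (fun x => Normc.normc (F x)))%:E.
Proof. by move=> F2 G2; have [N2 _] := cnorm2E F2 G2; rewrite -LnormE. Qed.

Lemma cnorm2_L2 (F : R -> R[i]) : measurable_fun setT (fun x => complex.Re (F x)) ->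
  measurable_fun setT (fun x => complex.Im (F x)) -> (cnorm2 F < +oo)%E ->
  L2 (fun x => complex.Re (F x)) /\ L2 (fun x => complex.Im (F x)).
Proof.
move=> mF mG Foo.
have E : (fun x => Normc.normc (F x)) =
   (fun x => Num.sqrt (complex.Re (F x) ^+ 2 + complex.Im (F x) ^+ 2)).
  by apply/funext => x; case: (F x).
have N2 : L2 (fun x => Normc.normc (F x)).
  apply: Lnorm_L2 => //; rewrite E.
  apply: measurableT_comp; first exact: (continuous_measurable_fun (@sqrt_continuous R)).
  by apply: measurable_funD; apply: measurable_funX.
split; apply: (L2_le _ N2) => // x; rewrite -(@ler_pXn2r _ 2)// ?nnegrE//;
  rewrite !real_normK ?num_real// normc_sqr ?lerDl ?lerDr sqr_ge0//.
Qed.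

(** The cosine and sine transforms are the even and odd parts of [hart1]. *)
Lemma fourier_truncE f n xi : L2 f -> fourier_trunc f n xi =
  Complex ((hart1 (trunc f n) xi + hart1 (trunc f n) (- xi)) / 2)
          (- ((hart1 (trunc f n) xi - hart1 (trunc f n) (- xi)) / 2)).
Proof.
move=> f2; have t1 := trunc_L1 n f2.
have E (g : R -> R) : \int[mu]_(x in `[- n%:R, n%:R]) (f x * g x) =
    intR (fun x => trunc f n x * g x).
  rewrite Rintegral_mkcond; apply: eq_Rintegral => x _.
  by rewrite patchE /trunc indicE; case: (x \in _); rewrite ?mul1r ?mul0r.
have h1 := casM_int xi t1; have h2 := casM_int (- xi) t1.
rewrite /fourier_trunc !E /hart1 -intRD// -intRB//; congr Complex.
  rewrite mulrC -intRZ; last exact: L1D.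
  by apply: intR_ext => x; rewrite /cas mulrN cosN sinN; field.
congr (- _); rewrite [RHS]mulrC -intRZ; last exact: L1B.
by apply: intR_ext => x; rewrite /cas mulrN cosN sinN; field.
Qed.

(** The inverse of [F |-> Re F - Im F] on Hermitian functions. *)
Definition of_hartley (h : R -> R) (xi : R) : R[i] :=
  Complex ((h xi + h (- xi)) / 2) (- ((h xi - h (- xi)) / 2)).

Let cvg2_half (F G : nat -> R -> R) f g : cvg2 F f -> cvg2 G g ->
  cvg2 (fun n x => (F n x + G n x) / 2) (fun x => (f x + g x) / 2).
Proof.
move=> Ff Gg; have := cvg2Z 2^-1 (cvg2D Ff Gg).
by congr cvg2; [apply/funext => n|]; apply/funext => x; rewrite mulrC.
Qed.

Lemma is_fourier_exists f h : L2 f -> cvg2 (fun n => hart1 (trunc f n)) h ->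
  is_fourier f (of_hartley h).
Proof.
move=> f2 Hh; have h2 : L2 h by case: Hh.
have HN := cvg2_refl Hh.
have CR := cvg2_half Hh HN.
have CI := cvg2Z (- 1) (cvg2_half Hh (cvg2Z (- 1) HN)).
have [R2 r2 CR'] := CR; have [I2 i2 CI'] := CI.
have iE : (fun x => complex.Im (of_hartley h x)) =
    (fun x => -1 * ((h x + -1 * h (- x)) / 2)).
  by apply/funext => x /=; ring.
split.
- exact: L2_meas r2.
- by rewrite iE; exact: L2_meas i2.
pose a n x := (hart1 (trunc f n) x + hart1 (trunc f n) (- x)) / 2 - (h x + h (- x)) / 2.
pose b n x := - 1 * ((hart1 (trunc f n) x + -1 * hart1 (trunc f n) (- x)) / 2) -
   (- 1 * ((h x + -1 * h (- x)) / 2)).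
have a2 n : L2 (a n) by exact: L2B.
have b2 n : L2 (b n) by exact: L2B.
have E n : cnorm2 (fun xi => fourier_trunc f n xi - of_hartley h xi) =
    (Num.sqrt (nrm (a n) ^+ 2 + nrm (b n) ^+ 2))%:E.
  have aE : (fun x => complex.Re (fourier_trunc f n x - of_hartley h x)) = a n.
    by apply/funext => x; rewrite fourier_truncE.
  have bE : (fun x => complex.Im (fourier_trunc f n x - of_hartley h x)) = b n.
    by apply/funext => x; rewrite fourier_truncE//= /b; ring.
  rewrite cnorm2_nrm ?aE ?bE//; congr (_%:E).
  have [_] := @cnorm2E (fun xi => fourier_trunc f n xi - of_hartley h xi) ltac:(by rewrite aE) ltac:(by rewrite bE).
  by rewrite aE bE => <-; rewrite sqrtr_sqr ger0_norm// nrm_ge0.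
under eq_fun do rewrite E.
apply: cvg_EFin; first exact: nearW.
rewrite -(@sqrtr0 R); apply: (@cvg_comp _ _ _ _ Num.sqrt); last exact: sqrt_continuous.
rewrite -(addr0 0) -(mulr0 0); apply: cvgD; under eq_fun do rewrite expr2; exact: cvgM.
Qed.

Lemma hartE f xi : hart f xi = complex.Re (fourier f xi) - complex.Im (fourier f xi).
Proof. by rewrite hart.unlock. Qed.

Lemma fourierP f : L2 f -> is_fourier f (fourier f).
Proof.
move=> f2; have [h Hh] := hart_exists f2.
by apply: xgetPex; exists (of_hartley h); exact: is_fourier_exists.
Qed.

Lemma is_fourier_cvg2 f F : L2 f -> is_fourier f F ->
  cvg2 (fun n => (fun x => complex.Re (fourier_trunc f n x))) (fun x => complex.Re (F x)) /\
  cvg2 (fun n => (fun x => complex.Im (fourier_trunc f n x))) (fun x => complex.Im (F x)).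
Proof.
move=> f2 [mR mI C].
have [h Hh] := hart_exists f2; have [T2 _ _] := Hh.
have R2 n : L2 (fun x => complex.Re (fourier_trunc f n x)).
  under eq_fun do rewrite fourier_truncE//=.
  under eq_fun do rewrite mulrC.
  by apply: L2Z; apply: L2D => //; exact: L2_refl.
have I2 n : L2 (fun x => complex.Im (fourier_trunc f n x)).
  under eq_fun do rewrite fourier_truncE//=.
  apply: L2N; under eq_fun do rewrite mulrC.
  by apply: L2Z; apply: L2B => //; exact: L2_refl.
pose D n xi := fourier_trunc f n xi - F xi.
have rD n : (fun x => complex.Re (D n x)) =
    (fun x => complex.Re (fourier_trunc f n x) - complex.Re (F x)).
  by apply/funext => x; rewrite /D; case: (fourier_trunc f n x) => ? ?; case: (F x).
have iD n : (fun x => complex.Im (D n x)) =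
    (fun x => complex.Im (fourier_trunc f n x) - complex.Im (F x)).
  by apply/funext => x; rewrite /D; case: (fourier_trunc f n x) => ? ?; case: (F x).
have DL n : (cnorm2 (D n) < +oo)%E -> L2 (fun x => complex.Re (D n x)) /\ L2 (fun x => complex.Im (D n x)).
  apply: cnorm2_L2; rewrite ?rD ?iD.
    by apply: measurable_funB => //; exact: L2_meas.
  by apply: measurable_funB => //; exact: L2_meas.
have [N _ HN] : \forall n \near \oo, cnorm2 (D n) \is a fin_num.
  by move/fine_cvgP : C => [].
have [DR DI] : L2 (fun x => complex.Re (D N x)) /\ L2 (fun x => complex.Im (D N x)).
  by apply: DL; have := HN N (leqnn N) => /=; rewrite fin_numE => /andP[_]; rewrite lt_neqAle leey andbT.
have FR : L2 (fun x => complex.Re (F x)).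
  rewrite rD in DR; have := L2B (R2 N) DR; congr L2; apply/funext => x; ring.
have FI : L2 (fun x => complex.Im (F x)).
  rewrite iD in DI; have := L2B (I2 N) DI; congr L2; apply/funext => x; ring.
have DR' n : L2 (fun x => complex.Re (D n x)) by rewrite rD; exact: L2B.
have DI' n : L2 (fun x => complex.Im (D n x)) by rewrite iD; exact: L2B.
have C' : nrm (fun x => Normc.normc (D n x)) @[n --> \oo] --> 0.
  rewrite (_ : (fun n => _) = fine \o (fun n => cnorm2 (D n))); first exact: fine_cvg C.
  by apply/funext => n /=; rewrite cnorm2_nrm.
split; split => //.
- apply: (cvg0_le _ _ C') => n; first exact: nrm_ge0.
  rewrite -rD -(@ler_pXn2r _ 2)// ?nnegrE ?nrm_ge0//.
  by have [_ ->] := cnorm2E (DR' n) (DI' n); rewrite lerDl sqr_ge0.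
- apply: (cvg0_le _ _ C') => n; first exact: nrm_ge0.
  rewrite -iD -(@ler_pXn2r _ 2)// ?nnegrE ?nrm_ge0//.
  by have [_ ->] := cnorm2E (DR' n) (DI' n); rewrite lerDr sqr_ge0.
Qed.

Lemma hart_cvg2 f : L2 f -> cvg2 (fun n => hart1 (trunc f n)) (hart f).
Proof.
move=> f2; have [CR CI] := is_fourier_cvg2 f2 (fourierP f2).
have := cvg2D CR (cvg2Z (- 1) CI); congr cvg2.
  by apply/funext => n; apply/funext => x; rewrite !fourier_truncE//=; field.
by apply/funext => x; rewrite hartE; ring.
Qed.

Lemma hart_L2 f : L2 f -> L2 (hart f).
Proof. by move=> /hart_cvg2[]. Qed.

Lemma fourier_hart f : L2 f ->
  {ae mu, forall xi, fourier f xi = of_hartley (hart f) xi}.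
Proof.
move=> f2; have [CR CI] := is_fourier_cvg2 f2 (fourierP f2).
have [DR DI] := is_fourier_cvg2 f2 (is_fourier_exists f2 (hart_cvg2 f2)).
have := cvg2_unique CR DR; have := cvg2_unique CI DI; apply: filterS2 => x h1 h2.
by move: h1 h2; case: (fourier f x) => a b /= -> ->.
Qed.

Lemma hart_of_fourier f h : L2 f -> {ae mu, forall xi, fourier f xi = of_hartley h xi} ->
  {ae mu, forall xi, hart f xi = h xi}.
Proof. by move=> f2; apply: filterS => x; rewrite hartE => ->/=; field. Qed.

Lemma nrm_hart f : L2 f -> nrm (hart f) = Num.sqrt (2 * pi) * nrm f.
Proof.
move=> f2; have A := nrm_cvg2 (hart_cvg2 f2).
have [T2 _ _] := trunc_cvg2 f2.
have B : Num.sqrt (2 * pi) * nrm (trunc f n) @[n --> \oo] --> Num.sqrt (2 * pi) * nrm f.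
  by apply: cvgM; [exact: cvg_cst|exact: nrm_cvg2 (trunc_cvg2 f2)].
apply: (cvg_unique _ A); first exact: Rhausdorff.
rewrite (_ : (fun n => _) = (fun n => Num.sqrt (2 * pi) * nrm (trunc f n)))//.
by apply/funext => n; have [_ ->] := hart1_isometry (trunc_L1 n f2) (T2 n).
Qed.

Lemma hartD f g : L2 f -> L2 g ->
  {ae mu, forall xi, hart (fun x => f x + g x) xi = hart f xi + hart g xi}.
Proof.
move=> f2 g2; apply: (cvg2_unique (hart_cvg2 (L2D f2 g2))).
have := cvg2D (hart_cvg2 f2) (hart_cvg2 g2); congr cvg2.
apply/funext => n; apply/funext => x; rewrite -hart1D; try exact: trunc_L1.
by congr hart1; apply/funext => y; rewrite /trunc mulrDr.
Qed.

Lemma hartZ f c : L2 f -> {ae mu, forall xi, hart (fun x => c * f x) xi = c * hart f xi}.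
Proof.
move=> f2; apply: (cvg2_unique (hart_cvg2 (L2Z c f2))).
have := cvg2Z c (hart_cvg2 f2); congr cvg2.
apply/funext => n; apply/funext => x; rewrite -hart1Z; last exact: trunc_L1.
by congr hart1; apply/funext => y; rewrite /trunc; ring.
Qed.

Lemma hartB f g : L2 f -> L2 g ->
  {ae mu, forall xi, hart (fun x => f x - g x) xi = hart f xi - hart g xi}.
Proof.
move=> f2 g2; have := hartZ (-1) g2; have := hartD f2 (L2Z (-1) g2).
apply: filterS2 => x; under [in X in X -> _]eq_fun do rewrite mulN1r.
by move=> -> ->; rewrite mulN1r.
Qed.

Let polarization F G f g c : L2 F -> L2 G -> L2 f -> L2 g ->
  ip (fun x => F x + G x) (fun x => F x + G x) = c * ip (fun x => f x + g x) (fun x => f x + g x) ->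
  ip F F = c * ip f f -> ip G G = c * ip g g -> ip F G = c * ip f g.
Proof.
move=> F2 G2 f2 g2.
rewrite (ipDl F2 G2 (L2D F2 G2)) (ipDr F2 G2 F2) (ipDr F2 G2 G2).
rewrite (ipDl f2 g2 (L2D f2 g2)) (ipDr f2 g2 f2) (ipDr f2 g2 g2).
rewrite (ipC G F) (ipC g f) => + E1 E2; rewrite E1 E2; lra.
Qed.

Lemma ip_hart f g : L2 f -> L2 g -> ip (hart f) (hart g) = 2 * pi * ip f g.
Proof.
move=> f2 g2; have hf := hart_L2 f2; have hg := hart_L2 g2.
have N (h : R -> R) : L2 h -> ip (hart h) (hart h) = 2 * pi * ip h h.
  move=> h2; rewrite -!nrm_sqr nrm_hart// exprMn sqr_sqrtr// mulr_ge0// pi_ge0//.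
apply: (polarization hf hg f2 g2 _ (N _ f2) (N _ g2)).
rewrite -(N _ (L2D f2 g2)).
have mS := L2_meas (hart_L2 (L2D f2 g2)); have mS' := L2_meas (L2D hf hg).
apply: (intR_ae (measurable_funM mS' mS') (measurable_funM mS mS)).
by apply: filterS (hartD f2 g2) => x /= ->.
Qed.

Lemma hart_hart1 f : L1 f -> L2 f -> {ae mu, forall xi, hart f xi = hart1 f xi}.
Proof.
move=> f1 f2; apply: (cvg2_unique (hart_cvg2 f2)).
have [T2 _ TC] := trunc_cvg2 f2; have [h2 _ _] := hart_cvg2 f2.
split => //; first by have [] := hart1_isometry f1 f2.
rewrite -(mulr0 (Num.sqrt (2 * pi))).
rewrite (_ : (fun n => _) = (fun n => Num.sqrt (2 * pi) * nrm (fun x => trunc f n x - f x))).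
  by apply: cvgM => //; exact: cvg_cst.
by apply/funext => n; rewrite hart1_isometryB//; exact: trunc_L1.
Qed.

Lemma hart_adjoint f g : L2 f -> L2 g -> ip (hart f) g = ip f (hart g).
Proof.
move=> f2 g2.
have A := ip_cvg2 (hart_cvg2 f2) (trunc_cvg2 g2).
have B := ip_cvg2 (trunc_cvg2 f2) (hart_cvg2 g2).
apply: (cvg_unique _ A); first exact: Rhausdorff.
rewrite (_ : (fun n => _) = (fun n => ip (trunc f n) (hart1 (trunc g n))))//.
apply/funext => n; have [_ _ E] := hart1_adjoint (trunc_L1 n f2) (trunc_L1 n g2).
exact/esym/E.
Qed.

(** [hart] is self-adjoint and an isometry up to the factor [sqrt (2 * pi)]. *)
Theorem hart_hart f : L2 f -> {ae mu, forall x, hart (hart f) x = 2 * pi * f x}.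
Proof.
move=> f2; have hf := hart_L2 f2; apply: ip_ae_eq; [exact: hart_L2|exact: L2Z|].
by move=> g g2; rewrite hart_adjoint// ip_hart// ipZl.
Qed.

End Hartley2.

(** * Fourier multipliers and Sobolev norms *)

Section Multipliers.
Context {R : realType}.
Local Notation mu := (@lebesgue_measure R).
Implicit Types (f g m : R -> R).

Lemma of_hartley_Re_L2 (h : R -> R) : L2 h -> L2 (fun x : R => complex.Re (of_hartley h x)).
Proof.
move=> h2; under eq_fun do rewrite /= mulrC.
by apply: L2Z; apply: L2D => //; exact: L2_refl.
Qed.

Lemma of_hartley_Im_L2 (h : R -> R) : L2 h -> L2 (fun x : R => complex.Im (of_hartley h x)).
Proof.
move=> h2; apply: L2N; under eq_fun do rewrite mulrC.
by apply: L2Z; apply: L2B => //; exact: L2_refl.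
Qed.

Lemma cnorm2_of_hartley (h : R -> R) : L2 h -> cnorm2 (of_hartley h) = (nrm h)%:E.
Proof.
move=> h2; have r2 := of_hartley_Re_L2 h2; have i2 := of_hartley_Im_L2 h2.
rewrite cnorm2_nrm//; congr (_%:E).
apply/eqP; rewrite -(@eqrXn2 _ 2)// ?nrm_ge0//; apply/eqP.
have [_ ->] := cnorm2E r2 i2; have hn := L2_refl h2.
rewrite !nrm_sqr !ip_sqr -intRD; [|exact: L2_sq..].
rewrite (_ : intR (fun x => h x ^+ 2) = 2^-1 * (intR (fun x => h x ^+ 2) + intR (fun x => h (- x) ^+ 2))).
  rewrite -intRD -?intRZ; try exact: L2_sq; last by apply: L1D; exact: L2_sq.
  by apply: intR_ext => x /=; field.
rewrite (intR_refl (f := fun x => h x ^+ 2)); first by field.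
by apply: measurable_funX; exact: L2_meas.
Qed.

Lemma fmult_rewrite m f : L2 f -> (forall x, m (- x) = m x) ->
  {ae mu, forall x, Complex (m x) 0 * fourier f x = of_hartley (fun x => m x * hart f x) x}.
Proof.
move=> f2 me; apply: filterS (fourier_hart f2) => x ->.
by rewrite /of_hartley me; apply/eqP; rewrite eq_complex /=; apply/andP; split; apply/eqP; field.
Qed.

Lemma fmult_odd_rewrite m f : L2 f -> (forall x, m (- x) = - m x) ->
  {ae mu, forall x, Complex 0 (m x) * fourier f x =
     of_hartley (fun x => - m x * hart f (- x)) x}.
Proof.
move=> f2 me; apply: filterS (fourier_hart f2) => x ->.
by rewrite /of_hartley me (opprK x); apply/eqP; rewrite eq_complex /=; apply/andP; split; apply/eqP; field.
Qed.

(** Every square-integrable function is a Hartley transform, by inversion. *)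
Lemma fmult_exists (s : R -> R[i]) f k : L2 f -> L2 k ->
  {ae mu, forall x, s x * fourier f x = of_hartley k x} ->
  L2 (fmult s f) /\ {ae mu, forall x, hart (fmult s f) x = k x}.
Proof.
move=> f2 k2 sk.
pose g x := (2 * pi)^-1 * hart k x.
have g2 : L2 g by apply: L2Z; exact: hart_L2.
have hg : {ae mu, forall x, hart g x = k x}.
  have A := hartZ (2 * pi)^-1 (hart_L2 k2); have B := hart_hart k2.
  apply: filterS2 A B => x A B; rewrite A B mulrA mulVf ?mul1r//.
  by rewrite mulf_neq0// gt_eqF// pi_gt0.
have E : exists g, g \in Lfun mu 2%:E /\
    {ae mu, forall xi, fourier g xi = s xi * fourier f xi}.
  exists g; split; first exact/LfunP2.
  have A := fourier_hart g2; have B := ae_refl hg.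
  apply: (filterS2 _ _ A (filterI sk (filterI hg B))) => x -> [-> [h1 h2]].
  by rewrite /of_hartley h1 h2.
have [G2 GE] := xgetPex (cst 0) E.
move/LfunP2 : G2 => G2; split; first exact: G2.
apply: (hart_of_fourier G2); apply: filterS2 GE sk => x; rewrite -/(fmult s f).
by move=> -> ->.
Qed.

Lemma fmult_even m f : L2 f -> (forall x, m (- x) = m x) ->
  L2 (fun x => m x * hart f x) ->
  L2 (fmult (fun x => Complex (m x) 0) f) /\
  {ae mu, forall x, hart (fmult (fun x => Complex (m x) 0) f) x = m x * hart f x}.
Proof. by move=> f2 me k2; apply: fmult_exists => //; exact: fmult_rewrite. Qed.

Lemma fmult_odd m f : L2 f -> (forall x, m (- x) = - m x) ->
  L2 (fun x => m x * hart f x) ->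
  L2 (fmult (fun x => Complex 0 (m x)) f) /\
  {ae mu, forall x, hart (fmult (fun x => Complex 0 (m x)) f) x = - m x * hart f (- x)}.
Proof.
move=> f2 me k2; apply: fmult_exists => //; last exact: fmult_odd_rewrite.
by have := L2_refl k2; congr L2; apply/funext => x; rewrite me.
Qed.

(** The symbol of [(1 - d_x^2)^(s/2)]. *)
Definition wt (s x : R) : R := (1 + x ^+ 2) `^ (s / 2).

Lemma wtN s x : wt s (- x) = wt s x.
Proof. by rewrite /wt sqrrN. Qed.

Lemma meas_wt s : measurable_fun setT (wt s).
Proof.
apply: (measurableT_comp (measurable_powR _)).
by apply: measurable_funD => //; exact: measurable_funX.
Qed.

Lemma wt_gt0 s x : 0 < wt s x.
Proof. by rewrite powR_gt0// ltr_pwDl// sqr_ge0. Qed.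

Lemma wtD s t x : wt (s + t) x = wt s x * wt t x.
Proof. by rewrite /wt mulrDl powRD// (gt_eqF (_ : 0 < 1 + x ^+ 2)) ?implybT// ltr_pwDl// sqr_ge0. Qed.

Lemma wt2 x : wt 2 x = 1 + x ^+ 2.
Proof. by rewrite /wt divff// powRr1// addr_ge0// sqr_ge0. Qed.

Lemma wt1_sqr x : wt 1 x ^+ 2 = 1 + x ^+ 2.
Proof. by rewrite expr2 -wtD (_ : 1 + 1 = 2)// wt2. Qed.

Lemma id_le_wt1 (x : R) : `|x| <= wt 1 x.
Proof.
rewrite -(@ler_pXn2r _ 2)// ?nnegrE ?(ltW (wt_gt0 _ _))//.
by rewrite wt1_sqr real_normK ?num_real// lerDr.
Qed.

Lemma wt_ge1 s x : 0 <= s -> 1 <= wt s x.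
Proof.
move=> s0; rewrite -(@powRr0 _ (1 + x ^+ 2)) /wt ler_powR//.
  by rewrite lerDl sqr_ge0.
by rewrite divr_ge0.
Qed.

Lemma HnormE s f : L2 f -> (Hnorm s f < +oo)%E ->
  L2 (fun x => wt s x * hart f x) /\ Hnorm s f = (nrm (fun x => wt s x * hart f x))%:E.
Proof.
move=> f2 Hf; have [mR mI _] := fourierP f2.
have A := fmult_rewrite f2 (wtN s).
pose F x : R[i] := Complex (wt s x) 0 * fourier f x.
have FR x : complex.Re (F x) = wt s x * complex.Re (fourier f x).
  by rewrite /F; case: (fourier f x) => a b /=; ring.
have FI x : complex.Im (F x) = wt s x * complex.Im (fourier f x).
  by rewrite /F; case: (fourier f x) => a b /=; ring.
have [R2 I2] : L2 (fun x => complex.Re (F x)) /\ L2 (fun x => complex.Im (F x)).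
  apply: cnorm2_L2 => //; under eq_fun do rewrite ?FR ?FI; apply: measurable_funM => //; exact: meas_wt.
have h2 : L2 (fun x => wt s x * hart f x).
  have := L2B R2 I2; congr L2; apply/funext => x; rewrite FR FI hartE; ring.
split => //; rewrite -cnorm2_of_hartley// -/(F) /Hnorm -/(cnorm2 F) !cnorm2_nrm//; last 2 first.
- exact: of_hartley_Re_L2.
- exact: of_hartley_Im_L2.
congr (_%:E); apply: nrm_ae.
- by apply: L2_meas; have [] := cnorm2E R2 I2.
- by apply: L2_meas; have [] := cnorm2E (of_hartley_Re_L2 h2) (of_hartley_Im_L2 h2).
- by apply: filterS A => x; rewrite -/(F x) => ->.
Qed.

Lemma HsP s f : Hs s f -> [/\ L2 f, L2 (fun x => wt s x * hart f x) &
  Hnorm s f = (nrm (fun x => wt s x * hart f x))%:E].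
Proof.
move=> [/LfunP2 f2 Hf]; have [] := HnormE f2 Hf; by split.
Qed.

End Multipliers.

(** * Modulations *)

Section Modulation.
Context {R : realType}.
Local Notation mu := (@lebesgue_measure R).
Implicit Types (f g Phi : R -> R) (a : R).

Lemma meas_cosM a : measurable_fun setT (fun x : R => cos (a * x)).
Proof.
apply: (measurableT_comp (continuous_measurable_fun (@continuous_cos R))).
exact: measurable_funM.
Qed.

Lemma meas_sinM a : measurable_fun setT (fun x : R => sin (a * x)).
Proof.
apply: (measurableT_comp (continuous_measurable_fun (@continuous_sin R))).
exact: measurable_funM.
Qed.

Lemma cosM_le1 a (x : R) : `|cos (a * x)| <= 1.
Proof. by rewrite ler_norml cos_geN1 cos_le1. Qed.

Lemma sinM_le1 a (x : R) : `|sin (a * x)| <= 1.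
Proof. by rewrite ler_norml sin_geN1 sin_le1. Qed.

Lemma cosM_L2 a f : L2 f -> L2 (fun x => cos (a * x) * f x).
Proof. exact: L2Ml (meas_cosM a) (cosM_le1 a). Qed.

Lemma sinM_L2 a f : L2 f -> L2 (fun x => sin (a * x) * f x).
Proof. exact: L2Ml (meas_sinM a) (sinM_le1 a). Qed.

Lemma hart_cosM a f : L2 f -> {ae mu, forall xi,
  hart (fun x => cos (a * x) * f x) xi = 2^-1 * (hart f (xi + a) + hart f (xi - a))}.
Proof.
move=> f2; apply: (cvg2_unique (hart_cvg2 (cosM_L2 a f2))).
have H := hart_cvg2 f2.
have := cvg2Z 2^-1 (cvg2D (cvg2_shift a H) (cvg2_shift (- a) H)); congr cvg2.
apply/funext => n; apply/funext => xi; have t1 := trunc_L1 n f2.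
rewrite /hart1 -intRD; try exact: casM_int.
rewrite -intRZ; last by apply: L1D; exact: casM_int.
apply: intR_ext => x; rewrite /trunc /cas !(mulrDr x) mulrN !cosD !sinD cosN sinN (mulrC x a).
by field.
Qed.

Lemma hart_sinM a f : L2 f -> {ae mu, forall xi,
  hart (fun x => sin (a * x) * f x) xi = 2^-1 * (hart f (- xi + a) - hart f (- xi - a))}.
Proof.
move=> f2; apply: (cvg2_unique (hart_cvg2 (sinM_L2 a f2))).
have H := hart_cvg2 f2.
have := cvg2Z 2^-1 (cvg2D (cvg2_refl (cvg2_shift a H)) (cvg2Z (-1) (cvg2_refl (cvg2_shift (- a) H)))).
congr cvg2; last by apply/funext => x; rewrite mulN1r.
apply/funext => n; apply/funext => xi; have t1 := trunc_L1 n f2.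
rewrite mulN1r /hart1 -intRB; try exact: casM_int.
rewrite -intRZ; last by apply: L1B; exact: casM_int.
apply: intR_ext => x; rewrite /trunc /cas !(mulrDr x) !mulrN !cosD !sinD !cosN !sinN (mulrC x a).
by field.
Qed.

Lemma ip_cosM a f g : L2 f -> L2 g ->
  ip (fun x => cos (a * x) * f x) g =
  (4 * pi)^-1 * (ip (fun x => hart f (x + a)) (hart g) + ip (hart f) (fun x => hart g (x + a))).
Proof.
move=> f2 g2; have F2 := hart_L2 f2; have G2 := hart_L2 g2.
have pi0 : pi != 0 :> R by rewrite gt_eqF// pi_gt0.
transitivity ((2 * pi)^-1 * ip (hart (fun x => cos (a * x) * f x)) (hart g)).
  rewrite ip_hart//; last exact: cosM_L2.
  by rewrite mulrA mulVf ?mul1r// mulf_neq0.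
have M : L2 (fun xi => 2^-1 * (hart f (xi + a) + hart f (xi - a))).
  by apply: L2Z; apply: L2D; exact: L2_shift.
have E := ip_ae (L2_meas (hart_L2 (cosM_L2 a f2))) (L2_meas M) (L2_meas G2) (hart_cosM a f2).
transitivity ((2 * pi)^-1 * ip (fun xi => 2^-1 * (hart f (xi + a) + hart f (xi - a))) (hart g)).
  by congr (_ * _); exact: E.
rewrite ipZl//; last by apply: L2D; exact: L2_shift.
rewrite ipDl//; try exact: L2_shift.
have -> : ip (fun x => hart f (x - a)) (hart g) = ip (hart f) (fun x => hart g (x + a)).
  rewrite /ip -(intR_shift a (f := fun x => hart f (x - a) * hart g x)).
    by apply: intR_ext => x; rewrite addrK.
  by apply: L1_meas; apply: L2M => //; exact: L2_shift.
by rewrite mulrA -invfM (_ : 2 * pi * 2 = 4 * pi)//; ring.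
Qed.

Lemma ip_sinM a f g : L2 f -> L2 g ->
  ip (fun x => sin (a * x) * f x) g =
  (4 * pi)^-1 * (ip (fun x => hart f (- x + a)) (hart g) - ip (fun x => hart f (- x - a)) (hart g)).
Proof.
move=> f2 g2; have F2 := hart_L2 f2; have G2 := hart_L2 g2.
have pi0 : pi != 0 :> R by rewrite gt_eqF// pi_gt0.
transitivity ((2 * pi)^-1 * ip (hart (fun x => sin (a * x) * f x)) (hart g)).
  rewrite ip_hart//; last exact: sinM_L2.
  by rewrite mulrA mulVf ?mul1r// mulf_neq0.
have S b : L2 (fun x => hart f (- x + b)) by exact: L2_refl (L2_shift b F2).
have M : L2 (fun xi => 2^-1 * (hart f (- xi + a) - hart f (- xi - a))).
  by apply: L2Z; apply: L2B; exact: S.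
have E := ip_ae (L2_meas (hart_L2 (sinM_L2 a f2))) (L2_meas M) (L2_meas G2) (hart_sinM a f2).
transitivity ((2 * pi)^-1 * ip (fun xi => 2^-1 * (hart f (- xi + a) - hart f (- xi - a))) (hart g)).
  by congr (_ * _); exact: E.
rewrite ipZl//; last by apply: L2B; exact: S.
rewrite ipBl//; try exact: S.
by rewrite mulrA -invfM (_ : 2 * pi * 2 = 4 * pi)//; ring.
Qed.

(** For an odd real [Phi], [Lg] is the image of [g] under the multiplier with
    symbol [- i Phi]: on the Hartley side the factor [- i] becomes a reflection. *)
Definition has_symbol (Phi : R -> R) g Lg :=
  L2 Lg /\ {ae mu, forall x, hart Lg x = Phi x * hart g (- x)}.

Lemma has_symbol_L2 (Phi : R -> R) g Lg : measurable_fun setT Phi -> (forall x, Phi (- x) = - Phi x) ->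
  L2 g -> has_symbol Phi g Lg -> L2 (fun x => Phi x * hart g x).
Proof.
move=> mP Po g2 [L2g E].
have A : L2 (fun x => Phi x * hart g (- x)).
  apply: (L2_ae _ E) (hart_L2 L2g); apply: measurable_funM => //.
  by apply: L2_meas; apply: L2_refl; exact: hart_L2.
have := L2N (L2_refl A); congr L2; apply/funext => x.
by rewrite Po opprK mulNr opprK.
Qed.

Lemma ip_sinM_symbol (Phi : R -> R) a f g Lg : measurable_fun setT Phi ->
  (forall x, Phi (- x) = - Phi x) -> L2 f -> L2 g -> has_symbol Phi g Lg ->
  ip (fun x => sin (a * x) * f x) Lg =
  (4 * pi)^-1 * (ip (hart f) (fun x => Phi (x + a) * hart g (x + a)) -
                 ip (fun x => hart f (x + a)) (fun x => Phi x * hart g x)).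
Proof.
move=> mP Po f2 g2 Lgs; have [Lg2 LgE] := Lgs.
have PG := has_symbol_L2 mP Po g2 Lgs.
have F2 := hart_L2 f2; have G2 := hart_L2 g2.
rewrite ip_sinM//; congr (_ * _).
have mPr : measurable_fun setT (fun x : R => Phi x * hart g (- x)).
  by apply: measurable_funM => //; apply: L2_meas; exact: L2_refl.
have E b : ip (fun x => hart f (- x + b)) (hart Lg) =
    - ip (fun x => hart f (x + b)) (fun x => Phi x * hart g x).
  have S : L2 (fun x => hart f (- x + b)) by exact: L2_refl (L2_shift b F2).
  rewrite ipC (ip_ae (L2_meas (hart_L2 Lg2)) mPr (L2_meas S) LgE).
  rewrite /ip -(intR_refl (f := fun x => Phi x * hart g (- x) * hart f (- x + b))).
    rewrite -intRN; last by apply: L2M => //; exact: L2_shift.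
    by apply: intR_ext => x; rewrite Po !opprK; ring.
  by apply: measurable_funM => //; exact: L2_meas.
rewrite !E opprK addrC; congr (_ - _).
rewrite /ip -(intR_shift a (f := fun x => hart f (x - a) * (Phi x * hart g x))).
  by apply: intR_ext => x; rewrite addrK.
by apply: L1_meas; apply: L2M => //; exact: L2_shift.
Qed.

(** Symmetrizing in [f] and [g] leaves only differences of the symbol. This plays
    the role of the commutator of a multiplier with a weight, for each frequency [a]
    of the weight separately. *)
Lemma sin_commutator (Phi : R -> R) a f g Lf Lg : measurable_fun setT Phi ->
  (forall x, Phi (- x) = - Phi x) -> L2 f -> L2 g ->
  has_symbol Phi f Lf -> has_symbol Phi g Lg ->
  L1 (fun x => (Phi (x + a) - Phi x) * (hart f x * hart g (x + a) + hart f (x + a) * hart g x)) /\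
  ip (fun x => sin (a * x) * f x) Lg + ip (fun x => sin (a * x) * g x) Lf =
  (4 * pi)^-1 * intR (fun x => (Phi (x + a) - Phi x) *
     (hart f x * hart g (x + a) + hart f (x + a) * hart g x)).
Proof.
move=> mP Po f2 g2 Lfs Lgs.
have PG := has_symbol_L2 mP Po g2 Lgs; have PF := has_symbol_L2 mP Po f2 Lfs.
have F2 := hart_L2 f2; have G2 := hart_L2 g2.
have i1 := L2M F2 (L2_shift a PG); have i2 := L2M (L2_shift a F2) PG.
have i3 := L2M G2 (L2_shift a PF); have i4 := L2M (L2_shift a G2) PF.
have E : (fun x => (Phi (x + a) - Phi x) * (hart f x * hart g (x + a) + hart f (x + a) * hart g x))
   = (fun x => (hart f x * (Phi (x + a) * hart g (x + a)) - hart f (x + a) * (Phi x * hart g x)) +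
       (hart g x * (Phi (x + a) * hart f (x + a)) - hart g (x + a) * (Phi x * hart f x))).
  by apply/funext => x; ring.
have j1 := L1B i1 i2; have j2 := L1B i3 i4.
split; first by rewrite E; exact: L1D.
rewrite E intRD// !intRB//.
rewrite (ip_sinM_symbol a mP Po f2 g2 Lgs) (ip_sinM_symbol a mP Po g2 f2 Lfs).
by rewrite -mulrDr.
Qed.

(** Integration by parts, as the case [Phi x = - x] of the commutator identity. *)
Lemma sin_derivative a f g Df Dg : L2 f -> L2 g ->
  has_symbol (fun x => - x) f Df -> has_symbol (fun x => - x) g Dg ->
  ip (fun x => sin (a * x) * f x) Dg + ip (fun x => sin (a * x) * g x) Df =
  - a * ip (fun x => cos (a * x) * f x) g.
Proof.
move=> f2 g2 Dfs Dgs; have F2 := hart_L2 f2; have G2 := hart_L2 g2.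
have mo : measurable_fun setT (fun x : R => - x) by exact: oppr_measurable.
have [_ ->] := sin_commutator a mo (fun x => erefl) f2 g2 Dfs Dgs.
rewrite ip_cosM// mulrCA; congr (_ * _).
have i1 := L2M F2 (L2_shift a G2); have i2 := L2M (L2_shift a F2) G2.
rewrite /ip -intRD// -intRZ; last exact: L1D.
by apply: intR_ext => x; ring.
Qed.

(** The even weight pairs the transforms without a reflection, so the factors are
    first exchanged by [x |-> a - x]. *)
Lemma cos_derivative a f g Df Dg : L2 f -> L2 g ->
  has_symbol (fun x => - x) f Df -> has_symbol (fun x => - x) g Dg ->
  ip (fun x => cos (a * x) * f x) Dg + ip (fun x => cos (a * x) * g x) Df =
  a * ip (fun x => sin (a * x) * f x) g.
Proof.
move=> f2 g2 Dfs Dgs; have F2 := hart_L2 f2; have G2 := hart_L2 g2.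
have mo : measurable_fun setT (fun x : R => - x) by exact: oppr_measurable.
have PG : L2 (fun x => x * hart g x).
  have := L2N (has_symbol_L2 mo (fun x => erefl) g2 Dgs); congr L2.
  by apply/funext => x; rewrite mulNr opprK.
have PF : L2 (fun x => x * hart f x).
  have := L2N (has_symbol_L2 mo (fun x => erefl) f2 Dfs); congr L2.
  by apply/funext => x; rewrite mulNr opprK.
have S b (h : R -> R) : L2 h -> L2 (fun x => h (- x + b)) by move=> h2; exact: L2_refl (L2_shift b h2).
(* pair the reflected transform of one factor with the other *)
have E (h k Dk : R -> R) b : L2 h -> L2 k -> has_symbol (fun x => - x) k Dk ->
    L2 (fun x => x * hart k x) ->
    ip (fun x => hart h (x + b)) (hart Dk) =
    ip (fun x => hart h (- x + b)) (fun x => x * hart k x).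
  move=> h2 k2 [Dk2 DkE] K2; have H2 := hart_L2 h2.
  have mK : measurable_fun setT (fun x : R => - x * hart k (- x)).
    by apply: measurable_funM => //; apply: L2_meas; apply: L2_refl; exact: hart_L2.
  rewrite ipC (ip_ae (L2_meas (hart_L2 Dk2)) mK (L2_meas (L2_shift b H2)) DkE).
  rewrite ipC /ip -(intR_refl (f := fun x => hart h (x + b) * (- x * hart k (- x)))).
    by apply: intR_ext => x; rewrite !opprK.
  by apply: measurable_funM => //; apply: L2_meas; exact: L2_shift.
have E2 b : ip (fun x => hart g (- x + b)) (fun x => x * hart f x) =
    ip (fun x => hart f (- x + b)) (fun x => (b - x) * hart g x).
  rewrite /ip -(intR_refl (f := fun x => hart g (- x + b) * (x * hart f x))); last first.
    by apply: L1_meas; apply: L2M => //; exact: S.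
  rewrite -(intR_shift (- b) (f := fun x => hart g (- - x + b) * (- x * hart f (- x)))); last first.
    have := L1_meas (L1_refl (L2M (S b _ G2) PF)).
    by apply: eq_measurable_fun => x _.
  by apply: intR_ext => x; rewrite opprK subrK opprB (addrC b) (addrC (- x)); ring.
have D (h k Dk : R -> R) : L2 h -> L2 k -> has_symbol (fun x => - x) k Dk ->
    ip (fun x => cos (a * x) * h x) Dk = (4 * pi)^-1 *
    (ip (fun x => hart h (x + a)) (hart Dk) + ip (fun x => hart h (x - a)) (hart Dk)).
  move=> h2 k2 [Dk2 _]; rewrite ip_cosM//; congr (_ * (_ + _)).
  rewrite /ip -(intR_shift a (f := fun x => hart h (x - a) * hart Dk x)).
    by apply: intR_ext => x; rewrite addrK.
  by apply: L1_meas; apply: L2M; [apply: L2_shift|]; exact: hart_L2.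
rewrite (D _ _ _ f2 g2 Dgs) (D _ _ _ g2 f2 Dfs) !(E _ _ _ _ f2 g2 Dgs PG).
rewrite !(E _ _ _ _ g2 f2 Dfs PF) !E2 ip_sinM// -mulrDr mulrCA; congr (_ * _).
have X b : ip (fun x => hart f (- x + b)) (fun x => (b - x) * hart g x) =
   b * ip (fun x => hart f (- x + b)) (hart g) - ip (fun x => hart f (- x + b)) (fun x => x * hart g x).
  have Sb := S b _ F2.
  rewrite -ipZr// -ipBr//; last exact: L2Z.
  by apply: intR_ext => x; ring.
by rewrite !X; ring.
Qed.

End Modulation.

(** * The embedding of H^1/2 into L^4 and the product rule *)

Section L4.
Context {R : realType}.
Local Notation mu := (@lebesgue_measure R).
Implicit Types (f g v : R -> R).

Lemma meas_sum2 f : measurable_fun setT f ->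
  measurable_fun setT (fun p : R * R => f (p.1 + p.2)).
Proof. by move=> mf; apply: (measurableT_comp mf); exact: measurable_funD. Qed.

Lemma tonelli_int (K : R -> R -> R) :
  measurable_fun setT (fun p : R * R => K p.1 p.2) -> (forall x y, 0 <= K x y) ->
  (forall x, L1 (K x)) -> (forall y, L1 (K ^~ y)) -> L1 (fun x => intR (K x)) ->
  L1 (fun y => intR (K ^~ y)) /\ intR (fun y => intR (K ^~ y)) = intR (fun x => intR (K x)).
Proof.
move=> mK K0 K1 K2 KK.
have mKe : measurable_fun setT (fun p : R * R => (K p.1 p.2)%:E).
  exact/measurable_EFinP.
have K0e (p : R * R) : (0 <= (K p.1 p.2)%:E)%E by rewrite lee_fin.
have mG : measurable_fun setT (fun y => intR (K ^~ y)).
  apply/measurable_EFinP.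
  have := @measurable_fun_fubini_tonelli_G _ _ _ _ _ mu _ mKe K0e.
  by apply: eq_measurable_fun => y _; rewrite /fubini_G /= intRE.
have E : (\int[mu]_y (intR (K ^~ y))%:E = \int[mu]_x (intR (K x))%:E)%E.
  under eq_integral do rewrite intRE//.
  under [RHS]eq_integral do rewrite intRE//.
  exact/esym/(@fubini_tonelli _ _ _ _ _ mu mu (fun p => (K p.1 p.2)%:E) mKe K0e).
have G1 : L1 (fun y => intR (K ^~ y)).
  apply: L1_fin => //; rewrite (_ : integral _ _ _ = \int[mu]_x (intR (K x))%:E)%E.
    by rewrite -intRE// ltry.
  rewrite -E; apply: eq_integral => y _; rewrite ger0_norm//; exact: intR_ge0.
by split; [exact: G1|apply: EFin_inj; rewrite (intRE G1) (intRE KK)].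
Qed.

Lemma wt_half_sqr (x : R) : wt (1 / 2) x ^+ 2 = wt 1 x.
Proof. by rewrite expr2 -wtD; congr wt; field. Qed.

Lemma autocorrelation_sym (M : R -> R) (s : R) : L2 M ->
  ip M (fun x => M (x - s)) = ip M (fun x => M (x + s)).
Proof.
move=> M2; rewrite /ip -(intR_shift s (f := fun x => M x * M (x - s))).
  by apply: intR_ext => x; rewrite addrK mulrC.
by apply: L1_meas; apply: L2M => //; exact: L2_shift.
Qed.

(** The transform of [v ^+ 2] is an autocorrelation of the transform of [v]. *)
Lemma hart1_sqr_le v (s : R) : L2 v ->
  let M x := `|hart v x| + `|hart v (- x)| in
  L2 M /\ `|hart1 (fun x => v x ^+ 2) s| <= pi^-1 * ip M (fun x => M (x + s)).
Proof.
move=> v2 M; have H2 := hart_L2 v2.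
have N2 : L2 (fun x => `|hart v x|).
  apply: (L2_le _ H2); last by move=> x; rewrite normr_id.
  by apply: measurableT_comp => //; exact: L2_meas.
have M2 : L2 M by apply: L2D => //; exact: L2_refl N2.
split => //.
have HM x : `|hart v x| <= M x by rewrite /M lerDl normr_ge0.
have HMn x : `|hart v (- x)| <= M x by rewrite /M lerDr normr_ge0.
have M0 x : 0 <= M x by rewrite /M addr_ge0 ?normr_ge0.
have S b (h : R -> R) : L2 h -> L2 (fun x : R => h (- x + b)) by move=> h2; exact: L2_refl (L2_shift b h2).
have E : hart1 (fun x => v x ^+ 2) s =
   ip (fun x => cos (s * x) * v x) v + ip (fun x => sin (s * x) * v x) v.
  rewrite /ip -intRD; last 2 first.
  - by apply: L2M => //; exact: cosM_L2.
  - by apply: L2M => //; exact: sinM_L2.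
  by apply: intR_ext => x; rewrite /cas (mulrC x); ring.
have p0 : 0 < pi :> R := pi_gt0 R.
have ip_le (h k : R -> R) : L2 h -> L2 k -> (forall x, `|h x * k x| <= M x * M (x + s)) ->
    `|ip h k| <= ip M (fun x => M (x + s)).
  move=> h2 k2 hk; apply: intR_norm_le => //; try exact: L2M.
  by apply: L2M => //; exact: L2_shift.
have ip_le' (h k : R -> R) : L2 h -> L2 k -> (forall x, `|h x * k x| <= M x * M (x - s)) ->
    `|ip h k| <= ip M (fun x => M (x + s)).
  move=> h2 k2 hk; rewrite -autocorrelation_sym//.
  apply: intR_norm_le => //; try exact: L2M.
  by apply: L2M => //; exact: L2_shift.
rewrite E ip_cosM// ip_sinM//.
set a := ip (fun x => hart v (x + s)) _; set b := ip (hart v) _.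
set c := ip (fun x => hart v (- x + s)) _; set d := ip (fun x => hart v (- x - s)) _.
have ha : `|a| <= ip M (fun x => M (x + s)).
  by apply: ip_le => //; [exact: L2_shift|move=> x; rewrite normrM mulrC ler_pM].
have hb : `|b| <= ip M (fun x => M (x + s)).
  by apply: ip_le => //; [exact: L2_shift|move=> x; rewrite normrM ler_pM].
have hc : `|c| <= ip M (fun x => M (x + s)).
  apply: ip_le' => //; [exact: S|move=> x; rewrite normrM mulrC ler_pM//].
  by rewrite (_ : - x + s = - (x - s)) ?HMn//; ring.
have hd : `|d| <= ip M (fun x => M (x + s)).
  apply: ip_le => //; [exact: S|move=> x; rewrite normrM mulrC ler_pM//].
  by rewrite (_ : - x - s = - (x + s)) ?HMn//; ring.
rewrite -mulrDr normrM ger0_norm; last by rewrite invr_ge0 mulr_ge0// ltW.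
have -> : pi^-1 = (4 * pi)^-1 * 4 :> R by rewrite invfM mulrAC mulVf ?mul1r.
rewrite -mulrA ler_wpM2l ?invr_ge0 ?mulr_ge0 ?(ltW p0)//.
apply: le_trans (ler_normD _ _) _; apply: le_trans (lerD (ler_normD _ _) (ler_normB _ _)) _.
lra.
Qed.

(** Cauchy-Schwarz against the integrable weight [(1 + x ^+ 2)^-1], which is where
    the half derivative is used. *)
Lemma weighted_autocorrelation (G : R -> R) : L2 G -> (forall x, 0 <= G x) ->
  let M x := G x / wt (1 / 2) x in
  exists D, [/\ L1 D, intR D = pi * ip G G &
    forall s, ip M (fun x => M (x + s)) ^+ 2 <= ip G G * ((D s + D (- s)) / 2)].
Proof.
move=> G2 G0 M; have mG := L2_meas G2.
have [w1 wE] := @inv_oneDsqr R.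
have mw : measurable_fun setT (fun x : R => (1 + x ^+ 2)^-1) by exact: L1_meas.
have w_le1 (x : R) : `|(1 + x ^+ 2)^-1| <= 1.
  by rewrite ger0_norm ?invr_ge0 ?addr_ge0 ?sqr_ge0// invf_le1 ?lerDl ?sqr_ge0// ltr_pwDl// sqr_ge0.
have w_ge0 (x : R) : 0 <= (1 + x ^+ 2)^-1 by rewrite invr_ge0 addr_ge0// sqr_ge0.
pose K (x s : R) := (1 + x ^+ 2)^-1 * G (x + s) ^+ 2.
have K1 x : L1 (K x).
  apply: L1Z; rewrite (_ : (fun s => _) = (fun s => G (s + x) ^+ 2)).
    by apply: L2_sq; exact: L2_shift.
  by apply/funext => s; rewrite addrC.
have K2 s : L1 (K ^~ s) by apply: (L1Ml mw w_le1); apply: L2_sq; exact: L2_shift.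
have KE x : intR (K x) = ip G G * (1 + x ^+ 2)^-1.
  rewrite /K intRZ; last first.
    rewrite (_ : (fun s => _) = (fun s => G (s + x) ^+ 2)).
      by apply: L2_sq; exact: L2_shift.
    by apply/funext => s; rewrite addrC.
  rewrite mulrC ip_sqr; congr (_ * _).
  rewrite -(intR_shift x (f := fun s => G s ^+ 2)); last exact: measurable_funX.
  by apply: intR_ext => s; rewrite addrC.
have mK : measurable_fun setT (fun p : R * R => K p.1 p.2).
  apply: measurable_funM; first exact: (meas_fst_fun mw).
  by apply: measurable_funX; exact: meas_sum2.
have [D1 DE] : L1 (fun s => intR (K ^~ s)) /\
    intR (fun s => intR (K ^~ s)) = intR (fun x => intR (K x)).
  apply: tonelli_int => //.
    by move=> x s; rewrite mulr_ge0// sqr_ge0.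
  by under eq_fun do rewrite KE; exact: L1Z.
exists (fun s => intR (K ^~ s)); split; [exact: D1| |].
  by rewrite DE; under intR_ext do rewrite KE; rewrite intRZ// wE mulrC.
have wp (x : R) : 0 < wt (1 / 2) x by exact: wt_gt0.
have mwt := @meas_wt R (1/2).
have M2 : L2 M.
  apply: (L2_le _ G2).
    by apply: measurable_funM => //; exact: meas_inv.
  move=> x; rewrite normrM ler_piMr// gtr0_norm ?invr_gt0// invf_le1//.
  by apply: wt_ge1; lra.
(* the weighted correlation in which only one factor carries the weight *)
pose B s := ip G (fun x => G (x + s) / wt 1 x).
have mw1 := @meas_wt R 1.
have W1 s : L2 (fun x => G (x + s) / wt 1 x).
  apply: (L2_le _ (L2_shift s G2)).
    apply: measurable_funM; last exact: meas_inv.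
    by apply: L2_meas; exact: L2_shift.
  move=> x; rewrite normrM ler_piMr// gtr0_norm ?invr_gt0 ?wt_gt0// invf_le1 ?wt_gt0//.
  by apply: wt_ge1.
have BD s : B s ^+ 2 <= ip G G * intR (K ^~ s).
  apply: le_trans (cauchy_schwarz_sqr G2 (W1 s)) _.
  rewrite le_eqVlt; apply/orP; left; apply/eqP; congr (_ * _); rewrite ip_sqr.
  by apply: intR_ext => x; rewrite /K exprMn exprVn wt1_sqr mulrC.
have B' s : B (- s) = ip (fun x => G (x + s)) (fun x => G x / wt 1 (x + s)).
  rewrite /B /ip -(intR_shift s (f := fun x => G x * (G (x - s) / wt 1 x))).
    by apply: intR_ext => x; rewrite addrK.
  by apply: L1_meas; exact: L2M.
have W1' s : L2 (fun x => G x / wt 1 (x + s)).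
  apply: (L2_le _ G2).
    by apply: measurable_funM => //; apply: meas_inv; exact: meas_shift.
  move=> x; rewrite normrM ler_piMr// gtr0_norm ?invr_gt0 ?wt_gt0// invf_le1 ?wt_gt0//.
  by apply: wt_ge1.
move=> s.
have AB : ip M (fun x => M (x + s)) <= (B s + B (- s)) / 2.
  rewrite B' /B [leRHS]mulrC -intRD; last 2 first.
  - exact: L2M.
  - by apply: L2M => //; exact: L2_shift.
  rewrite -intRZ; last first.
    by apply: L1D; apply: L2M => //; exact: L2_shift.
  apply: intR_le; first by apply: L2M => //; exact: L2_shift.
    by apply: L1Z; apply: L1D; apply: L2M => //; exact: L2_shift.
  move=> x; rewrite /M -!wt_half_sqr.
  have p1 := wp x; have p2 := wp (x + s).
  set a := wt _ x in p1 *; set b := wt _ (x + s) in p2 *.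
  have -> : G x / a * (G (x + s) / b) = G x * G (x + s) * (a^-1 * b^-1) by ring.
  have -> : 2^-1 * (G x * (G (x + s) / a ^+ 2) + G (x + s) * (G x / b ^+ 2)) =
    G x * G (x + s) * ((a^-1 ^+ 2 + b^-1 ^+ 2) / 2) by rewrite -!exprVn; field; rewrite !gt_eqF.
  rewrite ler_wpM2l ?mulr_ge0//; have := sqr_ge0 (a^-1 - b^-1); nra.
have A0 : 0 <= ip M (fun x => M (x + s)).
  by apply: intR_ge0 => x; rewrite mulr_ge0// divr_ge0// ltW.
apply: (@le_trans _ _ (((B s + B (- s)) / 2) ^+ 2)).
  by rewrite lerXn2r ?nnegrE//; exact: le_trans AB.
have := BD s; have := BD (- s); have := sqr_ge0 (B s - B (- s)); nra.
Qed.

(** Plancherel's theorem for [v ^+ 2], whose transform is an autocorrelation; the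
    half derivative makes this autocorrelation square-integrable. *)
Theorem L4_bound v : L2 v -> L2 (fun x => v x ^+ 2) ->
  L2 (fun x => wt (1 / 2) x * hart v x) ->
  nrm (fun x => v x ^+ 2) <= 4 * nrm (fun x => wt (1 / 2) x * hart v x) ^+ 2.
Proof.
move=> v2 vv2 w2.
pose M x := `|hart v x| + `|hart v (- x)|.
pose G x := wt (1 / 2) x * M x.
have mwt := @meas_wt R (1/2).
have N2 : L2 (fun x => wt (1 / 2) x * `|hart v x|).
  apply: (L2_le _ w2).
    apply: measurable_funM => //; apply: measurableT_comp => //.
    by apply: L2_meas; exact: hart_L2.
  by move=> x; rewrite !normrM normr_id.
have N2r : L2 (fun x => wt (1 / 2) x * `|hart v (- x)|).
  by have := L2_refl N2; congr L2; apply/funext => x; rewrite wtN.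
have GE : G = (fun x => wt (1 / 2) x * `|hart v x| + wt (1 / 2) x * `|hart v (- x)|).
  by apply/funext => x; rewrite /G mulrDr.
have G2 : L2 G by rewrite GE; exact: L2D.
have nG : nrm G <= 2 * nrm (fun x => wt (1 / 2) x * hart v x).
  rewrite GE; apply: le_trans (nrmD N2 N2r) _; rewrite mulr_natl mulr2n.
  have E : nrm (fun x => wt (1 / 2) x * `|hart v x|) = nrm (fun x => wt (1 / 2) x * hart v x).
    rewrite /nrm !ip_sqr; congr Num.sqrt; apply: intR_ext => x.
    by rewrite !exprMn real_normK ?num_real.
  rewrite E lerD2l -E -(nrm_refl (f := fun x => wt (1 / 2) x * `|hart v x|)); last exact: L2_meas.
  by rewrite le_eqVlt; apply/orP; left; apply/eqP; congr nrm; apply/funext => x; rewrite wtN.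
have G0 x : 0 <= G x by rewrite mulr_ge0 ?addr_ge0// ltW// wt_gt0.
have [D [D1 DE DM]] := weighted_autocorrelation G2 G0.
have ME : (fun x => G x / wt (1 / 2) x) = M.
  by apply/funext => x; rewrite /G mulrC mulKf// gt_eqF// wt_gt0.
have [M2 _] := hart1_sqr_le 0 v2.
have vv1 : L1 (fun x => v x ^+ 2) by exact: L2_sq.
have [m2 mE] := hart1_isometry vv1 vv2.
have p0 : 0 < pi :> R := pi_gt0 R.
have m_le s : hart1 (fun x => v x ^+ 2) s ^+ 2 <=
    pi^-1 ^+ 2 * (ip G G * ((D s + D (- s)) / 2)).
  have [_ h] := hart1_sqr_le s v2.
  rewrite -real_normK ?num_real//.
  apply: (@le_trans _ _ ((pi^-1 * ip M (fun x => M (x + s))) ^+ 2)).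
    by rewrite lerXn2r ?nnegrE//; exact: le_trans h.
  rewrite exprMn ler_wpM2l ?sqr_ge0//.
  by rewrite -ME; exact: DM.
have Dn := L1_refl D1.
have : nrm (hart1 (fun x => v x ^+ 2)) ^+ 2 <= pi^-1 * ip G G ^+ 2.
  rewrite nrm_sqr ip_sqr.
  apply: (@le_trans _ _ (intR (fun s => (pi^-1 ^+ 2 * ip G G / 2) * (D s + D (- s))))).
    apply: intR_le; [exact: L2_sq|by apply: L1Z; exact: L1D|].
    by move=> s; apply: le_trans (m_le s) _; rewrite le_eqVlt; apply/orP; left; apply/eqP; ring.
  rewrite intRZ; last exact: L1D.
  rewrite intRD// (intR_refl (L1_meas D1)) DE.
  have e (p q g : R) : q ^+ 2 * g / 2 * (p * g + p * g) = (q * p) * (q * g ^+ 2) by field.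
  by rewrite e mulVf ?mul1r// gt_eqF.
rewrite mE exprMn sqr_sqrtr; last by rewrite mulr_ge0// ltW.
rewrite -nrm_sqr => h.
have p1 : 1 <= pi :> R by have := pi_ge2 R; lra.
have h2 : nrm (fun x => v x ^+ 2) ^+ 2 <= (nrm G ^+ 2) ^+ 2.
  have : pi^-1 * (nrm G ^+ 2) ^+ 2 <= (nrm G ^+ 2) ^+ 2.
    by rewrite ler_piMl ?sqr_ge0// invf_le1.
  have := sqr_ge0 (nrm (fun x => v x ^+ 2)); nra.
have h3 : nrm (fun x => v x ^+ 2) <= nrm G ^+ 2.
  by rewrite -(@ler_pXn2r _ 2)// ?nnegrE ?nrm_ge0 ?sqr_ge0.
apply: le_trans h3 _; have := nrm_ge0 G.
have -> : 4 * nrm (fun x => wt (1 / 2) x * hart v x) ^+ 2 = (2 * nrm (fun x => wt (1 / 2) x * hart v x)) ^+ 2 by ring.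
by move=> gn; rewrite lerXn2r ?nnegrE// mulr_ge0// nrm_ge0.
Qed.

End L4.

Section ProductRule.
Context {R : realType}.
Local Notation mu := (@lebesgue_measure R).
Implicit Types (f g v : R -> R).

(** The transform is integrable, by Cauchy-Schwarz against [(wt 1)^-1]. *)
Lemma H1_bounded v : L2 v -> L2 (fun x => wt 1 x * hart v x) ->
  exists c (vb : R -> R), [/\ measurable_fun setT vb, forall x : R, `|vb x| <= c &
    {ae mu, forall x, vb x = v x}].
Proof.
move=> v2 w2; have H2 := hart_L2 v2.
have W2 : L2 (fun x : R => (wt 1 x)^-1).
  split; first by apply: meas_inv; exact: meas_wt.
  under eq_fun do rewrite exprVn wt1_sqr.
  by have [] := @inv_oneDsqr R.
have H1 : L1 (hart v).
  have := L2M W2 w2; congr L1; apply/funext => x.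
  by rewrite mulrA mulVf ?mul1r// gt_eqF// wt_gt0.
exists ((2 * pi)^-1 * (2 * intR (fun x => `|hart v x|))).
exists (fun x => (2 * pi)^-1 * hart1 (hart v) x); split.
- by apply: measurable_funM => //; exact: meas_hart1.
- move=> x; rewrite normrM ger0_norm ?invr_ge0 ?mulr_ge0 ?pi_ge0//.
  by rewrite ler_wpM2l ?invr_ge0 ?mulr_ge0 ?pi_ge0// hart1_bound.
apply: filterS2 (hart_hart1 H1 H2) (hart_hart v2) => x <- ->.
by rewrite mulrA mulVf ?mul1r// mulf_neq0// gt_eqF// pi_gt0.
Qed.

Lemma H1_mul_L2 v g : L2 v -> L2 (fun x => wt 1 x * hart v x) -> L2 g ->
  L2 (fun x => v x * g x).
Proof.
move=> v2 w2 g2; have [c [vb [mb bc bE]]] := H1_bounded v2 w2.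
have := L2Ml mb bc g2; apply: L2_ae.
  by apply: measurable_funM; exact: L2_meas.
by apply: filterS bE => x ->.
Qed.

(** The products are integrable, so their transforms are integrals against cosines
    and sines, to which the integrations by parts above apply. *)
Lemma product_rule v Dv : L2 v -> L2 (fun x => wt 1 x * hart v x) ->
  has_symbol (fun x => - x) v Dv ->
  [/\ L2 (fun x => v x ^+ 2), L2 (fun x => 2 * (v x * Dv x)) &
   has_symbol (fun x => - x) (fun x => v x ^+ 2) (fun x => 2 * (v x * Dv x))].
Proof.
move=> v2 w2 Ds; have [D2 _] := Ds.
have vv2 : L2 (fun x => v x ^+ 2) by exact: H1_mul_L2.
have vD2 : L2 (fun x => 2 * (v x * Dv x)) by apply: L2Z; exact: H1_mul_L2.
split => //; split => //.
have vv1 : L1 (fun x => v x ^+ 2) by exact: L2_sq.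
have vD1 : L1 (fun x => 2 * (v x * Dv x)) by apply: L1Z; exact: L2M.
apply: filterS2 (hart_hart1 vD1 vD2) (ae_refl (hart_hart1 vv1 vv2)) => s -> ->.
have E1 : hart1 (fun x => 2 * (v x * Dv x)) s =
   2 * (ip (fun x => cos (s * x) * v x) Dv + ip (fun x => sin (s * x) * v x) Dv).
  have i1 := L2M (cosM_L2 s v2) D2; have i2 := L2M (sinM_L2 s v2) D2.
  rewrite /ip -intRD// -intRZ; last exact: L1D.
  by apply: intR_ext => x; rewrite /cas (mulrC x); ring.
have E2 : hart1 (fun x => v x ^+ 2) (- s) =
   ip (fun x => cos (s * x) * v x) v - ip (fun x => sin (s * x) * v x) v.
  have i1 := L2M (cosM_L2 s v2) v2; have i2 := L2M (sinM_L2 s v2) v2.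
  rewrite /ip -intRB//.
  by apply: intR_ext => x; rewrite /cas mulrN cosN sinN (mulrC x); ring.
have A := sin_derivative s v2 v2 Ds Ds; have B := cos_derivative s v2 v2 Ds Ds.
rewrite E1 E2.
move: A B; set a := ip _ Dv; set b := ip _ Dv; set c := ip _ v; set d := ip _ v.
lra.
Qed.

(** Integration by parts for the pair [v], [v ^+ 2]. *)
Lemma sin_cubic a v Dv : L2 v -> L2 (fun x => wt 1 x * hart v x) ->
  has_symbol (fun x => - x) v Dv ->
  3 * ip (fun x => sin (a * x) * v x ^+ 2) Dv =
  - a * ip (fun x => cos (a * x) * v x) (fun x => v x ^+ 2).
Proof.
move=> v2 w2 Ds; have [vv2 vD2 Ds2] := product_rule v2 w2 Ds.
rewrite -(sin_derivative a v2 vv2 Ds Ds2).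
have [D2 _] := Ds.
have i1 := L2M (sinM_L2 a vv2) D2.
have -> : ip (fun x => sin (a * x) * v x) (fun x => 2 * (v x * Dv x)) =
   2 * ip (fun x => sin (a * x) * v x ^+ 2) Dv.
  by rewrite /ip -intRZ//; apply: intR_ext => x; ring.
by ring.
Qed.

End ProductRule.

(** * The dispersion relation *)

Section Dispersion.
Context {R : realType}.
Implicit Types (x y : R).

Definition sh2 y := expR y - expR (- y).
Definition ch2 y := expR y + expR (- y).

Lemma is_derive_sh2 y : is_derive y 1 sh2 (ch2 y).
Proof. by apply: is_derive_eq; rewrite /GRing.scale/= /ch2; ring. Qed.

Lemma is_derive_ch2 y : is_derive y 1 ch2 (sh2 y).
Proof. by apply: is_derive_eq; rewrite /GRing.scale/= /sh2; ring. Qed.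

Lemma ch2_sqr y : ch2 y ^+ 2 = sh2 y ^+ 2 + 4.
Proof.
have : expR y * expR (- y) = 1 by rewrite -expRD subrr expR0.
rewrite /ch2 /sh2; move: (expR y) (expR _) => a b ab.
by rewrite !sqrrD mulrN sqrrN ab; ring.
Qed.

Lemma sh2N y : sh2 (- y) = - sh2 y.
Proof. by rewrite /sh2 opprK opprB. Qed.

Lemma ch2N y : ch2 (- y) = ch2 y.
Proof. by rewrite /ch2 opprK addrC. Qed.

Lemma mean_value (f df : R -> R) y : (forall x, is_derive x 1 f (df x)) -> 0 < y ->
  exists2 c, 0 < c < y & f y = f 0 + df c * y.
Proof.
move=> fd y0.
have [|c] := @MVT _ f df 0 y y0 (fun x _ => fd x).
  by apply: continuous_subspaceT; exact: cont_of_derive fd.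
rewrite in_itv/= subr0 => cy E; exists c => //.
by rewrite -E addrC subrK.
Qed.

Lemma ge0_mean_value (f df : R -> R) y : (forall x, is_derive x 1 f (df x)) ->
  (forall x, 0 < x -> 0 <= df x) -> 0 <= y -> f 0 <= f y.
Proof.
move=> fd d0; rewrite le_eqVlt => /predU1P[<-//|y0].
have [c /andP[c0 _] ->] := mean_value fd y0.
by rewrite lerDl mulr_ge0 ?d0 ?ltW.
Qed.

Lemma ch2_gt0 y : 0 < ch2 y.
Proof. by rewrite addr_gt0// expR_gt0. Qed.

Lemma ch2_ge2 y : 2 <= ch2 y.
Proof. by have := ch2_sqr y; have := ch2_gt0 y; have := sqr_ge0 (sh2 y); nra. Qed.

Lemma sh20 : sh2 0 = 0.
Proof. by rewrite /sh2 oppr0 subrr. Qed.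

Lemma sh2_ge y : 0 <= y -> 2 * y <= sh2 y.
Proof.
move=> y0.
have D x : is_derive x 1 (fun x => sh2 x - 2 * x) (ch2 x - 2).
  by have := is_derive_sh2 x => ?; apply: is_derive_eq; rewrite /GRing.scale/=; ring.
have := ge0_mean_value D (fun x _ => ltac:(rewrite subr_ge0; exact: ch2_ge2)) y0.
by rewrite sh20 mulr0 subr0; lra.
Qed.

Lemma sh2_gt0 y : 0 < y -> 0 < sh2 y.
Proof. by move=> y0; have := sh2_ge (ltW y0); lra. Qed.

Lemma ch2_le y : 0 <= y -> ch2 y <= sh2 y + 2.
Proof.
move=> y0; rewrite /ch2 /sh2; have : expR (- y) <= 1; last by lra.
by rewrite -[leRHS]expR0 ler_expR oppr_le0.
Qed.

Lemma sh2_nd x y : 0 <= x -> x <= y -> sh2 x <= sh2 y.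
Proof.
move=> x0 xy; rewrite /sh2; have a : expR x <= expR y by rewrite ler_expR.
have b : expR (- y) <= expR (- x) by rewrite ler_expR lerN2.
lra.
Qed.

Let D1 x : is_derive x 1 (fun x => x * ch2 x - sh2 x) (x * sh2 x).
Proof.
have := is_derive_sh2 x => ?; have := is_derive_ch2 x => ?.
by apply: is_derive_eq; rewrite /GRing.scale/=; ring.
Qed.

Lemma sh2_le_ch2 y : 0 <= y -> sh2 y <= y * ch2 y.
Proof.
move=> y0; have H x : 0 < x -> 0 <= x * sh2 x.
  by move=> x0; rewrite mulr_ge0 ?ltW ?sh2_gt0.
have := ge0_mean_value D1 H y0.
by rewrite sh20 mul0r subr0; lra.
Qed.

Lemma ch2_sh2_le y : 0 < y -> y * ch2 y - sh2 y <= y ^+ 2 * sh2 y.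
Proof.
move=> y0; have [c /andP[c0 cy] ->] := mean_value D1 y0.
rewrite sh20 mul0r subr0 add0r.
have h1 := sh2_nd (ltW c0) (ltW cy); have h2 := sh2_gt0 c0.
have : c * sh2 c <= y * sh2 y by apply: ler_pM => //; exact: ltW.
nra.
Qed.

(** [delta * Omega'] as a function of [y = delta * x <> 0]. *)
Definition dprofile y := 2 * y * (ch2 y / sh2 y) - 4 * y ^+ 2 / sh2 y ^+ 2 - 1.

Definition d2profile y :=
  (2 * ch2 y * sh2 y ^+ 2 - 16 * y * sh2 y + 8 * y ^+ 2 * ch2 y) / sh2 y ^+ 3.

Lemma is_derive_dprofile y : sh2 y != 0 -> is_derive y 1 dprofile (d2profile y).
Proof.
move=> s0; have := is_derive_sh2 y => ?; have := is_derive_ch2 y => ?.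
have iV : is_derive y 1 (fun z => (sh2 z)^-1) (- (sh2 y) ^- 2 *: ch2 y) by exact: is_deriveV.
have -> : dprofile = (fun y => 2 * y * (ch2 y * (sh2 y)^-1) - 4 * y ^+ 2 * (sh2 y)^-1 ^+ 2 - 1).
  by apply/funext => z; rewrite /dprofile exprVn.
apply: is_derive_eq; rewrite /GRing.scale/= /d2profile.
have E := ch2_sqr y.
have -> : 2 * ch2 y * sh2 y ^+ 2 - 16 * y * sh2 y + 8 * y ^+ 2 * ch2 y =
  2 * ch2 y * sh2 y ^+ 2 + 2 * y * (sh2 y ^+ 2 - ch2 y ^+ 2) * sh2 y - 8 * y * sh2 y + 8 * y ^+ 2 * ch2 y.
  by rewrite E; ring.
by field.
Qed.

Lemma dprofileN y : dprofile (- y) = dprofile y.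
Proof. by rewrite /dprofile ch2N sh2N !sqrrN invrN !mulrN mulNr opprK. Qed.

Let numer y := 2 * y * ch2 y * sh2 y - 4 * y ^+ 2 - sh2 y ^+ 2.

Let numer_der y : is_derive y 1 numer (4 * y * sh2 y ^+ 2).
Proof.
have := is_derive_sh2 y => ?; have := is_derive_ch2 y => ?.
apply: is_derive_eq; rewrite /GRing.scale/=.
have E := ch2_sqr y.
have -> : 4 * y * sh2 y ^+ 2 = 2 * y * (sh2 y ^+ 2 + ch2 y ^+ 2) - 8 * y by rewrite E; ring.
ring.
Qed.

Let numer0 : numer 0 = 0.
Proof. by rewrite /numer sh20; ring. Qed.

Let dprofileE y : 0 < y -> dprofile y = numer y / sh2 y ^+ 2.
Proof.
by move=> y0; rewrite /dprofile /numer; field; rewrite gt_eqF// sh2_gt0.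
Qed.

Lemma dprofile_ge0 y : 0 < y -> 0 <= dprofile y.
Proof.
move=> y0; rewrite dprofileE// divr_ge0 ?sqr_ge0// -numer0.
apply: (ge0_mean_value numer_der) => [x x0|]; last exact: ltW.
by rewrite mulr_ge0 ?sqr_ge0// mulr_ge0// ltW.
Qed.

Lemma dprofile_le y : 0 < y -> dprofile y <= 4 * y ^+ 2.
Proof.
move=> y0; have s0 := sh2_gt0 y0.
rewrite dprofileE// ler_pdivrMr ?exprn_gt0//.
have [c /andP[c0 cy] ->] := mean_value numer_der y0.
rewrite numer0 add0r; have h1 := sh2_nd (ltW c0) (ltW cy); have h2 := sh2_gt0 c0.
have : sh2 c ^+ 2 <= sh2 y ^+ 2 by rewrite lerXn2r// ?nnegrE ltW.
move=> h3; have : c * sh2 c ^+ 2 <= y * sh2 y ^+ 2.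
  by apply: ler_pM => //; rewrite ?sqr_ge0// ltW.
nra.
Qed.

(** With [s = sh2 y] and [c = ch2 y] the numerator is
    [2 c (s - 2 y)^2 + 8 y (c - 2) s], and each term is at most a multiple of
    [s ^+ 3], both for small and for large [y]. *)
Lemma d2profile_bound y : 0 < y -> `|d2profile y| <= 10.
Proof.
move=> y0; have s0 := sh2_gt0 y0; rewrite /d2profile normrM.
rewrite (gtr0_norm (x := _^-1)) ?invr_gt0 ?exprn_gt0//.
rewrite ler_pdivrMr ?exprn_gt0//.
have E := ch2_sqr y; have C2 := ch2_ge2 y; have CS := ch2_le (ltW y0).
have S2 := sh2_ge (ltW y0); have SC := sh2_le_ch2 (ltW y0).
set s := sh2 y in s0 E CS S2 SC *; set c := ch2 y in E C2 CS SC *.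
have -> : 2 * c * s ^+ 2 - 16 * y * s + 8 * y ^+ 2 * c =
   2 * c * (s - 2 * y) ^+ 2 + 8 * (y * (c - 2)) * s by ring.
have c2 : c - 2 <= s ^+ 2 / 4 by nra.
have t0 : 0 <= s - 2 * y by lra.
have ts : s - 2 * y <= s by lra.
have yc0 : 0 <= y * (c - 2) by rewrite mulr_ge0 ?subr_ge0// ltW.
have yc : y * (c - 2) <= s ^+ 2 / 2.
  apply: (@le_trans _ _ (s / 2 * s)); last by rewrite expr2 mulrAC.
  by apply: ler_pM; lra.
have t3 : s - 2 * y <= s ^+ 3 / 8.
  apply: (@le_trans _ _ (y * (c - 2))); first by lra.
  apply: (@le_trans _ _ (s / 2 * (s ^+ 2 / 4))); first by apply: ler_pM; lra.
  by rewrite le_eqVlt; apply/orP; left; apply/eqP; field.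
set t := s - 2 * y in t0 ts t3 *.
have tt : t ^+ 2 <= s ^+ 3.
  have [s1|s1] := leP 1 s.
    apply: (@le_trans _ _ (s ^+ 2)); first by rewrite lerXn2r ?nnegrE// ltW.
    by rewrite ler_weXn2l// ltW.
  apply: (@le_trans _ _ (s * (s ^+ 3 / 8))); first by rewrite expr2; apply: ler_pM.
  have : 0 < s ^+ 3 by rewrite exprn_gt0.
  nra.
have tt2 : t ^+ 2 <= s ^+ 2 by rewrite lerXn2r ?nnegrE// ltW.
rewrite ger0_norm; last first.
  by rewrite addr_ge0// ?mulr_ge0 ?sqr_ge0//; lra.
have h1 : 2 * c * t ^+ 2 <= 6 * s ^+ 3.
  apply: (@le_trans _ _ (2 * (s + 2) * t ^+ 2)).
    by rewrite ler_wpM2r ?sqr_ge0//; lra.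
  have : s * t ^+ 2 <= s * s ^+ 2 by rewrite ler_wpM2l// ltW.
  rewrite -exprS; lra.
have h2 : 8 * (y * (c - 2)) * s <= 4 * s ^+ 3.
  have : (y * (c - 2)) * s <= (s ^+ 2 / 2) * s by rewrite ler_wpM2r// ltW.
  rewrite [in X in _ <= X -> _]mulrAC -exprSr; lra.
lra.
Qed.

Lemma dprofile_lip x y : 0 < x -> x <= y -> `|dprofile x - dprofile y| <= 10 * (y - x).
Proof.
move=> x0; rewrite le_eqVlt => /predU1P[->|xy]; first by rewrite !subrr normr0 mulr0.
have D z : z \in `]x, y[ -> is_derive z 1 dprofile (d2profile z).
  rewrite in_itv/= => /andP[xz _]; apply: is_derive_dprofile.
  by rewrite gt_eqF// sh2_gt0// (lt_trans x0).
have [|c] := @MVT _ dprofile d2profile x y xy D.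
  apply: derivable_within_continuous => z; rewrite in_itv/= => /andP[xz _].
  have z0 : sh2 z != 0 by rewrite gt_eqF// sh2_gt0// (lt_le_trans x0).
  by have [] := is_derive_dprofile z0.
rewrite in_itv/= => /andP[xc _] E.
rewrite distrC E normrM (ger0_norm (_ : 0 <= y - x)); last by rewrite subr_ge0 ltW.
by rewrite ler_wpM2r ?subr_ge0 ?(ltW xy)// d2profile_bound// (lt_trans x0).
Qed.

(** The Lipschitz bound, since [dprofile] tends to [0] at [0]. *)
Lemma dprofile_le_lin y : 0 < y -> dprofile y <= 10 * y.
Proof.
move=> y0; apply/ler_addgt0Pr => e e0.
pose z := Num.min y (Num.min 1 (e / 4)).
have z0 : 0 < z by rewrite !lt_min y0 ltr01 divr_gt0.
have zy : z <= y by rewrite /z ge_min lexx.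
have z1 : z <= 1 by rewrite /z !ge_min lexx orbT.
have ze : z <= e / 4 by rewrite /z !ge_min lexx !orbT.
have := dprofile_lip z0 zy; rewrite distrC => /(le_trans (ler_norm _)).
have := dprofile_le z0; nra.
Qed.

End Dispersion.

Section OmegaFacts.
Context {R : realType}.
Context (delta : R) (delta_gt0 : 0 < delta).
Local Notation Om := (Omega delta).
Implicit Types (x y s : R).

Lemma OmegaN x : Om (- x) = - Om x.
Proof.
rewrite /Omega /coth !mulrN opprK sqrrN mulNr.
rewrite (_ : expR (- (delta * x)) - expR (delta * x) = - (expR (delta * x) - expR (- (delta * x)))); last by ring.
by rewrite invrN mulrN (addrC (expR (- _))); ring.
Qed.

Lemma OmegaE x : Om x = x ^+ 2 * (ch2 (delta * x) / sh2 (delta * x)) - x / delta.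
Proof. by []. Qed.

Lemma sh2_neq0 x : x != 0 -> sh2 (delta * x) != 0.
Proof.
move=> x0; have [xp|xn|E] := ltgtP 0 x; last by move: x0; rewrite -E eqxx.
  by rewrite gt_eqF// sh2_gt0// mulr_gt0.
by rewrite -[delta * x]opprK sh2N oppr_eq0 gt_eqF// sh2_gt0// -mulrN mulr_gt0// oppr_gt0.
Qed.

Let is_derive_neq0 x : x != 0 -> is_derive x 1 Om (dprofile (delta * x) / delta).
Proof.
move=> x0; have s0 := sh2_neq0 x0.
have d0 : delta != 0 by rewrite gt_eqF.
have D1 : is_derive x 1 (fun z => delta * z) delta.
  by apply: is_derive_eq; rewrite /GRing.scale/=; ring.
have dS : is_derive x 1 (fun z => sh2 (delta * z)) (delta * ch2 (delta * x)).
  by rewrite mulrC; exact: (@is_derive1_comp _ sh2 (fun z => delta * z) x _ _ (is_derive_sh2 _) D1).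
have dC : is_derive x 1 (fun z => ch2 (delta * z)) (delta * sh2 (delta * x)).
  by rewrite mulrC; exact: (@is_derive1_comp _ ch2 (fun z => delta * z) x _ _ (is_derive_ch2 _) D1).
have iV : is_derive x 1 (fun z => (sh2 (delta * z))^-1) (- (sh2 (delta * x)) ^- 2 *: (delta * ch2 (delta * x))).
  exact: is_deriveV.
have -> : Om = (fun z => z ^+ 2 * (ch2 (delta * z) * (sh2 (delta * z))^-1) - delta^-1 * z).
  by apply/funext => z; rewrite OmegaE (mulrC delta^-1).
apply: is_derive_eq; rewrite /GRing.scale/= /dprofile.
have E := ch2_sqr (delta * x).
have -> : 4 * (delta * x) ^+ 2 / sh2 (delta * x) ^+ 2 = (delta * x) ^+ 2 * (ch2 (delta * x) ^+ 2 - sh2 (delta * x) ^+ 2) / sh2 (delta * x) ^+ 2.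
  by rewrite E; ring.
by field; rewrite s0 d0.
Qed.

(** This gives the derivative at [0], where [coth] is singular. *)
Let Omega_cubic x : `|Om x| <= delta * `|x| ^+ 3.
Proof.
wlog x0 : x / 0 <= x.
  move=> W; have [x0|/ltW x0] := leP 0 x; first exact: W.
  by rewrite -normrN -OmegaN -(normrN x) W// oppr_ge0.
move: x0; rewrite le_eqVlt => /predU1P[<-|x0].
  by rewrite OmegaE normr0 !expr0n/= !mul0r subrr normr0 mulr0.
have y0 : 0 < delta * x by rewrite mulr_gt0.
have s0 := sh2_gt0 y0; have h1 := sh2_le_ch2 (ltW y0); have h2 := ch2_sh2_le y0.
have -> : Om x = x / delta * ((delta * x * ch2 (delta * x) - sh2 (delta * x)) / sh2 (delta * x)).
  by rewrite OmegaE; field; rewrite !gt_eqF.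
have h3 : 0 <= (delta * x * ch2 (delta * x) - sh2 (delta * x)) / sh2 (delta * x).
  by apply: divr_ge0; [rewrite subr_ge0|exact: ltW].
rewrite ger0_norm; last by rewrite mulr_ge0// divr_ge0 ?(ltW x0) ?(ltW delta_gt0).
rewrite (ger0_norm (ltW x0)).
have -> : delta * x ^+ 3 = x / delta * (delta * x) ^+ 2 by field; rewrite gt_eqF.
by rewrite ler_wpM2l ?divr_ge0 ?(ltW x0) ?(ltW delta_gt0)// ler_pdivrMr.
Qed.

Let is_derive_0 : is_derive (0:R) 1 Om 0.
Proof.
have C : h^-1 *: (Om (h *: 1 + 0) - Om 0) @[h --> 0^'] --> (0 : R).
  have E : Om 0 = 0 by rewrite OmegaE expr0n/= !mul0r subrr.
  apply/cvgrPdist_le => e e0.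
  pose r := Num.min 1 (e / delta).
  have r0 : 0 < r by rewrite lt_min ltr01 divr_gt0.
  rewrite near_withinE; apply/nbhs_ballP; exists r => //= h; rewrite /ball/= sub0r normrN => hr h0.
  have h1 : `|h| <= 1 by rewrite ltW// (lt_le_trans hr)// /r ge_min lexx.
  have h2 : `|h| <= e / delta by rewrite ltW// (lt_le_trans hr)// /r ge_min lexx orbT.
  have n0 : 0 < `|h| by rewrite normr_gt0.
  rewrite E subr0 addr0 sub0r normrN normrM normfV ler_pdivrMl//.
  have -> : (h%:A : R) = h by rewrite /GRing.scale/= mulr1.
  apply: le_trans (Omega_cubic h) _; rewrite mulrC exprS -mulrA ler_wpM2l//.
  rewrite -ler_pdivlMr//; apply: le_trans h2.
  by rewrite expr2 ler_piMr.
apply: DeriveDef; first by apply/cvg_ex; exists 0.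
by apply: cvg_lim => //; exact: Rhausdorff.
Qed.

Lemma is_derive_Omega x : is_derive x 1 Om (derive1 Om x).
Proof.
rewrite derive1E; apply: derivableP.
have [->|x0] := eqVneq x 0; first by have [] := is_derive_0.
by have [] := is_derive_neq0 x0.
Qed.

Lemma derive1_Omega0 : derive1 Om 0 = 0.
Proof. by rewrite derive1E; have [_] := is_derive_0. Qed.

Lemma derive1_OmegaE x : x != 0 -> derive1 Om x = dprofile (delta * x) / delta.
Proof. by move=> x0; rewrite derive1E; have [_] := is_derive_neq0 x0. Qed.

Lemma derive1_OmegaN x : derive1 Om (- x) = derive1 Om x.
Proof.
have [->|x0] := eqVneq x 0; first by rewrite oppr0.
by rewrite !derive1_OmegaE ?oppr_eq0// mulrN dprofileN.
Qed.

Lemma derive1_Omega_norm x : derive1 Om x = derive1 Om `|x|.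
Proof. by have [x0|x0] := leP 0 x; rewrite ?(ger0_norm x0)// (ltr0_norm x0) derive1_OmegaN. Qed.

Lemma derive1_Omega_ge0 x : 0 <= derive1 Om x.
Proof.
rewrite derive1_Omega_norm; have [->|x0] := eqVneq x 0; first by rewrite normr0 derive1_Omega0.
by rewrite derive1_OmegaE ?normr_eq0// divr_ge0 ?(ltW delta_gt0)// dprofile_ge0// mulr_gt0// normr_gt0.
Qed.

Lemma derive1_Omega_le x : derive1 Om x <= 10 * `|x|.
Proof.
rewrite derive1_Omega_norm; have [->|x0] := eqVneq x 0.
  by rewrite normr0 derive1_Omega0 mulr0.
rewrite derive1_OmegaE ?normr_eq0// ler_pdivrMr// -mulrA (mulrC _ delta).
by apply: dprofile_le_lin; rewrite mulr_gt0// normr_gt0.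
Qed.

Lemma derive1_Omega_lip x y : `|derive1 Om x - derive1 Om y| <= 10 * `|x - y|.
Proof.
suff H a b : 0 <= a -> a <= b -> `|derive1 Om a - derive1 Om b| <= 10 * (b - a).
  rewrite (derive1_Omega_norm x) (derive1_Omega_norm y).
  apply: (@le_trans _ _ (10 * Num.norm (`|x| - `|y|))); last first.
    by rewrite ler_wpM2l// ler_dist_dist.
  have [h|/ltW h] := leP `|x| `|y|.
    by apply: le_trans (H _ _ (normr_ge0 x) h) _; rewrite ler_wpM2l// distrC ler_norm.
  rewrite distrC; apply: le_trans (H _ _ (normr_ge0 y) h) _.
  by rewrite ler_wpM2l// ler_norm.
rewrite le_eqVlt => /predU1P[<-|a0] ab.
  rewrite derive1_Omega0 sub0r normrN subr0 ger0_norm ?derive1_Omega_ge0//.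
  by apply: le_trans (derive1_Omega_le b) _; rewrite ger0_norm.
have b0 := lt_le_trans a0 ab.
rewrite !derive1_OmegaE ?gt_eqF// -mulrBl normrM (gtr0_norm (x := delta^-1)) ?invr_gt0//.
rewrite ler_pdivrMr//; have := @dprofile_lip _ (delta * a) (delta * b).
rewrite mulr_gt0// ler_pM2l// => /(_ isT ab) /le_trans; apply.
by rewrite le_eqVlt; apply/orP; left; apply/eqP; ring.
Qed.

Lemma continuous_Omega : continuous Om.
Proof. exact: cont_of_derive is_derive_Omega. Qed.

Lemma meas_Omega : measurable_fun setT Om.
Proof. exact: continuous_measurable_fun continuous_Omega. Qed.

Lemma continuous_derive1_Omega : continuous (derive1 Om).
Proof.
move=> x; apply/cvgrPdist_le => e e0; near=> y.
apply: le_trans (derive1_Omega_lip x y) _.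
rewrite mulrC -ler_pdivlMr//; near: y.
by apply: cvgr_dist_le => //; rewrite divr_gt0.
Unshelve. all: by end_near. Qed.

Lemma meas_q : measurable_fun setT (q delta).
Proof.
apply: (measurableT_comp (continuous_measurable_fun (@sqrt_continuous R))).
exact: continuous_measurable_fun continuous_derive1_Omega.
Qed.

Lemma qN x : q delta (- x) = q delta x.
Proof. by rewrite /q derive1_OmegaN. Qed.

Lemma q_ge0 x : 0 <= q delta x.
Proof. exact: sqrtr_ge0. Qed.

Lemma q_sqr x : q delta x ^+ 2 = derive1 Om x.
Proof. by rewrite sqr_sqrtr// derive1_Omega_ge0. Qed.

Lemma q_le_wt x : q delta x <= 4 * wt (1 / 2) x.
Proof.
rewrite -(@ler_pXn2r _ 2)// ?nnegrE ?q_ge0 ?mulr_ge0 ?(ltW (wt_gt0 _ _))//.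
rewrite q_sqr exprMn wt_half_sqr; apply: le_trans (derive1_Omega_le x) _.
have := id_le_wt1 x; have := normr_ge0 x; lra.
Qed.

(** The square root of a Lipschitz function is Hoelder continuous of exponent 1/2. *)
Lemma q_hoelder x y : (q delta x - q delta y) ^+ 2 <= 10 * `|x - y|.
Proof.
apply: le_trans (derive1_Omega_lip x y); rewrite -!q_sqr.
have := q_ge0 x; have := q_ge0 y; move: (q delta x) (q delta y) => a b b0 a0.
rewrite subr_sqr normrM (ger0_norm (_ : 0 <= a + b)) ?addr_ge0//.
rewrite -real_normK ?num_real// expr2 ler_wpM2l//.
by rewrite ler_norml; apply/andP; split; lra.
Qed.

Lemma Omega_mvt x s : exists2 t, `|t - x| <= `|s| /\ `|t - (x + s)| <= `|s| &
  Om (x + s) - Om x = s * derive1 Om t.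
Proof.
have H a b : a < b -> exists2 t, a < t < b & Om b - Om a = derive1 Om t * (b - a).
  move=> ab; have [|c] := @MVT _ Om (derive1 Om) a b ab (fun z _ => is_derive_Omega z).
    by apply: continuous_subspaceT; exact: continuous_Omega.
  by rewrite in_itv/= => cab E; exists c.
have [s0|s0|->] := ltgtP s 0.
- have [|t /andP[t1 t2] E] := H (x + s) x; first by lra.
  exists t; last by rewrite -opprB E; ring.
  by rewrite (ltr0_norm s0); split; rewrite ler_norml; apply/andP; split; lra.
- have [|t /andP[t1 t2] E] := H x (x + s); first by lra.
  exists t; last by rewrite E; ring.
  by rewrite (gtr0_norm s0); split; rewrite ler_norml; apply/andP; split; lra.
- exists x; last by rewrite addr0 subrr mul0r.
  by rewrite addr0 subrr normr0.
Qed.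

Lemma Omega_quad x : `|Om x| <= 10 * x ^+ 2.
Proof.
have [t [t1 _]] := Omega_mvt 0 x; rewrite add0r subr0 in t1 *.
have -> : Om 0 = 0 by rewrite OmegaE expr0n/= !mul0r subrr.
rewrite subr0 => ->; rewrite normrM (ger0_norm (derive1_Omega_ge0 t)).
apply: (@le_trans _ _ (`|x| * (10 * `|x|))).
  rewrite ler_wpM2l//; apply: le_trans (derive1_Omega_le t) _.
  by rewrite ler_wpM2l.
by rewrite -(real_normK (num_real x)) le_eqVlt; apply/orP; left; apply/eqP; ring.
Qed.

(** The difference quotient of [Omega] is [q t ^+ 2] for a [t] at distance at most
    [`|s|] from [x] and [x + s], and over this distance [q] varies by
    [sqrt (10 * `|s|)] at most. The free parameter [tau] balances the powers of
    [s]. *)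
Lemma Omega_commutator_symbol x s tau : 0 < tau ->
  `|Om (x + s) - Om x - s * (q delta x * q delta (x + s))| <=
  `|s| * (20 * (tau + `|s| / tau + `|s|) * wt (1 / 2) x).
Proof.
move=> tau0; have [t [t1 t2] ->] := Omega_mvt x s.
rewrite -q_sqr -mulrBr normrM ler_wpM2l//.
have a0 := q_ge0 t; have b0 := q_ge0 x; have c0 := q_ge0 (x + s).
have ab : (q delta t - q delta x) ^+ 2 <= 10 * `|s|.
  by apply: le_trans (q_hoelder t x) _; rewrite ler_wpM2l.
have ac : (q delta t - q delta (x + s)) ^+ 2 <= 10 * `|s|.
  by apply: le_trans (q_hoelder t (x + s)) _; rewrite ler_wpM2l.
have bW := q_le_wt x; have W1 : 1 <= wt (1 / 2) x by apply: wt_ge1.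
set W := wt (1 / 2) x in W1 bW *; set A := `|s| in ab ac *.
move: a0 b0 c0 ab ac bW; move: (q delta t) (q delta x) (q delta (x + s)) => a b c.
move=> a0 b0 c0 ab ac bW.
have A0 : 0 <= A by exact: normr_ge0.
have E : a ^+ 2 - b * c = a * (a - b) + b * (a - c) by ring.
rewrite E; apply: le_trans (ler_normD _ _) _; rewrite !normrM (ger0_norm a0) (ger0_norm b0).
set d := `|a - b|; set d' := `|a - c|.
have d0 : 0 <= d by exact: normr_ge0.
have d'0 : 0 <= d' by exact: normr_ge0.
have dd : d ^+ 2 <= 10 * A by rewrite real_normK ?num_real.
have dd' : d' ^+ 2 <= 10 * A by rewrite real_normK ?num_real.
have abd : a <= b + d by have := ler_norm (a - b); rewrite -/d; lra.
have T0 : 0 <= tau + A / tau by rewrite addr_ge0 ?divr_ge0// ltW.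
(* the arithmetic-geometric mean of [tau] and [`|s| / tau] *)
have am (e : R) : 0 <= e -> e ^+ 2 <= 10 * A -> e <= 2 * (tau + A / tau).
  move=> e0 ee; rewrite -(@ler_pXn2r _ 2)// ?nnegrE ?mulr_ge0//; apply: (le_trans ee).
  have : 0 <= (tau - A / tau) ^+ 2 by exact: sqr_ge0.
  have -> : (2 * (tau + A / tau)) ^+ 2 = 4 * (tau - A / tau) ^+ 2 + 16 * A.
    by field; rewrite gt_eqF.
  lra.
have h1 : b * d <= 4 * W * (2 * (tau + A / tau)) by apply: ler_pM => //; exact: am.
have h2 : b * d' <= 4 * W * (2 * (tau + A / tau)) by apply: ler_pM => //; exact: am.
have h3 : a * d <= b * d + d ^+ 2 by rewrite expr2 -mulrDl ler_wpM2r.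
have h4 : A <= A * W by rewrite ler_peMr.
have h5 : 0 <= (tau + A / tau) * W by rewrite mulr_ge0//; lra.
lra.
Qed.

End OmegaFacts.

(** * The weight *)

Section Weight.
Context {R : realType}.
Local Notation mu := (@lebesgue_measure R).
Implicit Types (a s x : R).

Lemma hart_ae (f g : R -> R) : L2 f -> L2 g -> {ae mu, forall x, f x = g x} ->
  {ae mu, forall s, hart f s = hart g s}.
Proof.
move=> f2 g2 fg; have hf := hart_L2 f2; have hg := hart_L2 g2.
apply: nrm_ae_eq => //; have mB := L2_meas (hart_L2 (L2B f2 g2)).
rewrite -(nrm_ae mB (L2_meas (L2B hf hg)) (hartB f2 g2)) nrm_hart; last exact: L2B.
by rewrite nrm0_ae ?mulr0//; exact: L2_meas.
Qed.

Lemma expR_abs_meas a : measurable_fun setT (fun s => expR (- (a * `|s|))).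
Proof.
apply: measurableT_comp => //; apply: measurableT_comp => //.
by apply: measurable_funM => //; exact: measurableT_comp.
Qed.

Lemma expR_cos_line a x : 0 < a ->
  intR (fun s => expR (- (a * `|s|)) * cos (s * x)) = 2 * a / (a ^+ 2 + x ^+ 2).
Proof.
move=> a0; have [E1 EI] := expR_even_line a0.
have mc : measurable_fun setT (fun s => cos (s * x)).
  by under eq_fun do rewrite mulrC; exact: meas_cosM.
have [F1 FI] : L1 (fun s => expR (- (a * `|s|)) * (1 - cos (s * x))) /\
   intR (fun s => expR (- (a * `|s|)) * (1 - cos (s * x))) = 2 * (a^-1 - a / (a ^+ 2 + x ^+ 2)).
  apply: even_line.
  - by apply: measurable_funM; [exact: expR_abs_meas|exact: measurable_funB].
  - by move=> s; rewrite mulr_ge0 ?expR_ge0// subr_ge0 cos_le1.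
  - by move=> s; rewrite normrN mulNr cosN.
  rewrite -sinc_kernel_inner//; apply: eq_integral => s.
  by rewrite inE/= in_itv/= andbT => s0; rewrite ger0_norm// (mulrC s).
rewrite (_ : (fun s => _) = (fun s => expR (- (a * `|s|)) - expR (- (a * `|s|)) * (1 - cos (s * x)))).
  by rewrite intRB// EI FI; field; rewrite !gt_eqF// ltr_pwDl ?exprn_gt0 ?sqr_ge0.
by apply/funext => s; ring.
Qed.

Context (lam Lam : R) (lam_gt0 : 0 < lam) (lam_lt : lam < Lam).

Let Lam_gt0 : 0 < Lam. Proof. exact: lt_trans lam_lt. Qed.

(** The transform of the weight, up to a factor. The weight itself is
    [lam (atan (x / lam) - atan (x / Lam))]: the second term makes it
    square-integrable, while its derivative is at least [1/2 - lam / Lam] for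
    [|x| < lam] and never below [- lam / Lam]. *)
Definition kap s := lam * (expR (- (lam * `|s|)) - expR (- (Lam * `|s|))) / s.

Definition weight x := 2^-1 * intR (fun s => kap s * sin (s * x)).

Definition dweight x :=
  lam ^+ 2 / (lam ^+ 2 + x ^+ 2) - lam * Lam / (Lam ^+ 2 + x ^+ 2).

Lemma kapN s : kap (- s) = - kap s.
Proof. by rewrite /kap normrN invrN mulrN. Qed.

Lemma meas_kap : measurable_fun setT kap.
Proof.
apply: measurable_funM; last by apply: meas_inv.
by apply: measurable_funM => //; apply: measurable_funB; exact: expR_abs_meas.
Qed.

Let expd s : 0 <= expR (- (lam * `|s|)) - expR (- (Lam * `|s|)) <= expR (- (lam * `|s|)).
Proof.
rewrite subr_ge0 ler_expR lerN2 ler_wpM2r ?(ltW lam_lt)//= lerBlDr lerDl; exact: expR_ge0.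
Qed.

Lemma sM_kap s : s * kap s = lam * (expR (- (lam * `|s|)) - expR (- (Lam * `|s|))).
Proof.
have [->|s0] := eqVneq s 0; last by rewrite /kap mulrCA divff// mulr1.
by rewrite mul0r normr0 !mulr0 subrr mulr0.
Qed.

Lemma sM_kap_ge0 s : 0 <= s * kap s.
Proof. by rewrite sM_kap mulr_ge0 ?(ltW lam_gt0)//; case/andP: (expd s). Qed.

Lemma sM_kap_le s : `|s * kap s| <= lam * expR (- (lam * `|s|)).
Proof.
rewrite (ger0_norm (sM_kap_ge0 s)) sM_kap ler_wpM2l ?(ltW lam_gt0)//.
by case/andP: (expd s).
Qed.

Lemma kap_le s : `|kap s| <= lam * Lam * expR (- (lam * `|s|)).
Proof.
have [->|s0] := eqVneq s 0.
  by rewrite /kap invr0 mulr0 normr0 !mulr_ge0 ?expR_ge0 ?ltW.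
have n0 : 0 < `|s| by rewrite normr_gt0.
rewrite -(ler_pM2l n0) -normrM (ger0_norm (sM_kap_ge0 s)) sM_kap.
rewrite [leRHS](_ : _ = lam * (Lam * `|s| * expR (- (lam * `|s|)))); last by ring.
rewrite ler_wpM2l ?(ltW lam_gt0)//.
have -> : expR (- (Lam * `|s|)) = expR (- (lam * `|s|)) * expR (- ((Lam - lam) * `|s|)).
  by rewrite -expRD; congr expR; ring.
rewrite -[X in X - _]mulr1 -mulrBr mulrC ler_wpM2r ?expR_ge0//.
have := expR_ge1Dx (- ((Lam - lam) * `|s|)); have : 0 <= lam * `|s| by rewrite mulr_ge0 ?ltW.
lra.
Qed.

Let lamE := expR_even_line lam_gt0.

Lemma kap_L1 : L1 kap.
Proof. by apply: (L1_le meas_kap (L1Z (lam * Lam) lamE.1)); exact: kap_le. Qed.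

Lemma kap_L1_norm : intR (fun s => `|kap s|) <= 2 * Lam.
Proof.
apply: (@le_trans _ _ (intR (fun s => lam * Lam * expR (- (lam * `|s|))))).
  by apply: intR_le; [exact: L1_norm kap_L1|exact: L1Z lamE.1|exact: kap_le].
rewrite intRZ ?lamE.2; last exact: lamE.1.
by rewrite le_eqVlt; apply/orP; left; apply/eqP; field; rewrite gt_eqF.
Qed.

Lemma expR_abs_sqr a s : expR (- (a * `|s|)) ^+ 2 = expR (- (2 * a * `|s|)).
Proof. by rewrite expr2 -expRD; congr expR; ring. Qed.

Lemma kap_L2 : L2 kap.
Proof.
apply: (@L2_le _ _ (fun s => lam * Lam * expR (- (lam * `|s|)))).
- exact: meas_kap.
- apply: L2Z; split; first exact: expR_abs_meas.
  under eq_fun do rewrite expR_abs_sqr.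
  by have [] := @expR_even_line _ (2 * lam); rewrite ?mulr_gt0.
- by move=> s; rewrite [leRHS]ger0_norm ?kap_le// !mulr_ge0 ?expR_ge0// ltW.
Qed.

Lemma kap_L2_norm : ip kap kap <= lam * Lam ^+ 2.
Proof.
have l2 : 0 < 2 * lam by rewrite mulr_gt0.
have [E1 EI] := expR_even_line l2.
apply: (@le_trans _ _ (intR (fun s => (lam * Lam) ^+ 2 * expR (- (2 * lam * `|s|))))).
  rewrite ip_sqr; apply: intR_le; [exact: L2_sq kap_L2|exact: L1Z|move=> s].
  rewrite -expR_abs_sqr -exprMn -real_normK ?num_real//.
  by rewrite ler_pXn2r ?nnegrE ?kap_le// !mulr_ge0 ?expR_ge0// ltW.
rewrite intRZ// EI le_eqVlt; apply/orP; left; apply/eqP; field.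
by rewrite gt_eqF.
Qed.

Lemma weight_hart1 x : weight x = 2^-1 * hart1 kap x.
Proof.
congr (_ * _); rewrite /hart1 /cas.
have m1 : measurable_fun setT (fun s => sin (s * x)).
  by under eq_fun do rewrite mulrC; exact: meas_sinM.
have m2 : measurable_fun setT (fun s => cos (s * x)).
  by under eq_fun do rewrite mulrC; exact: meas_cosM.
have L1s : L1 (fun s => kap s * sin (s * x)).
  under eq_fun do rewrite mulrC.
  apply: (L1Ml (c := 1) m1 _ kap_L1) => s; rewrite mulrC; exact: sinM_le1.
have L1c : L1 (fun s => kap s * cos (s * x)).
  under eq_fun do rewrite mulrC.
  apply: (L1Ml (c := 1) m2 _ kap_L1) => s; rewrite mulrC; exact: cosM_le1.
transitivity (intR (fun s => kap s * cos (s * x)) + intR (fun s => kap s * sin (s * x))).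
  rewrite [X in _ = X + _]intR_odd ?add0r//; first exact: L1_meas.
  by move=> s; rewrite kapN (mulNr s) cosN mulNr.
by rewrite -intRD//; apply: intR_ext => s; rewrite mulrDr.
Qed.

Lemma meas_weight : measurable_fun setT weight.
Proof.
rewrite (_ : weight = fun x => 2^-1 * hart1 kap x); last exact/funext/weight_hart1.
by apply: measurable_funM => //; apply: meas_hart1; exact: kap_L1.
Qed.

Lemma weight_le x : `|weight x| <= Lam.
Proof.
rewrite /weight normrM ger0_norm ?invr_ge0// ler_pdivrMl//.
apply: le_trans kap_L1_norm.
have m1 : measurable_fun setT (fun s => sin (s * x)).
  by under eq_fun do rewrite mulrC; exact: meas_sinM.
apply: intR_norm_le; last 1 first.
- by move=> s; rewrite normrM ler_piMr// mulrC sinM_le1.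
- under eq_fun do rewrite mulrC.
  apply: (L1Ml (c := 1) m1 _ kap_L1) => s; rewrite mulrC; exact: sinM_le1.
- exact: L1_norm kap_L1.
Qed.

Lemma weight_L2 : L2 weight.
Proof.
rewrite (_ : weight = fun x => 2^-1 * hart1 kap x); last exact/funext/weight_hart1.
by apply: L2Z; have [] := hart1_isometry kap_L1 kap_L2.
Qed.

Lemma weight_L2_norm : nrm weight ^+ 2 <= 2 * (lam * Lam ^+ 2).
Proof.
have [H2 HN] := hart1_isometry kap_L1 kap_L2.
rewrite (_ : weight = fun x => 2^-1 * hart1 kap x); last exact/funext/weight_hart1.
rewrite nrmZ// HN ger0_norm ?invr_ge0// !exprMn sqr_sqrtr ?mulr_ge0 ?pi_ge0//.
rewrite nrm_sqr; have := kap_L2_norm; have := ip_ge0 kap; have /andP[_] := pihalf_02 R; have := @pi_ge0 R.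
set k := ip _ _ => p0 k0 kl p4.
rewrite mulrA; apply: ler_pM => //; first by rewrite !mulr_ge0 ?exprn_ge0 ?invr_ge0.
by rewrite expr2 -invfM; lra.
Qed.

Lemma hart_weight : {ae mu, forall s, hart weight s = pi * kap s}.
Proof.
have [H2 HN] := hart1_isometry kap_L1 kap_L2.
have K2 := hart_L2 kap_L2.
have A : {ae mu, forall x, weight x = 2^-1 * hart kap x}.
  by apply: filterS (hart_hart1 kap_L1 kap_L2) => x ->; exact: weight_hart1.
have B := hart_ae weight_L2 (L2Z 2^-1 K2) A.
apply: filterS2 B (filterI (hartZ 2^-1 K2) (hart_hart kap_L2)) => s -> [-> ->].
by field.
Qed.

Lemma dweightE x : dweight x = 2^-1 * intR (fun s => s * kap s * cos (s * x)).
Proof.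
have L1e a : 0 < a -> L1 (fun s => expR (- (a * `|s|)) * cos (s * x)).
  move=> a0; under eq_fun do rewrite mulrC.
  apply: (@L1Ml _ 1); last by case: (expR_even_line a0).
    by under eq_fun do rewrite mulrC; exact: meas_cosM.
  by move=> s; rewrite mulrC cosM_le1.
rewrite (_ : (fun s => s * kap s * cos (s * x)) = (fun s =>
  lam * (expR (- (lam * `|s|)) * cos (s * x) - expR (- (Lam * `|s|)) * cos (s * x)))).
  rewrite intRZ; last by apply: L1B; exact: L1e.
  rewrite intRB; try exact: L1e.
  rewrite !expR_cos_line// /dweight; field.
  by rewrite !gt_eqF// ltr_pwDl ?exprn_gt0 ?sqr_ge0.
by apply/funext => s; rewrite sM_kap; ring.
Qed.

Lemma meas_dweight : measurable_fun setT dweight.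
Proof.
by apply: measurable_funB; apply: measurable_funM => //; apply: meas_inv;
  apply: measurable_funD => //; exact: measurable_funX.
Qed.

Lemma dweight_le1 x : `|dweight x| <= 1.
Proof.
have h a : 0 < a -> 0 < a ^+ 2 + x ^+ 2 by move=> a0; rewrite ltr_pwDl ?exprn_gt0 ?sqr_ge0.
have x2 : 0 <= x ^+ 2 by exact: sqr_ge0.
have h1 : lam ^+ 2 / (lam ^+ 2 + x ^+ 2) <= 1 by rewrite ler_pdivrMr ?h// mul1r lerDl.
have h2 : 0 <= lam ^+ 2 / (lam ^+ 2 + x ^+ 2) by rewrite divr_ge0 ?sqr_ge0// ltW// h.
have h3 : lam * Lam / (Lam ^+ 2 + x ^+ 2) <= 1.
  rewrite ler_pdivrMr ?h// mul1r; apply: (@le_trans _ _ (Lam ^+ 2)); last by rewrite lerDl.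
  by rewrite expr2 ler_wpM2r// ltW.
have h4 : 0 <= lam * Lam / (Lam ^+ 2 + x ^+ 2) by rewrite divr_ge0 ?mulr_ge0// ltW// h.
by rewrite /dweight ler_norml; apply/andP; split; lra.
Qed.

Lemma dweight_ge x : - (lam / Lam) <= dweight x.
Proof.
have h a : 0 < a -> 0 < a ^+ 2 + x ^+ 2 by move=> a0; rewrite ltr_pwDl ?exprn_gt0 ?sqr_ge0.
have h2 : 0 <= lam ^+ 2 / (lam ^+ 2 + x ^+ 2) by rewrite divr_ge0 ?sqr_ge0// ltW// h.
suff : lam * Lam / (Lam ^+ 2 + x ^+ 2) <= lam / Lam by rewrite /dweight; lra.
rewrite ler_pdivrMr ?h// mulrDr (_ : lam / Lam * Lam ^+ 2 = lam * Lam).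
  by rewrite lerDl mulr_ge0 ?sqr_ge0// divr_ge0// ltW.
by field; rewrite gt_eqF.
Qed.

Lemma dweight_ge_half x : `|x| < lam -> 2^-1 - lam / Lam <= dweight x.
Proof.
move=> xl.
have h a : 0 < a -> 0 < a ^+ 2 + x ^+ 2 by move=> a0; rewrite ltr_pwDl ?exprn_gt0 ?sqr_ge0.
have x2 : x ^+ 2 <= lam ^+ 2.
  by rewrite -(real_normK (num_real x)) ler_pXn2r ?nnegrE ?(ltW lam_gt0)// ltW.
have h1 : 2^-1 <= lam ^+ 2 / (lam ^+ 2 + x ^+ 2).
  by rewrite ler_pdivlMr ?h//; lra.
suff : lam * Lam / (Lam ^+ 2 + x ^+ 2) <= lam / Lam by rewrite /dweight; lra.
rewrite ler_pdivrMr ?h// mulrDr (_ : lam / Lam * Lam ^+ 2 = lam * Lam).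
  by rewrite lerDl mulr_ge0 ?sqr_ge0// divr_ge0// ltW.
by field; rewrite gt_eqF.
Qed.

End Weight.

(** * Virial identities *)

Section Superposition.
Context {R : realType}.
Local Notation mu := (@lebesgue_measure R).
Implicit Types (f g k p : R -> R).

(** Fubini's theorem: a modulation is integrated in its frequency against [k]. *)
Lemma superposition (c : R -> R) k p : measurable_fun setT c ->
  (forall x, `|c x| <= 1) -> L1 k -> L1 p ->
  L1 (fun s => k s * intR (fun x => c (s * x) * p x)) /\
  intR (fun s => k s * intR (fun x => c (s * x) * p x)) =
  intR (fun x => intR (fun s => k s * c (s * x)) * p x).
Proof.
move=> mc c1 k1 p1.
have mK : measurable_fun setT (fun z : R * R => k z.1 * (c (z.1 * z.2) * p z.2)).
  apply: measurable_funM; first exact: meas_fst_fun (L1_meas k1).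
  apply: measurable_funM; last exact: meas_snd_fun (L1_meas p1).
  apply: measurableT_comp => //; apply: measurable_funM; first exact: measurable_fst.
  exact: measurable_snd.
have [|A B A1 B1 E] := @fubini_dom R (fun s x => k s * (c (s * x) * p x))
    (fun s => `|k s|) (fun x => `|p x|) mK (L1_norm k1) (L1_norm p1).
  by move=> s x; rewrite !normrM ler_wpM2l// ler_piMl.
have m1 s : measurable_fun setT (fun x : R => c (s * x)).
  by apply: measurableT_comp => //; exact: measurable_funM.
have m2 x : measurable_fun setT (fun s : R => c (s * x)).
  by apply: measurableT_comp => //; exact: measurable_funM.
have EA s : intR (fun x => k s * (c (s * x) * p x)) = k s * intR (fun x => c (s * x) * p x).
  by rewrite intRZ//; exact: (L1Ml (c := 1)).
have EB x : intR (fun s => k s * (c (s * x) * p x)) = intR (fun s => k s * c (s * x)) * p x.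
  rewrite mulrC -intRZ; first by apply: intR_ext => s; ring.
  by under eq_fun do rewrite mulrC; exact: (L1Ml (c := 1)).
split.
  by move: A1; congr L1; apply/funext.
rewrite -(intR_ext EA) E; exact: intR_ext.
Qed.

End Superposition.

Section Virial.
Context {R : realType} (lam Lam : R) (lam_gt0 : 0 < lam) (lam_lt : lam < Lam).
Local Notation mu := (@lebesgue_measure R).
Local Notation kap := (kap lam Lam).
Local Notation w := (weight lam Lam).
Local Notation dw := (dweight lam Lam).
Implicit Types (f g v : R -> R) (s x : R).

(** The identities for [sin (s * x)] and [cos (s * x)] are integrated in [s]
    against [kap]: the former add up to the weight, the latter, with the extra factor
    [s], to its derivative. *)
Lemma weight_superposition f g : L2 f -> L2 g ->
  L1 (fun s => kap s * ip (fun x => sin (s * x) * f x) g) /\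
  intR (fun s => kap s * ip (fun x => sin (s * x) * f x) g) = 2 * ip (fun x => w x * f x) g.
Proof.
move=> f2 g2; have fg := L2M f2 g2.
have sin1 (x : R) : `|sin x| <= 1 by rewrite ler_norml sin_geN1 sin_le1.
have [A B] := superposition (continuous_measurable_fun (@continuous_sin R)) sin1
  (kap_L1 lam_gt0 lam_lt) fg.
have E s : kap s * ip (fun x => sin (s * x) * f x) g =
    kap s * intR (fun x => sin (s * x) * (f x * g x)).
  by congr (_ * _); apply: intR_ext => x; rewrite mulrA.
rewrite (funext E); split => //; rewrite B /ip -intRZ.
  by apply: intR_ext => x; rewrite /weight; field.
by under eq_fun do rewrite -mulrA; apply: (L1Ml _ (weight_le lam_gt0 lam_lt)) => //; exact: meas_weight.
Qed.

Lemma dweight_L2 f : L2 f -> L2 (fun x => dw x * f x).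
Proof. by apply: (L2Ml (c := 1)) => //; [exact: meas_dweight|exact: dweight_le1]. Qed.

Lemma weight_mul_L2 f : L2 f -> L2 (fun x => w x * f x).
Proof. by apply: (L2Ml _ (weight_le lam_gt0 lam_lt)) => //; exact: meas_weight. Qed.

Lemma dweight_superposition f g : L2 f -> L2 g ->
  L1 (fun s => s * kap s * ip (fun x => cos (s * x) * f x) g) /\
  intR (fun s => s * kap s * ip (fun x => cos (s * x) * f x) g) = 2 * ip (fun x => dw x * f x) g.
Proof.
move=> f2 g2; have fg := L2M f2 g2.
have cos1 (x : R) : `|cos x| <= 1 by rewrite ler_norml cos_geN1 cos_le1.
have k1 : L1 (fun s => s * kap s).
  apply: (L1_le _ (L1Z lam (expR_even_line lam_gt0).1)).
    by apply: measurable_funM => //; exact: meas_kap.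
  exact: sM_kap_le.
have [A B] := superposition (continuous_measurable_fun (@continuous_cos R)) cos1 k1 fg.
have E s : s * kap s * ip (fun x => cos (s * x) * f x) g =
    s * kap s * intR (fun x => cos (s * x) * (f x * g x)).
  by congr (_ * _); apply: intR_ext => x; rewrite mulrA.
rewrite (funext E); split => //; rewrite B /ip -intRZ.
  by apply: intR_ext => x; rewrite dweightE//; field.
by apply: L2M => //; exact: dweight_L2.
Qed.

Lemma weight_transport v Dv : L2 v -> has_symbol (fun x => - x) v Dv ->
  2 * ip (fun x => w x * v x) Dv = - ip (fun x => dw x * v x) v.
Proof.
move=> v2 Ds; have [D2 _] := Ds.
have [A1 A2] := weight_superposition v2 D2; have [B1 B2] := dweight_superposition v2 v2.
rewrite -A2; apply: (mulfI (x := 2)) => //; rewrite mulrN -B2 -intRZ// -intRN//.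
apply: intR_ext => s; have := sin_derivative s v2 v2 Ds Ds.
set a := ip _ Dv; set b := ip _ v => E.
have -> : a = - s * b / 2 by lra.
by field.
Qed.

Lemma weight_cubic v Dv : L2 v -> L2 (fun x => wt 1 x * hart v x) ->
  has_symbol (fun x => - x) v Dv ->
  3 * ip (fun x => w x * v x) (fun x => v x * Dv x) =
  - ip (fun x => dw x * v x) (fun x => v x ^+ 2).
Proof.
move=> v2 w2 Ds; have [D2 _] := Ds.
have vv2 : L2 (fun x => v x ^+ 2) by exact: H1_mul_L2.
have [A1 A2] := weight_superposition vv2 D2; have [B1 B2] := dweight_superposition v2 vv2.
have -> : ip (fun x => w x * v x) (fun x => v x * Dv x) = ip (fun x => w x * v x ^+ 2) Dv.
  by apply: intR_ext => x; ring.
apply: (mulfI (x := 2)) => //; rewrite mulrN -B2 mulrCA -A2 -intRZ// -intRN//.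
apply: intR_ext => s; have := sin_cubic s v2 w2 Ds.
set a := ip _ Dv; set b := ip _ _ => E.
have -> : a = - s * b / 3 by lra.
by field.
Qed.

Lemma expR_absM_le s : lam * `|s| * expR (- (lam * `|s|)) <= 2 * expR (- (lam / 2 * `|s|)).
Proof.
have -> : expR (- (lam * `|s|)) = expR (- (lam / 2 * `|s|)) * expR (- (lam / 2 * `|s|)).
  by rewrite -expRD; congr expR; field.
rewrite mulrA ler_wpM2r ?expR_ge0// expRN ler_pdivrMr ?expR_gt0//.
have := expR_ge1Dx (lam / 2 * `|s|).
lra.
Qed.

Context (delta : R) (delta_gt0 : 0 < delta).
Local Notation Om := (Omega delta).
Local Notation q := (q delta).

(** The commutator of the dispersion with one frequency of the weight, against
    [q(D)] on both sides of the derivative of that frequency. *)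
Lemma sin_dispersion v Lv qv s tau : L2 v -> L2 (fun x => wt (1 / 2) x * hart v x) ->
  has_symbol Om v Lv -> L2 qv -> {ae mu, forall x, hart qv x = q x * hart v x} -> 0 < tau ->
  `|2 * ip (fun x => sin (s * x) * v x) Lv - s * ip (fun x => cos (s * x) * qv x) qv| <=
  5 * (`|s| * (tau + `|s| / tau + `|s|)) * nrm (fun x => wt (1 / 2) x * hart v x) ^+ 2.
Proof.
move=> v2 h2 Ls qv2 qvE tau0.
set g := hart v; have g2 : L2 g by exact: hart_L2.
set N := nrm _.
have pi2 := @pi_ge2 R; have pi0 := @pi_gt0 R.
have qg2 : L2 (fun x => q x * g x).
  apply: (L2_ae _ qvE (hart_L2 qv2)); apply: measurable_funM; [exact: meas_q|exact: L2_meas].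
have [c1 c2] := sin_commutator s (meas_Omega delta_gt0) (OmegaN delta) v2 v2 Ls Ls.
have E1 : 2 * ip (fun x => sin (s * x) * v x) Lv =
    (2 * pi)^-1 * intR (fun x => (Om (x + s) - Om x) * (g x * g (x + s))).
  rewrite [LHS]mulr_natl mulr2n c2 (_ : (4 * pi)^-1 = (2 * pi)^-1 * 2^-1); last first.
    by rewrite -invfM; congr (_^-1); ring.
  by rewrite -mulrA -intRZ//; congr (_ * _); apply: intR_ext => x; rewrite -/g; field.
have E2 : ip (fun x => cos (s * x) * qv x) qv =
    (2 * pi)^-1 * intR (fun x => q x * q (x + s) * (g x * g (x + s))).
  have Q2 := hart_L2 qv2.
  rewrite ip_cosM// (ipC (hart qv)) -mulr2n -[_ *+ 2]mulr_natl mulrA.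
  rewrite (_ : (4 * pi)^-1 * 2 = (2 * pi)^-1); last first.
    by rewrite (_ : 4 * pi = 2 * pi * 2) ?invfM ?mulfVK//; ring.
  congr (_ * _).
  have qs := ae_shift s qvE.
  rewrite (ip_ae _ _ _ qs); [|exact: L2_meas (L2_shift s Q2)|exact: L2_meas (L2_shift s qg2)|exact: L2_meas].
  rewrite ipC (ip_ae _ _ _ qvE); [|exact: L2_meas|exact: L2_meas|exact: L2_meas (L2_shift s qg2)].
  by rewrite /ip; apply: intR_ext => y; rewrite -/g; ring.
have i1 : L1 (fun x => (Om (x + s) - Om x) * (g x * g (x + s))).
  by have := L1Z 2^-1 c1; congr L1; apply/funext => x; rewrite -/g; field.
have i2 : L1 (fun x => q x * q (x + s) * (g x * g (x + s))).
  by have := L2M qg2 (L2_shift s qg2); congr L1; apply/funext => x; ring.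
rewrite E1 E2 mulrCA -mulrBr -intRZ// -intRB//; last exact: L1Z.
rewrite normrM (ger0_norm (_ : 0 <= (2 * pi)^-1)); last by rewrite invr_ge0; lra.
set B := tau + `|s| / tau + `|s|.
have B0 : 0 <= B by rewrite !addr_ge0 ?divr_ge0// ltW.
rewrite -[leLHS]mulrC.
have i3 : L1 (fun x => wt (1 / 2) x * g x * g (x + s)) by apply: L2M => //; exact: L2_shift.
have gN : nrm g <= N.
  apply: nrm_le_mono => // x; rewrite normrM ler_peMl//.
  by rewrite ger0_norm ?wt_ge1// ltW// wt_gt0.
have ib : intR (fun x => `|wt (1 / 2) x * g x * g (x + s)|) <= N ^+ 2.
  have a2 : L2 (fun x => `|wt (1 / 2) x * g x|).
    by apply: (L2_le _ h2) => [|x]; [apply: measurableT_comp => //; exact: L2_meas|rewrite normr_id].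
  have b2 : L2 (fun x => `|g (x + s)|).
    apply: (L2_le _ (L2_shift s g2)) => [|x]; last by rewrite normr_id.
    by apply: measurableT_comp => //; exact: L2_meas (L2_shift s g2).
  have := cauchy_schwarz a2 b2; rewrite /ip.
  under intR_ext do rewrite -normrM.
  move/(le_trans (ler_norm _))/le_trans; apply.
  rewrite expr2; apply: ler_pM; rewrite ?nrm_ge0//.
    by apply: nrm_le_mono => // x; rewrite normr_id.
  apply: le_trans gN; rewrite -(nrm_shift s (L2_meas g2)).
  by apply: nrm_le_mono => // [|x]; [exact: L2_shift|rewrite normr_id].
have H : `|intR (fun x => (Om (x + s) - Om x) * (g x * g (x + s)) - s * (q x * q (x + s) * (g x * g (x + s))))|
    <= `|s| * (20 * B) * N ^+ 2.
  apply: (@le_trans _ _ (intR (fun x => `|s| * (20 * B) * `|wt (1 / 2) x * g x * g (x + s)|))).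
    apply: intR_norm_le; [by apply: L1B => //; exact: L1Z|by apply: L1Z; exact: L1_norm|move=> x].
    rewrite (_ : _ - _ = (Om (x + s) - Om x - s * (q x * q (x + s))) * (g x * g (x + s))); last by ring.
    rewrite normrM; apply: le_trans (ler_wpM2r (normr_ge0 _) (Omega_commutator_symbol delta_gt0 x s tau0)) _.
    rewrite -/B !normrM (ger0_norm (ltW (wt_gt0 (1 / 2) x))).
    by rewrite le_eqVlt; apply/orP; left; apply/eqP; ring.
  rewrite intRZ; last exact: L1_norm.
  by rewrite ler_wpM2l// !mulr_ge0.
rewrite ler_pdivrMr; last by lra.
apply: (le_trans H).
have X0 : 0 <= `|s| * B * N ^+ 2 by rewrite !mulr_ge0// ?exprn_ge0// ?nrm_ge0.
rewrite (_ : `|s| * (20 * B) * N ^+ 2 = 20 * (`|s| * B * N ^+ 2)); last by ring.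
rewrite (_ : 5 * (`|s| * B) * N ^+ 2 * (2 * pi) = 10 * pi * (`|s| * B * N ^+ 2)); last by ring.
rewrite ler_wpM2r//; lra.
Qed.

(** The dispersive term is [\int w' (q v)^2] up to a commutator error, which is
    small because the frequencies [s] of the weight are at most of order [1 / lam]. *)
Lemma weight_dispersion v Lv qv tau : L2 v -> L2 (fun x => wt (1 / 2) x * hart v x) ->
  has_symbol Om v Lv -> L2 qv -> {ae mu, forall x, hart qv x = q x * hart v x} -> 0 < tau ->
  `|2 * ip (fun x => w x * v x) Lv - ip (fun x => dw x * qv x) qv| <=
  3 * (2 * tau + 8 * (tau^-1 + 1) / lam) * nrm (fun x => wt (1 / 2) x * hart v x) ^+ 2.
Proof.
move=> v2 h2 Ls qv2 qvE tau0; have [L2v _] := Ls.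
set N := nrm _.
have [A1 A2] := weight_superposition v2 L2v; have [B1 B2] := dweight_superposition qv2 qv2.
have lam2 : 0 < lam / 2 by rewrite divr_gt0.
have [e1 eI] := expR_even_line lam_gt0; have [f1 fI] := expR_even_line lam2.
have i1 : L1 (fun s => kap s * (2 * ip (fun x => sin (s * x) * v x) Lv -
    s * ip (fun x => cos (s * x) * qv x) qv)).
  by have := L1B (L1Z 2 A1) B1; congr L1; apply/funext => s; ring.
have N0 : 0 <= N ^+ 2 by rewrite exprn_ge0// nrm_ge0.
have t0 : 0 <= tau^-1 by rewrite invr_ge0 ltW.
have i2 := L1Z (5 * N ^+ 2) (L1D (L1Z (lam * tau) e1) (L1Z ((tau^-1 + 1) * 2) f1)).
have := intR_norm_le i1 i2.
rewrite intRZ ?intRD ?intRZ ?eI ?fI//; try exact: L1Z; last first.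
  by apply: L1D; exact: L1Z.
rewrite (_ : intR _ = 2 * (2 * ip (fun x => w x * v x) Lv - ip (fun x => dw x * qv x) qv)); last first.
  rewrite mulrBr -B2 -A2 -intRZ// -intRB//; last exact: L1Z.
  by apply: intR_ext => s; ring.
rewrite normrM (ger0_norm (_ : 0 <= 2))// => H.
have {}H := H _.
set X := `|_ - _| in H *.
suff : 2 * X <= 5 * N ^+ 2 * (lam * tau * (2 / lam) + (tau^-1 + 1) * 2 * (2 / (lam / 2))).
  rewrite (_ : lam * tau * (2 / lam) + (tau^-1 + 1) * 2 * (2 / (lam / 2)) = 2 * tau + 8 * (tau^-1 + 1) / lam); last first.
    by field; rewrite !gt_eqF.
  set Y := _ + _.
  have : 0 <= N ^+ 2 * Y.
    by rewrite mulr_ge0// /Y addr_ge0 ?mulr_ge0 ?addr_ge0 ?invr_ge0 ?(ltW tau0) ?(ltW lam_gt0).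
  lra.
apply: H => s; rewrite normrM.
apply: (le_trans (ler_wpM2l (normr_ge0 _) (sin_dispersion s v2 h2 Ls qv2 qvE tau0))).
rewrite -/N.
have k1 := sM_kap_le lam_gt0 lam_lt s; rewrite normrM in k1.
have k2 := expR_absM_le s.
have z0 : 0 <= tau + `|s| / tau + `|s| by rewrite !addr_ge0 ?divr_ge0// ltW.
rewrite (_ : `|kap s| * _ = 5 * N ^+ 2 * (`|s| * `|kap s| * (tau + `|s| / tau + `|s|))); last by ring.
rewrite ler_wpM2l ?(mulr_ge0 _ N0)//.
apply: (le_trans (ler_wpM2r z0 k1)).
have -> : lam * expR (- (lam * `|s|)) * (tau + `|s| / tau + `|s|) =
   lam * tau * expR (- (lam * `|s|)) + (tau^-1 + 1) * (lam * `|s| * expR (- (lam * `|s|))) by ring.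
by rewrite lerD2l -[leRHS]mulrA ler_wpM2l// addr_ge0.
Qed.

(** [Omega] is quadratic at [0], where the transform of the weight is
    concentrated. *)
Lemma weight_linear v Lv : L2 v -> has_symbol Om v Lv ->
  ip Lv w ^+ 2 <= 200 / lam * nrm (hart v) ^+ 2.
Proof.
move=> v2 [Lv2 LvE]; have w2 := weight_L2 lam_gt0 lam_lt; have g2 := hart_L2 v2.
have pi0 : pi != 0 :> R by rewrite gt_eqF// pi_gt0.
have lam2 : 0 < lam / 2 by rewrite divr_gt0.
have [e1 eI] := expR_even_line lam_gt0.
have mg : measurable_fun setT (fun x => hart v (- x)) by exact: L2_meas (L2_refl g2).
have mO := meas_Omega delta_gt0.
have mk := @meas_kap R lam Lam.
have s2 : L2 (fun s => 20 * expR (- (lam / 2 * `|s|))).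
  apply: L2Z; split; first exact: expR_abs_meas.
  by under eq_fun do (rewrite expR_abs_sqr (_ : 2 * (lam / 2) = lam); last by field).
have b s : `|Om s * kap s| <= `|20 * expR (- (lam / 2 * `|s|))|.
  rewrite [leRHS]ger0_norm ?mulr_ge0 ?expR_ge0//.
  have k1 := sM_kap_le lam_gt0 lam_lt s; rewrite normrM in k1.
  have k2 := expR_absM_le s.
  rewrite normrM; apply: (le_trans (ler_wpM2r (normr_ge0 _) (Omega_quad delta_gt0 s))).
  rewrite -(real_normK (num_real s)).
  rewrite (_ : _ * _ = 10 * `|s| * (`|s| * `|kap s|)); last by ring.
  apply: (le_trans (ler_wpM2l _ k1)); first by rewrite mulr_ge0.
  lra.
have Ok2 : L2 (fun s => Om s * kap s) by apply: (L2_le _ s2) => //; exact: measurable_funM.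
have E : ip Lv w = 2^-1 * ip (fun x => hart v (- x)) (fun s => Om s * kap s).
  apply: (mulfI (x := 2 * pi)); first by rewrite mulf_neq0.
  rewrite -ip_hart// ipC (ip_ae _ _ _ (hart_weight lam_gt0 lam_lt)); last 3 first.
  - exact: L2_meas (hart_L2 w2).
  - exact: measurable_funM.
  - exact: L2_meas (hart_L2 Lv2).
  rewrite ipC (ip_ae _ _ _ LvE); last 3 first.
  - exact: L2_meas (hart_L2 Lv2).
  - exact: measurable_funM.
  - exact: measurable_funM.
  rewrite mulrA (_ : 2 * pi * 2^-1 = pi); last by rewrite mulrAC mulfV ?mul1r.
  rewrite -ipZr//; last exact: L2_refl.
  by apply: intR_ext => x; ring.
rewrite E exprMn.
have := cauchy_schwarz_sqr (L2_refl g2) Ok2.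
rewrite -nrm_sqr nrm_refl; last exact: L2_meas.
have : ip (fun s => Om s * kap s) (fun s => Om s * kap s) <= 400 * (2 / lam).
  rewrite -nrm_sqr; apply: (@le_trans _ _ (nrm (fun s => 20 * expR (- (lam / 2 * `|s|))) ^+ 2)).
    by rewrite ler_pXn2r ?nnegrE ?nrm_ge0//; exact: nrm_le_mono.
  rewrite nrm_sqr ip_sqr -eI -intRZ// le_eqVlt; apply/orP; left; apply/eqP.
  apply: intR_ext => s; rewrite exprMn.
  by rewrite expR_abs_sqr (_ : 2 * (lam / 2) = lam); [ring|field].
set a := ip _ _; set c := nrm _ ^+ 2; set z := ip _ _ ^+ 2 => h1 h2.
have c0 : 0 <= c by rewrite exprn_ge0// nrm_ge0.
have : c * a <= c * (400 * (2 / lam)) by rewrite ler_wpM2l.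
rewrite expr2 -invfM; lra.
Qed.

End Virial.

(** * Curves in L^2 and smooth solutions *)

Section Curves.
Context {R : realType}.
Implicit Types (f w G : R -> R) (v : R -> R -> R) (t h : R).

Lemma is_derive_lim f t l : (f (t + h) - f t) / h @[h --> 0^'] --> l ->
  is_derive t 1 f l.
Proof.
move=> C.
have {}C : h^-1 *: (f (h *: 1 + t) - f t) @[h --> 0^'] --> l.
  rewrite (_ : (fun h => _) = (fun h => (f (t + h) - f t) / h))//.
  by apply/funext => h; rewrite /GRing.scale/= mulr1 mulrC (addrC h).
apply: DeriveDef; first by apply/cvg_ex; exists l.
by apply: cvg_lim => //; exact: Rhausdorff.
Qed.

Definition L2_derivative v t G := [/\ forall s, L2 (v s), L2 G &
  nrm (fun x => (v (t + h) x - v t x) / h - G x) @[h --> 0^'] --> 0].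

Lemma L2_derivative_linear v t G w : L2_derivative v t G -> L2 w ->
  is_derive t 1 (fun s => ip (v s) w) (ip G w).
Proof.
move=> [v2 G2 vG] w2; apply: is_derive_lim.
apply/cvgrPdist_le => e e0.
have N1 : 0 < nrm w + 1 by rewrite ltr_wpDl// nrm_ge0.
near=> h.
have P2 : L2 (fun x => (v (t + h) x - v t x) / h).
  by under eq_fun do rewrite mulrC; apply: L2Z; exact: L2B.
have E : (ip (v (t + h)) w - ip (v t) w) / h = ip (fun x => (v (t + h) x - v t x) / h) w.
  rewrite -ipBl// mulrC -ipZl//; last exact: L2B.
  by congr ip; apply/funext => x; rewrite mulrC.
rewrite E distrC -ipBl//; apply: (le_trans (cauchy_schwarz (L2B P2 G2) w2)).
set r := nrm _.
have rle : r <= e / (nrm w + 1).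
  rewrite -[r]ger0_norm ?nrm_ge0// /r; near: h.
  by apply: cvgr0_norm_le => //; rewrite divr_gt0.
apply: (@le_trans _ _ (r * (nrm w + 1))); first by rewrite ler_wpM2l ?nrm_ge0// lerDl.
by rewrite -ler_pdivlMr.
Unshelve. all: by end_near. Qed.

(** With [P] the difference quotient of [v] over a step [h], that of the quadratic
    form is [2 <w v, P> + h <w P, P>]. *)
Lemma L2_derivative_quadratic v t G w c : L2_derivative v t G ->
  measurable_fun setT w -> (forall x, `|w x| <= c) ->
  is_derive t 1 (fun s => ip (fun x => w x * v s x) (v s)) (2 * ip (fun x => w x * v t x) G).
Proof.
move=> [v2 G2 vG] mw wc; apply: is_derive_lim.
have W2 (f : R -> R) : L2 f -> L2 (fun x => w x * f x) by exact: L2Ml mw wc.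
have c0 : 0 <= c by apply: le_trans (wc 0).
have Wn (f : R -> R) : L2 f -> nrm (fun x => w x * f x) <= c * nrm f.
  move=> f2; rewrite -{1}(ger0_norm c0) -nrmZ//; apply: nrm_le_mono => [||x]; [exact: W2|exact: L2Z|].
  by rewrite !normrM (ger0_norm c0) ler_wpM2r.
have n0 := nrm_ge0 (v t); have g0 := nrm_ge0 G.
apply/cvgrPdist_le => e e0.
pose d1 := e / (4 * (c * nrm (v t) + 1)); pose d2 := e / (2 * (c * (nrm G + 1) ^+ 2 + 1)).
have d1p : 0 < d1 by rewrite divr_gt0 ?mulr_gt0// ltr_wpDl// mulr_ge0.
have d2p : 0 < d2 by rewrite divr_gt0 ?mulr_gt0// ltr_wpDl// mulr_ge0// sqr_ge0.
near=> h.
have h0 : h != 0 by near: h; exact: nbhs_dnbhs_neq.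
pose P x := (v (t + h) x - v t x) / h.
have P2 : L2 P.
  by rewrite /P; under eq_fun do rewrite mulrC; apply: L2Z; exact: L2B.
have PG2 := L2B P2 G2.
pose r := nrm (fun x => P x - G x).
have r1 : r <= 1.
  rewrite -[r]ger0_norm ?nrm_ge0// /r /P; near: h; apply: cvgr0_norm_le => //.
have r2 : r <= d1.
  rewrite -[r]ger0_norm ?nrm_ge0// /r /P; near: h; apply: cvgr0_norm_le => //.
have h2 : `|h| <= d2.
  by near: h; apply: cvgr0_norm_le => //; exact: cvg_within.
have i1 := L2M (W2 _ (v2 (t + h))) (v2 (t + h)); have i2 := L2M (W2 _ (v2 t)) (v2 t).
have i3 := L2M (W2 _ (v2 t)) PG2; have i4 := L2M (W2 _ P2) P2; have i5 := L2M (W2 _ (v2 t)) G2.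
have E : (ip (fun x => w x * v (t + h) x) (v (t + h)) - ip (fun x => w x * v t x) (v t)) / h
    - 2 * ip (fun x => w x * v t x) G =
    2 * ip (fun x => w x * v t x) (fun x => P x - G x) + h * ip (fun x => w x * P x) P.
  rewrite /ip -intRB// mulrC -!intRZ//; last exact: L1B.
  rewrite -intRB//; [|by apply: L1Z; exact: L1B|exact: L1Z].
  rewrite -intRD//; try exact: L1Z.
  by apply: intR_ext => x; rewrite /P; field.
rewrite distrC E; apply: le_trans (ler_normD _ _) _; rewrite !normrM.
have b1 : `|ip (fun x => w x * v t x) (fun x => P x - G x)| <= c * nrm (v t) * r.
  apply: (le_trans (cauchy_schwarz (W2 _ (v2 t)) PG2)).
  by rewrite ler_wpM2r ?nrm_ge0 ?Wn.
have Pn : nrm P <= nrm G + 1.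
  have := nrm_dist P2 G2; rewrite ler_norml -/r => /andP[_]; lra.
have b2 : `|ip (fun x => w x * P x) P| <= c * (nrm G + 1) ^+ 2.
  apply: (le_trans (cauchy_schwarz (W2 _ P2) P2)).
  apply: (@le_trans _ _ (c * nrm P * nrm P)); first by rewrite ler_wpM2r ?nrm_ge0 ?Wn.
  by rewrite -mulrA ler_wpM2l// expr2 ler_pM ?nrm_ge0.
have b3 : c * nrm (v t) * r <= e / 4.
  apply: (@le_trans _ _ ((c * nrm (v t) + 1) * d1)).
    by apply: ler_pM; rewrite ?mulr_ge0 ?nrm_ge0// lerDl.
  rewrite /d1 le_eqVlt; apply/orP; left; apply/eqP; field.
  by rewrite gt_eqF// ltr_wpDl// mulr_ge0.
have b4 : `|h| * `|ip (fun x => w x * P x) P| <= e / 2.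
  apply: (@le_trans _ _ (d2 * (c * (nrm G + 1) ^+ 2 + 1))).
    by apply: ler_pM => //; apply: (le_trans b2); rewrite lerDl.
  rewrite /d2 le_eqVlt; apply/orP; left; apply/eqP; field.
  by rewrite gt_eqF// ltr_wpDl// mulr_ge0// sqr_ge0.
by rewrite (ger0_norm (_ : 0 <= 2))//; lra.
Unshelve. all: by end_near. Qed.

End Curves.

Section SmoothSolution.
Context {R : realType} (delta : R) (delta_gt0 : 0 < delta).
Local Notation mu := (@lebesgue_measure R).
Local Notation Om := (Omega delta).
Local Notation q := (q delta).
Implicit Types (f v : R -> R).

Lemma Omega_le_wt2 x : `|Om x| <= 10 * wt 2 x.
Proof.
apply: le_trans (Omega_quad delta_gt0 x) _.
by rewrite wt2 ler_wpM2l// lerDr.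
Qed.

Lemma symbol_mul_L2 (m : R -> R) s c f : measurable_fun setT m ->
  (forall x, `|m x| <= c * wt s x) -> L2 f -> L2 (fun x => wt s x * hart f x) ->
  L2 (fun x => m x * hart f x) /\
  nrm (fun x => m x * hart f x) <= c * nrm (fun x => wt s x * hart f x).
Proof.
move=> mm ms f2 w2.
have c0 : 0 <= c.
  by rewrite -(pmulr_lge0 _ (wt_gt0 s 0)); apply: le_trans (ms 0).
have le x : `|m x * hart f x| <= `|c * (wt s x * hart f x)|.
  by rewrite mulrA !normrM ler_wpM2r// (ger0_norm c0) (ger0_norm (ltW (wt_gt0 _ _))).
have m2 : L2 (fun x => m x * hart f x).
  apply: (L2_le _ (L2Z c w2)) => //; apply: measurable_funM => //.
  by apply: L2_meas; exact: hart_L2.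
split => //; rewrite -{1}(ger0_norm c0) -nrmZ//; apply: nrm_le_mono => //; exact: L2Z.
Qed.

Lemma Dx_symbol f : L2 f -> L2 (fun x => wt 1 x * hart f x) ->
  has_symbol (fun x => - x) f (Dx f).
Proof.
move=> f2 w2.
have [m2 _] := symbol_mul_L2 (c := 1) (m := id) (@measurable_id _ _ _)
  (fun x => ltac:(by rewrite mul1r; exact: id_le_wt1)) f2 w2.
by have [] := fmult_odd f2 (m := id) (fun x => erefl) m2.
Qed.

Lemma ILW_op_symbol f : L2 f -> L2 (fun x => wt 2 x * hart f x) ->
  has_symbol Om f (ILW_op delta f).
Proof.
move=> f2 w2.
have mO : measurable_fun setT (fun x => - Om x).
  by apply: measurableT_comp => //; exact: meas_Omega.
have [m2 _] := symbol_mul_L2 (c := 10) mO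
  (fun x => ltac:(by rewrite normrN; exact: Omega_le_wt2)) f2 w2.
have [L2f E] := fmult_odd f2 (m := fun x => - Om x) (fun x => ltac:(by rewrite /= OmegaN)) m2.
by split => //; apply: filterS E => x ->; rewrite opprK.
Qed.

Lemma qDx_symbol f : L2 f -> L2 (fun x => wt (1 / 2) x * hart f x) ->
  L2 (qDx delta f) /\ {ae mu, forall x, hart (qDx delta f) x = q x * hart f x}.
Proof.
move=> f2 w2.
have [m2 _] := symbol_mul_L2 (c := 4) (meas_q delta_gt0)
  (fun x => ltac:(by rewrite ger0_norm ?q_ge0//; exact: q_le_wt)) f2 w2.
exact: (fmult_even f2 (qN delta_gt0) m2).
Qed.

Lemma nrm_le_hart f : L2 f -> nrm f <= nrm (hart f).
Proof.
move=> f2; rewrite nrm_hart// ler_peMl ?nrm_ge0//.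
have pi2 := @pi_ge2 R.
by rewrite -[leLHS]sqrtr1 ler_wsqrtr//; lra.
Qed.

Lemma nrm_hart_le_wt s f : 0 <= s -> L2 f -> L2 (fun x => wt s x * hart f x) ->
  nrm (hart f) <= nrm (fun x => wt s x * hart f x).
Proof.
move=> s0 f2 w2; apply: nrm_le_mono => //; first exact: hart_L2.
move=> x; rewrite normrM ler_peMl//.
by rewrite ger0_norm ?wt_ge1// ltW// wt_gt0.
Qed.

Lemma nrm_qDxB f g : L2 f -> L2 (fun x => wt (1 / 2) x * hart f x) ->
  L2 g -> L2 (fun x => wt (1 / 2) x * hart g x) ->
  nrm (fun x => qDx delta f x - qDx delta g x) <=
  4 * nrm (fun x => wt (1 / 2) x * hart (fun x => f x - g x) x).
Proof.
move=> f2 wf g2 wg; have fg2 := L2B f2 g2.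
have [qf2 qfE] := qDx_symbol f2 wf; have [qg2 qgE] := qDx_symbol g2 wg.
have hfg := hart_L2 fg2.
have wfg : L2 (fun x => wt (1 / 2) x * hart (fun x => f x - g x) x).
  apply: (L2_ae _ _ (L2B wf wg)).
    by apply: measurable_funM; [exact: meas_wt|exact: L2_meas].
  by apply: filterS (hartB f2 g2) => x ->; rewrite mulrBr.
have [m2 mle] := symbol_mul_L2 (c := 4) (meas_q delta_gt0)
  (fun x => ltac:(by rewrite ger0_norm ?q_ge0//; exact: q_le_wt)) fg2 wfg.
apply: le_trans mle; have qB := L2B qf2 qg2.
apply: (le_trans (nrm_le_hart qB)).
rewrite le_eqVlt; apply/orP; left; apply/eqP; apply: nrm_ae; try exact: L2_meas.
  exact: L2_meas (hart_L2 qB).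
have A := hartB qf2 qg2; have B := hartB f2 g2.
apply: (filterS2 _ _ A (filterI B (filterI qfE qgE))) => x -> [h1 [h2 h3]].
apply: (etrans (congr2 (fun a b => a - b) h2 h3)).
exact: (etrans (esym (mulrBr _ _ _)) (congr1 _ (esym h1))).
Qed.

Lemma nrm_qDx f : L2 f -> L2 (fun x => wt (1 / 2) x * hart f x) ->
  nrm (qDx delta f) <= 4 * nrm (fun x => wt (1 / 2) x * hart f x).
Proof.
move=> f2 wf; have [qf2 qfE] := qDx_symbol f2 wf.
have [m2 mle] := symbol_mul_L2 (c := 4) (meas_q delta_gt0)
  (fun x => ltac:(by rewrite ger0_norm ?q_ge0//; exact: q_le_wt)) f2 wf.
apply: le_trans mle; apply: (le_trans (nrm_le_hart qf2)).
rewrite le_eqVlt; apply/orP; left; apply/eqP; apply: nrm_ae => //; try exact: L2_meas.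
exact: L2_meas (hart_L2 qf2).
Qed.

Lemma smooth_solution_L2_derivative (u : R -> R -> R) t : smooth_solution delta u ->
  L2_derivative u t (fun x => - (ILW_op delta (u t) x + u t x * Dx (u t) x)).
Proof.
move=> [uH ut].
have H s r : 0 <= s -> L2 (u r) /\ L2 (fun x => wt s x * hart (u r) x).
  by move=> s0; have [/(_ r) /HsP[]] := uH s s0.
have u2 r : L2 (u r) by have [] := H 0 r (lexx _).
have [_ w1] := H 1 t ler01; have [_ w2] := H 2 t ltac:(by []).
have [D2 _] := Dx_symbol (u2 t) w1; have [Lu2 _] := ILW_op_symbol (u2 t) w2.
have G2 : L2 (fun x => ILW_op delta (u t) x + u t x * Dx (u t) x).
  by apply: L2D => //; exact: H1_mul_L2.
split => //; first exact: L2N.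
have := ut t.
under eq_fun => h.
  have P2 : L2 (fun x => (u (t + h) x - u t x) / h + ILW_op delta (u t) x + u t x * Dx (u t) x).
    under eq_fun do rewrite -addrA.
    by apply: L2D => //; under eq_fun do rewrite mulrC; apply: L2Z; exact: L2B.
  rewrite (LnormE P2).
  over.
move/fine_cvgP => [_]; apply: cvg_trans; apply: near_eq_cvg; near=> h => /=.
by congr nrm; apply/funext => x; rewrite opprK addrA.
Unshelve. all: by end_near. Qed.

End SmoothSolution.

(** * Monotonicity of the virial functional *)

Section VirialRate.
Context {R : realType} (lam Lam : R) (lam_gt0 : 0 < lam) (lam_lt : lam < Lam).
Local Notation mu := (@lebesgue_measure R).
Local Notation w := (weight lam Lam).
Local Notation dw := (dweight lam Lam).
Implicit Types (f g v : R -> R) (s x : R).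

Let Lam_gt0 : 0 < Lam. Proof. exact: lt_trans lam_lt. Qed.

Definition local_energy r f := intR (fun x => \1_[set y : R | `|y| < r] x * f x ^+ 2).

Lemma meas_ball r : measurable [set y : R | `|y| < r].
Proof.
have -> : [set y : R | `|y| < r] = `]- r, r[%classic.
  by apply/seteqP; split => y /=; rewrite in_itv/= ltr_norml.
exact: measurable_itv.
Qed.

Lemma local_energy_L1 r f : L2 f -> L1 (fun x => \1_[set y : R | `|y| < r] x * f x ^+ 2).
Proof.
move=> f2; apply: (L1Ml (c := 1)); last exact: L2_sq.
  exact: measurable_indic (meas_ball r).
by move=> x; exact: indic_le1.
Qed.

Lemma dweight_energy f : L2 f ->
  2^-1 * local_energy lam f - lam / Lam * nrm f ^+ 2 <= ip (fun x => dw x * f x) f.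
Proof.
move=> f2; have l1 := local_energy_L1 lam f2.
rewrite nrm_sqr ip_sqr -!intRZ//; last exact: L2_sq.
rewrite -intRB//; [|exact: L1Z|by apply: L1Z; exact: L2_sq].
apply: intR_le.
- by apply: L1B; apply: L1Z => //; exact: L2_sq.
- by apply: L2M => //; exact: dweight_L2.
move=> x; rewrite mulrA -mulrBl -mulrA -expr2 ler_wpM2r ?sqr_ge0// indicE.
have [xB|xB] := boolP (x \in _).
  by rewrite mulr1; apply: dweight_ge_half => //; move: xB; rewrite inE.
by rewrite mulr0 sub0r; exact: dweight_ge.
Qed.

(** The cubic term is absorbed by the mass part of the functional, once its
    coefficient is large compared with the energy. *)
Lemma dweight_cubic (c : R) v : 0 < c -> L2 v -> L2 (fun x => v x ^+ 2) ->
  - (2 * c / 3 * (lam / Lam) * nrm v ^+ 2 + nrm (fun x => v x ^+ 2) ^+ 2 / (3 * c)) <=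
  c / 3 * ip (fun x => dw x * v x) v - 2 / 3 * ip (fun x => dw x * v x) (fun x => v x ^+ 2).
Proof.
move=> c0 v2 vv2; have d2 := @dweight_L2 _ _ _ lam_gt0 lam_lt _ v2.
have i1 := L2M d2 v2; have i2 := L2M d2 vv2.
rewrite !nrm_sqr !ip_sqr [X in _ + X]mulrC -!intRZ//; try exact: L2_sq.
rewrite -intRD//; try (by apply: L1Z; exact: L2_sq).
rewrite -intRN; last by apply: L1D; apply: L1Z; exact: L2_sq.
rewrite -intRB//; try exact: L1Z.
apply: intR_le.
- by apply: L1N; apply: L1D; apply: L1Z; exact: L2_sq.
- by apply: L1B; exact: L1Z.
move=> x; have := dweight_ge lam_gt0 lam_lt x; have := dweight_le1 lam_gt0 lam_lt x.
set r := lam / Lam; have r0 : 0 <= r by rewrite divr_ge0 ?ltW.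
rewrite ler_norml => /andP[_]; move: (dw x) (v x) => d y d1 d2'.
set z := y ^+ 2.
have z0 : 0 <= z by exact: sqr_ge0.
have zz : 0 <= z ^+ 2 / c by rewrite divr_ge0 ?sqr_ge0// ltW.
(* complete the squares [(c y - z)^2 / c] and [(c y + z)^2 / c] *)
have p1 : 0 <= c * z - 2 * (y * z) + z ^+ 2 / c.
  have : 0 <= (c * y - z) ^+ 2 / c by rewrite divr_ge0 ?sqr_ge0// ltW.
  by congr (_ <= _); rewrite /z; field; rewrite gt_eqF.
have p2 : 0 <= c * z + 2 * (y * z) + z ^+ 2 / c.
  have : 0 <= (c * y + z) ^+ 2 / c by rewrite divr_ge0 ?sqr_ge0// ltW.
  by congr (_ <= _); rewrite /z; field; rewrite gt_eqF.
have cz : 0 <= c * z by rewrite mulr_ge0// ltW.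
suff : 0 <= d * (c * z - 2 * (y * z)) + 2 * r * (c * z) + z ^+ 2 / c.
  rewrite [X in _ -> _ <= X](_ : _ = 3^-1 * (d * (c * z - 2 * (y * z)))); last by rewrite /z; field.
  rewrite (_ : (3 * c)^-1 * z ^+ 2 = 3^-1 * (z ^+ 2 / c)); last by field; rewrite gt_eqF.
  rewrite (_ : 2 * c / 3 * r * z = 3^-1 * (2 * r * (c * z))); last by field.
  lra.
have [dp|dn] := leP 0 d.
  have rcz : 0 <= r * (c * z) by rewrite mulr_ge0.
  have [sp|sn] := leP 0 (c * z - 2 * (y * z)).
    by have := mulr_ge0 dp sp; lra.
  have : (1 - d) * (c * z - 2 * (y * z)) <= 0 by apply: mulr_ge0_le0; lra.
  lra.
have nd : 0 <= - d by lra.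
have h2 : (- d) * - (c * z + 2 * (y * z)) <= (- d) * (z ^+ 2 / c) by rewrite ler_wpM2l//; lra.
have nd1 : - d <= r by lra.
have h3 : (- d) * (c * z) <= r * (c * z) by rewrite ler_wpM2r.
have h4 : (- d) * (z ^+ 2 / c) <= z ^+ 2 / c.
  rewrite ler_piMl//; apply: (le_trans nd1).
  by rewrite /r ler_pdivrMr// mul1r ltW.
lra.
Qed.

Context (delta : R) (delta_gt0 : 0 < delta).
Local Notation Om := (Omega delta).
Local Notation q := (q delta).

(** The terms stem from the negative part of [w'] (the first two), the quartic
    remainder of the cubic term, the commutator, and the linear term. *)
Definition virial_error (c tau M : R) :=
  17 * (lam / Lam) * M ^+ 2 + 2 * c / 3 * (lam / Lam) * M ^+ 2 + 16 * M ^+ 4 / (3 * c) +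
  3 * (2 * tau + 8 * (tau^-1 + 1) / lam) * M ^+ 2 + (2 + 2 * c / 3) * (15 * M / Num.sqrt lam).

(** The right-hand side is the time derivative of
    [(2 + 2c/3) \int v w - \int w v^2] along the flow. Its dispersive part gives the
    energy of [qv], and the transport part of [\int v w] gives the mass as well as
    what absorbs the cubic term. *)
Lemma virial_rate v Dv Lv qv (c tau M : R) : L2 v -> L2 (fun x => wt 1 x * hart v x) ->
  L2 (fun x => wt (1 / 2) x * hart v x) -> has_symbol (fun x => - x) v Dv ->
  has_symbol Om v Lv -> L2 qv -> {ae mu, forall x, hart qv x = q x * hart v x} ->
  0 < c -> 0 < tau -> nrm (fun x => wt (1 / 2) x * hart v x) <= M -> nrm qv <= 4 * M ->
  2^-1 * (local_energy lam v + local_energy lam qv) - virial_error c tau M <=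
  (2 + 2 * c / 3) * ip (fun x => - (Lv x + v x * Dv x)) w -
  2 * ip (fun x => w x * v x) (fun x => - (Lv x + v x * Dv x)).
Proof.
move=> v2 w1 wh Ds Ls qv2 qvE c0 tau0 NM QM.
have [D2 _] := Ds; have [L2v _] := Ls; have W2 := weight_L2 lam_gt0 lam_lt.
have wv2 := weight_mul_L2 lam_gt0 lam_lt v2.
have vD2 : L2 (fun x => v x * Dv x) by exact: H1_mul_L2.
have vv2 : L2 (fun x => v x ^+ 2) by exact: H1_mul_L2.
have S2 := L2D L2v vD2.
have E1 : ip (fun x => - (Lv x + v x * Dv x)) w = - ip Lv w - ip (fun x => w x * v x) Dv.
  rewrite ipNl// ipDl// opprD; congr (_ - _); apply: intR_ext => x; ring.
have E2 : ip (fun x => w x * v x) (fun x => - (Lv x + v x * Dv x)) =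
   - ip (fun x => w x * v x) Lv - ip (fun x => w x * v x) (fun x => v x * Dv x).
  by rewrite ipC ipNl// ipC ipDr// opprD.
rewrite E1 E2.
have A := weight_transport lam_gt0 lam_lt v2 Ds.
have B := weight_cubic lam_gt0 lam_lt v2 w1 Ds.
have C := weight_dispersion lam_gt0 lam_lt delta_gt0 v2 wh Ls qv2 qvE tau0.
have D := weight_linear lam_gt0 lam_lt delta_gt0 v2 Ls.
have F := dweight_cubic c0 v2 vv2.
have G := dweight_energy v2; have H := dweight_energy qv2.
have I := L4_bound v2 vv2 wh.
set N := nrm (fun x => wt (1 / 2) x * hart v x) in NM C I.
have N0 : 0 <= N by exact: nrm_ge0.
have M0 : 0 <= M by exact: le_trans NM.
have gN : nrm (hart v) <= M by apply: le_trans (nrm_hart_le_wt _ v2 wh) NM.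
have vN : nrm v <= M by apply: le_trans (nrm_le_hart v2) gN.
set r := lam / Lam in F G H *; have r0 : 0 <= r by rewrite divr_ge0 ?ltW.
have sq (a b' : R) : 0 <= a -> a <= b' -> a ^+ 2 <= b' ^+ 2.
  by move=> a0 ab; rewrite ler_pXn2r ?nnegrE//; exact: le_trans ab.
have vN2 := sq _ _ (nrm_ge0 v) vN; have qN2 := sq _ _ (nrm_ge0 qv) QM.
have NM2 := sq _ _ N0 NM; have gN2 := sq _ _ (nrm_ge0 _) gN.
have M2 : 0 <= M ^+ 2 by exact: sqr_ge0.
have cp : 0 <= c by exact: ltW.
have l0 : 0 < Num.sqrt lam by rewrite sqrtr_gt0.
have D' : `|ip Lv w| <= 15 * M / Num.sqrt lam.
  rewrite -(@ler_pXn2r _ 2)// ?nnegrE ?divr_ge0 ?mulr_ge0// ?(ltW l0)//.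
  rewrite real_normK ?num_real//; apply: (le_trans D).
  rewrite expr_div_n exprMn (sqr_sqrtr (ltW lam_gt0)) mulrAC ler_wpM2r ?invr_ge0 ?(ltW lam_gt0)//.
  by apply: ler_pM; rewrite ?sqr_ge0//; lra.
have I' : nrm (fun x => v x ^+ 2) ^+ 2 / (3 * c) <= 16 * M ^+ 4 / (3 * c).
  rewrite ler_wpM2r ?invr_ge0 ?mulr_ge0//.
  apply: (@le_trans _ _ ((4 * M ^+ 2) ^+ 2)).
    by apply: sq; [exact: nrm_ge0|apply: (le_trans I); rewrite ler_wpM2l].
  by rewrite le_eqVlt; apply/orP; left; apply/eqP; ring.
have F' : 2 * c / 3 * r * nrm v ^+ 2 <= 2 * c / 3 * r * M ^+ 2.
  by rewrite ler_wpM2l// mulr_ge0// divr_ge0// mulr_ge0.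
have G' : r * nrm v ^+ 2 <= r * M ^+ 2 by rewrite ler_wpM2l.
have H' : r * nrm qv ^+ 2 <= 16 * (r * M ^+ 2).
  rewrite [leRHS]mulrCA ler_wpM2l//; apply: (le_trans qN2).
  by rewrite le_eqVlt; apply/orP; left; apply/eqP; ring.
have C' : 3 * (2 * tau + 8 * (tau^-1 + 1) / lam) * N ^+ 2 <= 3 * (2 * tau + 8 * (tau^-1 + 1) / lam) * M ^+ 2.
  by rewrite ler_wpM2l// ?mulr_ge0 ?addr_ge0 ?mulr_ge0 ?addr_ge0 ?invr_ge0 ?(ltW lam_gt0) ?(ltW tau0).
have A0 : 0 <= 2 + 2 * c / 3 by lra.
have D2' : (2 + 2 * c / 3) * ip Lv w <= (2 + 2 * c / 3) * (15 * M / Num.sqrt lam).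
  by rewrite ler_wpM2l//; apply: le_trans D'; exact: ler_norm.
move: (le_trans C C'); rewrite ler_norml => /andP[C1 _].
rewrite /virial_error -/r.
have A2 : c / 3 * (2 * ip (fun x => w x * v x) Dv) = c / 3 * - ip (fun x => dw x * v x) v by rewrite A.
move: A A2 B F G H C1 D2' F' G' H' I'.
set T1 := 3 * _ * M ^+ 2; set T2 := 16 * M ^+ 4 / _; set T3 := _ / (3 * c); set T4 := 2 * c / 3 * r * M ^+ 2.
set T5 := 2 * c / 3 * r * _; set T6 := _ * (15 * M / _).
set X1 := ip (fun x => w x * v x) Dv; set X2 := ip _ v; set X3 := ip (fun x => w x * v x) _.
set X4 := ip _ (fun x => v x ^+ 2); set X5 := ip _ qv; set X6 := ip _ Lv.
set Y1 := r * nrm v ^+ 2; set Y2 := r * nrm qv ^+ 2; set X7 := ip Lv w.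
rewrite (_ : 17 * r * M ^+ 2 = 17 * (r * M ^+ 2)); last by ring.
set Y3 := r * M ^+ 2.
move=> A A2 B F G H C1 D2' F' G' H' I'.
have -> : (2 + 2 * c / 3) * (- X7 - X1) = - ((2 + 2 * c / 3) * X7) - 2 * X1 - 2 * (c / 3 * X1) by field.
lra.
Qed.

Lemma virial_bound (A : R) v : 0 <= A -> L2 v ->
  `|A * ip v w - ip (fun x => w x * v x) v| <=
  (2 * A * nrm v * Num.sqrt lam + nrm v ^+ 2) * Lam.
Proof.
move=> A0 v2; have W2 := weight_L2 lam_gt0 lam_lt.
have wv2 := weight_mul_L2 lam_gt0 lam_lt v2.
have W : nrm w <= 2 * Num.sqrt lam * Lam.
  rewrite -(@ler_pXn2r _ 2)// ?nnegrE ?nrm_ge0 ?mulr_ge0 ?sqrtr_ge0// ?(ltW Lam_gt0)//.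
  apply: (le_trans (weight_L2_norm lam_gt0 lam_lt)).
  rewrite !exprMn sqr_sqrtr ?(ltW lam_gt0)//.
  have : 0 <= lam * Lam ^+ 2 by rewrite mulr_ge0 ?sqr_ge0// ltW.
  lra.
have wn : nrm (fun x => w x * v x) <= Lam * nrm v.
  rewrite -{2}(gtr0_norm Lam_gt0) -nrmZ//; apply: nrm_le_mono => // [|x]; first exact: L2Z.
  by rewrite (normrM (w x)) (normrM Lam) (gtr0_norm Lam_gt0) ler_wpM2r// weight_le.
have n0 := nrm_ge0 v.
apply: (le_trans (ler_normB _ _)); rewrite normrM (ger0_norm A0).
have b1 : A * `|ip v w| <= A * (nrm v * (2 * Num.sqrt lam * Lam)).
  by rewrite ler_wpM2l//; apply: (le_trans (cauchy_schwarz v2 W2)); rewrite ler_wpM2l.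
have b2 : `|ip (fun x => w x * v x) v| <= Lam * nrm v * nrm v.
  by apply: (le_trans (cauchy_schwarz wv2 v2)); rewrite ler_wpM2r.
lra.
Qed.

End VirialRate.

(** * Growth of the virial functional *)

Section SobolevDistance.
Context {R : realType}.
Local Notation mu := (@lebesgue_measure R).
Implicit Types (f g : R -> R).

Definition wnrm s f := nrm (fun x => wt s x * hart f x).

Lemma wnrmB s f g : L2 f -> L2 g -> L2 (fun x => wt s x * hart f x) ->
  L2 (fun x => wt s x * hart g x) ->
  L2 (fun x => wt s x * hart (fun y => f y - g y) x) /\
  `|wnrm s f - wnrm s g| <= wnrm s (fun y => f y - g y).
Proof.
move=> f2 g2 wf wg; have B2 := L2B wf wg.
have m2 : measurable_fun setT (fun x => wt s x * hart (fun y => f y - g y) x).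
  by apply: measurable_funM; [exact: meas_wt|apply: L2_meas; apply: hart_L2; exact: L2B].
have E : {ae mu, forall x, wt s x * hart f x - wt s x * hart g x = wt s x * hart (fun y => f y - g y) x}.
  by apply: filterS (hartB f2 g2) => x ->; rewrite mulrBr.
split; first exact: L2_ae m2 E B2.
apply: (le_trans (nrm_dist wf wg)).
by rewrite /wnrm (nrm_ae (L2_meas B2) m2 E).
Qed.

(** A nonempty open set of times is not negligible. *)
Lemma C_Hs_bounded s (u : R -> R -> R) M : C_Hs s u ->
  {ae mu, forall t, (Hnorm s (u t) <= M%:E)%E} ->
  forall t, (Hnorm s (u t) <= M%:E)%E.
Proof.
move=> [uH uc] uM t0.
have F t := HsP (uH t).
have wE t : Hnorm s (u t) = (wnrm s (u t))%:E by have [_ _ ->] := F t.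
rewrite wE lee_fin leNgt; apply/negP => Mt.
have d0 : 0 < wnrm s (u t0) - M by rewrite subr_gt0.
have N : \forall t \near t0, (Hnorm s (u t \- u t0)%R < (wnrm s (u t0) - M)%:E)%E.
  have := uc t0; move/(_ [set x | (x < (wnrm s (u t0) - M)%:E)%E]); apply.
  by apply: open_nbhs_nbhs; split; [exact: open_ereal_lt_ereal|rewrite /= lte_fin].
move/nbhs_ballP : N => [r /= r0 rP].
have [A [mA A0 AP]] := uM.
have sub : ball t0 r `<=` A.
  move=> t /rP tr; apply: AP => /=; rewrite wE lee_fin => tM.
  have [u2 w2 _] := F t; have [v2 z2 _] := F t0.
  have [_] := wnrmB u2 v2 w2 z2; rewrite ler_norml => /andP[h _].
  have B2 := L2B u2 v2.
  have [|_ E] := @HnormE R s (u t \- u t0) B2; first by apply: lt_trans tr _; rewrite ltry.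
  move: tr; rewrite E lte_fin -/(wnrm s (fun y => u t y - u t0 y)); lra.
have : (mu (ball t0 r) <= mu A)%E.
  by apply: le_measure => //; apply/mem_set => //; exact: measurable_ball.
by rewrite A0 lebesgue_measure_ball ?(ltW r0)// lee_fin leNgt mulrn_wgt0.
Qed.

End SobolevDistance.

Section Growth.
Context {R : realType} (delta : R) (delta_gt0 : 0 < delta).
Local Notation mu := (@lebesgue_measure R).
Implicit Types (f g : R -> R).

Lemma ILW_solution_approx (u0 : R -> R) (u : R -> R -> R) (T eta : R) :
  ILW_solution delta (1 / 2) u0 u -> 0 < T -> 0 < eta ->
  exists2 v : R -> R -> R, smooth_solution delta v &
    forall t, - T <= t <= T -> wnrm (1 / 2) (fun x => v t x - u t x) <= eta.
Proof.
move=> [_ [uH _] _ /(_ T)] + T0 e0 => /(_ T0) [v [vs _ vu]].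
pose S n := ereal_sup [set Hnorm (1 / 2) (v n t \- u t) | t in `[- T, T]].
have : \forall n \near \oo, (S n < eta%:E)%E.
  move: vu => /(_ [set x | (x < eta%:E)%E]); apply.
  by apply: open_nbhs_nbhs; split; [exact: open_ereal_lt_ereal|rewrite /= lte_fin].
case=> n _ /(_ n (leqnn n)) /= H; exists (v n) => // t tT.
have [v2 _ _] := HsP (((vs n).1 (1 / 2) ltac:(by [])).1 t).
have [u2 _ _] := HsP (uH t).
have lt : (Hnorm (1 / 2)%R (v n t \- u t)%R < eta%:E)%E.
  by apply: le_lt_trans H; apply: ereal_sup_ubound; exists t => //; rewrite /= in_itv.
have [|_ E] := @HnormE R (1 / 2) (v n t \- u t) (L2B v2 u2).
  by apply: lt_trans lt _; rewrite ltry.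
by move: lt; rewrite E lte_fin => /ltW.
Qed.

Lemma local_energyB r f g : L2 f -> L2 g ->
  local_energy r f - local_energy r g <= nrm (fun x => f x - g x) * (nrm f + nrm g).
Proof.
move=> f2 g2; have f1 := local_energy_L1 r f2; have g1 := local_energy_L1 r g2.
have B2 := L2B f2 g2; have D2 := L2D f2 g2.
have I1 (x : R) : `|\1_[set y : R | `|y| < r] x : R| <= 1.
  exact: indic_le1.
have IB2 : L2 (fun x => \1_[set y : R | `|y| < r] x * (f x - g x)).
  apply: (L2Ml (c := 1)) => //; exact: measurable_indic (meas_ball r).
rewrite /local_energy -intRB//.
rewrite (_ : intR _ = ip (fun x => \1_[set y : R | `|y| < r] x * (f x - g x)) (fun x => f x + g x)).
  apply: le_trans (ler_norm _) _; apply: (le_trans (cauchy_schwarz IB2 D2)).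
  apply: ler_pM; rewrite ?nrm_ge0//; last exact: nrmD.
  by apply: nrm_le_mono => // x; rewrite normrM ler_piMl.
by apply: intR_ext => x; ring.
Qed.

Lemma local_energy_mono r r' f : L2 f -> r <= r' -> local_energy r f <= local_energy r' f.
Proof.
move=> f2 rr; apply: intR_le; try exact: local_energy_L1.
move=> x; rewrite ler_wpM2r ?sqr_ge0// !indicE.
have [xr|xr] := boolP (x \in [set y : R | `|y| < r]); last by [].
rewrite mem_set//=; move: xr; rewrite inE/= => xr; exact: lt_le_trans rr.
Qed.

(** If the local energy of [u] stays above [e] on [[T, 2T]], the virial functional
    of a nearby smooth solution grows at the rate [e / 8] there, whereas it is
    bounded by the size of the weight. *)
Lemma virial_growth (u v : R -> R -> R) (lam Lam e c tau M T eta : R) :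
  0 < lam -> lam < Lam -> 0 < c -> 0 < tau -> 0 < T -> 1 <= M ->
  (forall t : R, Hs (1 / 2) (u t)) -> (forall t, wnrm (1 / 2) (u t) <= M - 1) ->
  smooth_solution delta v ->
  (forall t : R, - (2 * T) <= t <= 2 * T -> wnrm (1 / 2) (fun x => v t x - u t x) <= eta) ->
  eta <= 1 -> 34 * M * eta <= e / 2 ->
  (forall t : R, T <= t <= 2 * T -> e <= local_energy lam (u t) + local_energy lam (qDx delta (u t))) ->
  virial_error lam Lam c tau M <= e / 8 ->
  e / 8 * T <= 2 * ((2 * (2 + 2 * c / 3) * M * Num.sqrt lam + M ^+ 2) * Lam).
Proof.
move=> lam0 lamL c0 tau0 T0 M1 uH uM vs vu eta1 eta_e ue ve.
set A := 2 + 2 * c / 3.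
have A0 : 0 <= A by rewrite /A; lra.
pose w := weight lam Lam.
pose G t x := - (ILW_op delta (v t) x + v t x * Dx (v t) x).
have vd t := smooth_solution_L2_derivative delta_gt0 t vs.
pose K t := A * ip (v t) w - ip (fun x => w x * v t x) (v t).
pose dK t := A * ip (G t) w - 2 * ip (fun x => w x * v t x) (G t).
have KdK (t : R) : is_derive t 1 K (dK t).
  have d1 := L2_derivative_linear (vd t) (weight_L2 lam0 lamL).
  have d2 := L2_derivative_quadratic (vd t) (meas_weight lam0 lamL) (weight_le lam0 lamL).
  have d3 : is_derive t 1 (fun s => A * ip (v s) w) (A * ip (G t) w).
    by apply: is_derive_eq; rewrite /GRing.scale/=; ring.
  exact: is_deriveB.
have vH (s t : R) : 0 <= s -> L2 (v t) /\ L2 (fun x => wt s x * hart (v t) x).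
  by move=> s0; have [/(_ t) /HsP[]] := vs.1 s s0.
have close (t : R) : - (2 * T) <= t <= 2 * T ->
    [/\ wnrm (1 / 2) (v t) <= M, nrm (v t) <= M, nrm (u t) <= M,
     wnrm (1 / 2) (u t) <= M & nrm (fun x => u t x - v t x) <= eta].
  move=> tT; have [v2 wv] := vH (1 / 2) t ltac:(by []).
  have [u2 wu _] := HsP (uH t).
  have [wB] := wnrmB v2 u2 wv wu; rewrite ler_norml => /andP[_ h].
  have h1 := vu t tT; have h2 := uM t.
  have vM : wnrm (1 / 2) (v t) <= M by lra.
  have uM' : wnrm (1 / 2) (u t) <= M by lra.
  split => //.
  - by apply: le_trans vM; apply: (le_trans (nrm_le_hart v2)); exact: nrm_hart_le_wt.
  - by apply: le_trans uM'; apply: (le_trans (nrm_le_hart u2)); exact: nrm_hart_le_wt.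
  - rewrite nrm_sym; apply: le_trans h1; apply: (le_trans (nrm_le_hart (L2B v2 u2))).
    by apply: nrm_hart_le_wt => //; exact: L2B.
have Kb (t : R) : - (2 * T) <= t <= 2 * T -> `|K t| <= (2 * A * M * Num.sqrt lam + M ^+ 2) * Lam.
  move=> tT; have [_ vM _ _ _] := close t tT; have [v2 _] := vH 0 t (lexx _).
  have L0 : 0 <= Lam by rewrite ltW// (lt_trans lam0).
  apply: (le_trans (virial_bound lam0 lamL A0 v2)); rewrite ler_wpM2r//.
  apply: lerD; last by rewrite ler_pXn2r ?nnegrE ?nrm_ge0//; lra.
  by rewrite ler_wpM2r ?sqrtr_ge0// ler_wpM2l// mulr_ge0.
have T2 : T < 2 * T by lra.
have [|t] := @MVT _ K dK T (2 * T) T2 (fun t _ => KdK t).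
  by apply: continuous_subspaceT; exact: cont_of_derive KdK.
rewrite in_itv/= => /andP[t1 t2] EK.
have tT : - (2 * T) <= t <= 2 * T by apply/andP; split; lra.
have ut := ue t ltac:(by apply/andP; split; lra).
have [vM nvM nuM uM' uv] := close t tT.
have [v2 w1] := vH 1 t ler01; have [_ w2] := vH 2 t ltac:(by []).
have [_ wh] := vH (1 / 2) t ltac:(by []); have [u2 uh _] := HsP (uH t).
have Ds := Dx_symbol v2 w1; have Ls := ILW_op_symbol delta_gt0 v2 w2.
have [qv2 qvE] := qDx_symbol delta_gt0 v2 wh; have [qu2 _] := qDx_symbol delta_gt0 u2 uh.
have M0 : 0 <= M by lra.
have qvM : nrm (qDx delta (v t)) <= 4 * M.
  by apply: (le_trans (nrm_qDx delta_gt0 v2 wh)); rewrite ler_wpM2l.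
have quM : nrm (qDx delta (u t)) <= 4 * M.
  by apply: (le_trans (nrm_qDx delta_gt0 u2 uh)); rewrite ler_wpM2l.
have quv : nrm (fun x => qDx delta (u t) x - qDx delta (v t) x) <= 4 * eta.
  rewrite nrm_sym; apply: (le_trans (nrm_qDxB delta_gt0 v2 wh u2 uh)).
  by rewrite ler_wpM2l// vu.
have R1 := virial_rate lam0 lamL delta_gt0 v2 w1 wh Ds Ls qv2 qvE c0 tau0 vM qvM.
have e0 : 0 <= eta by apply: le_trans uv; exact: nrm_ge0.
(* abstracting the two terms keeps conversion away from the choice operator *)
move: qu2 qv2 quM qvM quv ut R1; clear qvE.
generalize (qDx delta (u t)) (qDx delta (v t)) => qu qv qu2 qv2 quM qvM quv ut R1.
have B1 := local_energyB lam u2 v2; have B2 := local_energyB lam qu2 qv2.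
have B1' : nrm (fun x => u t x - v t x) * (nrm (u t) + nrm (v t)) <= eta * (2 * M).
  by apply: ler_pM; rewrite ?addr_ge0 ?nrm_ge0//; lra.
have B2' : nrm (fun x => qu x - qv x) * (nrm qu + nrm qv) <= 4 * eta * (8 * M).
  by apply: ler_pM; rewrite ?addr_ge0 ?nrm_ge0//; lra.
have dKt : e / 8 <= dK t.
  apply: le_trans R1.
  move: (le_trans B1 B1') (le_trans B2 B2'); move: ut eta_e ve.
  set a1 := local_energy _ _; set a2 := local_energy _ _; set a3 := local_energy _ _; set a4 := local_energy _ _.
  set z := virial_error _ _ _ _ _; have -> : 34 * M * eta = 34 * (M * eta) by ring.
  rewrite (_ : eta * (2 * M) = 2 * (M * eta)); last by ring.
  rewrite (_ : 4 * eta * (8 * M) = 32 * (M * eta)); last by ring.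
  lra.
have K1 := Kb T ltac:(by apply/andP; split; lra).
have K2 := Kb (2 * T) ltac:(by apply/andP; split; lra).
move: EK K1 K2; rewrite (_ : 2 * T - T = T); last by ring.
rewrite !ler_norml => EK /andP[k1 k2] /andP[k3 k4].
have : e / 8 * T <= dK t * T by rewrite ler_wpM2r// ltW.
lra.
Qed.

End Growth.

(** * Conclusion *)

Section Conclusion.
Context {R : realType}.
Local Notation mu := (@lebesgue_measure R).

Lemma local_energy_integral (r : R) (f g : R -> R) : L2 f -> L2 g ->
  (\int[mu]_(x in [set x : R | (`|x| < r)%R]) ((f x) ^+ 2 + `|g x| ^+ 2)%:E =
   (local_energy r f + local_energy r g)%:E)%E.
Proof.
move=> f2 g2; have f1 := local_energy_L1 r f2; have g1 := local_energy_L1 r g2.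
rewrite /local_energy -intRD// intRE; last exact: L1D.
rewrite integral_mkcond; apply: eq_integral => x _; rewrite patchE indicE.
by case: (x \in _); rewrite ?mul1r ?mul0r ?addr0// real_normK ?num_real.
Qed.

Lemma powR_large (a C : R) : 0 < a -> \forall S \near +oo, C <= S `^ a.
Proof.
move=> a0; near=> S.
have S1 : Num.max 1 C `^ a^-1 <= S by near: S; apply: nbhs_pinfty_ge; exact: num_real.
have m0 : 0 < Num.max 1 C by rewrite lt_max ltr01.
apply: (@le_trans _ _ (Num.max 1 C)); first by rewrite le_max lexx orbT.
rewrite -[leLHS]powRr1 ?(ltW m0)// -(@mulVf _ a) ?gt_eqF// powRrM.
by apply: ge0_ler_powR => //; rewrite ?nnegrE ?powR_ge0 ?(ltW a0)//; apply: le_trans S1; exact: powR_ge0.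
Unshelve. all: by end_near. Qed.

Lemma limf_einf_eq0 (g : R -> \bar R) : (forall t, 0 <= g t)%E ->
  (forall e T : R, 0 < e -> exists2 t, T <= t & (g t < e%:E)%E) ->
  limf_einf g (pinfty_nbhs R) = 0%E.
Proof.
move=> g0 gs; rewrite limf_einfE; apply/eqP; rewrite eq_le; apply/andP; split.
  apply: ge_ereal_sup => _ [V [T [_ TV]] <-].
  apply/lee_addgt0Pr => e e0; rewrite add0e.
  have [t Tt lt] := gs e (T + 1) e0.
  apply: le_trans (ltW lt); apply: ereal_inf_lbound; exists t => //; apply: TV.
  by apply: lt_le_trans Tt; rewrite ltrDl.
apply: (@le_trans _ _ (ereal_inf (g @` setT))).
  by apply: le_ereal_inf_tmp => _ [t _ <-].
by apply: ereal_sup_ubound; exists setT => //; exact: filterT.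
Qed.

(** For [b < 2/3] the parameters can be balanced: with [s = S^(b/2)] and
    [z = S^(1/2 - 3b/4)] large, take [lam = s^2 = S^b] and [Lam = lam z], so that
    [S = s^3 z^2] dominates the bound [s Lam = s^3 z] of the functional. *)
Lemma virial_parameters (e M b T0 : R) : 0 < e -> 1 <= M -> 0 < b -> b < 2 / 3 ->
  exists S Lam c tau eta : R,
  [/\ 0 < S /\ 2 * T0 <= S, 0 < S `^ b < Lam, 0 < c /\ 0 < tau,
    [/\ 0 < eta, eta <= 1 & 34 * M * eta <= e / 2] &
    virial_error (S `^ b) Lam c tau M <= e / 8 /\
    2 * ((2 * (2 + 2 * c / 3) * M * Num.sqrt (S `^ b) + M ^+ 2) * Lam) < e / 8 * (S / 2)].
Proof.
move=> e0 M1 b_gt0 b_lt.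
have Mp : 0 < M by apply: lt_le_trans M1.
pose c := 100 * M ^+ 4 / e; pose tau := e / 100 / (2 * M ^+ 2).
have M2 : 0 < M ^+ 2 by exact: exprn_gt0.
have c0 : 0 < c by rewrite divr_gt0// mulr_gt0// exprn_gt0.
have tau0 : 0 < tau by rewrite divr_gt0// mulr_gt0.
pose eta := Num.min 1 (e / (100 * M)).
have eta0 : 0 < eta by rewrite lt_min ltr01 divr_gt0// mulr_gt0.
have eta1 : eta <= 1 by rewrite ge_min lexx.
have etaM : 34 * M * eta <= e / 2.
  have : 34 * M * eta <= 34 * M * (e / (100 * M)).
    by rewrite ler_wpM2l ?mulr_ge0 ?(ltW Mp)// ge_min lexx orbT.
  have -> : 34 * M * (e / (100 * M)) = 34 / 100 * e by field; rewrite gt_eqF.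
  lra.
pose A := 2 + 2 * c / 3.
have A0 : 0 < A by rewrite /A; lra.
(* lower bounds that make each term of [virial_error] a small part of [e] *)
pose C1 := 24 * (tau^-1 + 1) * M ^+ 2 / (e / 100).
pose C2 := A * (15 * M) / (e / 100).
pose C3 := (17 + 2 * c / 3) * M ^+ 2 / (e / 100).
pose C4 := 64 * (2 * A * M + M ^+ 2) / e.
have b1 : 0 < b / 2 by rewrite divr_gt0.
have b2 : 0 < 1 / 2 - 3 / 4 * b by lra.
have [S [[S0 ST] lC1 sC2 zC3 zC4]] : exists S, [/\ 0 < S /\ 2 * T0 <= S, C1 <= S `^ b,
    Num.max 1 C2 <= S `^ (b / 2), Num.max 2 C3 <= S `^ (1 / 2 - 3 / 4 * b) &
    C4 <= S `^ (1 / 2 - 3 / 4 * b)].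
  apply: (@filter_ex _ (pinfty_nbhs R)); near=> S; split.
  - split; near: S; first by apply: nbhs_pinfty_gt; exact: num_real.
    by apply: nbhs_pinfty_ge; exact: num_real.
  - by near: S; exact: powR_large.
  - by near: S; exact: powR_large.
  - by near: S; exact: powR_large.
  - by near: S; exact: powR_large.
move: sC2 zC3; rewrite !ge_max => /andP[s1 sC2] /andP[z1 zC3].
set lam := S `^ b in lC1; set s := S `^ (b / 2) in s1 sC2; set z := S `^ _ in z1 zC3 zC4.
pose Lam := lam * z.
have Sn0 : S != 0 by rewrite gt_eqF.
have s0 : 0 < s by exact: powR_gt0.
have z0 : 0 < z by exact: powR_gt0.
have lamE : lam = s ^+ 2.
  by rewrite expr2 -powRD ?Sn0 ?implybT//; congr (_ `^ _); field.
have SE : S = s ^+ 3 * z ^+ 2.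
  rewrite -[LHS]powRr1 ?(ltW S0)// -!powR_mulrn ?powR_ge0// -!powRrM -powRD ?Sn0 ?implybT//.
  by congr (_ `^ _); field.
have sqE : Num.sqrt lam = s by rewrite lamE sqrtr_sqr gtr0_norm.
have lam0 : 0 < lam by rewrite lamE exprn_gt0.
have lamL : lam < Lam by rewrite /Lam ltr_pMr//; lra.
have lamLE : lam / Lam = z^-1 by rewrite /Lam invfM mulrA divff ?mul1r// gt_eqF.
have Tp : 0 < S / 2 by rewrite divr_gt0.
exists S, Lam, c, tau, eta; rewrite -/lam.
have ve : virial_error lam Lam c tau M <= e / 8.
  rewrite /virial_error lamLE sqE -/A.
  have h1 : (17 + 2 * c / 3) * M ^+ 2 / z <= e / 100.
    rewrite ler_pdivrMr// -ler_pdivrMl ?divr_gt0//; by apply: le_trans zC3; rewrite /C3 mulrC.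
  have h2 : 24 * (tau^-1 + 1) * M ^+ 2 / lam <= e / 100.
    rewrite ler_pdivrMr// -ler_pdivrMl ?divr_gt0//; by apply: le_trans lC1; rewrite /C1 mulrC.
  have h3 : A * (15 * M / s) <= e / 100.
    rewrite mulrA ler_pdivrMr// -ler_pdivrMl ?divr_gt0//; by apply: le_trans sC2; rewrite /C2 mulrC.
  have h4 : 16 * M ^+ 4 / (3 * c) = 16 / 300 * e by rewrite /c; field; rewrite !gt_eqF.
  have h5 : tau * M ^+ 2 = e / 200 by rewrite /tau; field; rewrite gt_eqF.
  rewrite h4.
  rewrite (_ : 17 * z^-1 * M ^+ 2 = 17 * (M ^+ 2 / z)); last by ring.
  rewrite (_ : 2 * c / 3 * z^-1 * M ^+ 2 = (17 + 2 * c / 3) * M ^+ 2 / z - 17 * (M ^+ 2 / z)); last by ring.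
  rewrite (_ : 3 * (2 * tau + 8 * (tau^-1 + 1) / lam) * M ^+ 2 = 6 * (tau * M ^+ 2) + 24 * (tau^-1 + 1) * M ^+ 2 / lam); last by ring.
  rewrite h5; lra.
split => //; first by apply/andP.
split => //; rewrite ltNge; apply/negP => H; move: H.
rewrite sqE -/A {1}SE /Lam lamE => H.
have H1 : 2 * ((2 * A * M * s + M ^+ 2) * (s ^+ 2 * z)) <= 2 * (2 * A * M + M ^+ 2) * (s ^+ 3 * z).
  have : 0 <= M ^+ 2 * (s - 1) * (s ^+ 2 * z).
    apply: mulr_ge0; last by rewrite ltW// mulr_gt0// exprn_gt0.
    by apply: mulr_ge0; [exact: ltW|rewrite subr_ge0].
  lra.
have H2 : (e / 16 * z) * (s ^+ 3 * z) <= 2 * (2 * A * M + M ^+ 2) * (s ^+ 3 * z).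
  by apply: le_trans (le_trans H H1); rewrite le_eqVlt; apply/orP; left; apply/eqP; field.
move: H2; rewrite ler_pM2r ?mulr_gt0 ?exprn_gt0// => H2.
have : e / 16 * C4 <= e / 16 * z by rewrite ler_wpM2l// ltW// divr_gt0.
have -> : e / 16 * C4 = 4 * (2 * A * M + M ^+ 2) by rewrite /C4; field; rewrite gt_eqF.
have : 0 < 2 * A * M + M ^+ 2 by rewrite addr_gt0// !mulr_gt0.
lra.
Unshelve. all: by end_near. Qed.

End Conclusion.

Theorem theorem1p6 (R : realType) (delta : R) (u0 : R -> R) (u : R -> R -> R)
    (delta_gt0 : 0 < delta)
    (u0_H : Hs (1 / 2) u0)
    (u_sol : ILW_solution delta (1 / 2) u0 u)
    (u_cont : C_Hs (1 / 2) u)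
    (u_bdd : Linfty_Hs (1 / 2) u)
    (b : R) (b_gt0 : 0 < b) (b_lt : b < 2 / 3) :
  limf_einf (fun t : R =>
      (\int[@lebesgue_measure R]_(x in [set x : R | (`|x| < t `^ b)%R])
         ((u t x) ^+ 2 + `|qDx delta (u t) x| ^+ 2)%:E)%E)
    (pinfty_nbhs R) = 0%E.
Proof.
have uH := u_cont.1; have [M0 /(C_Hs_bounded u_cont) uM0] := u_bdd.
have uM1 (t : R) : wnrm (1 / 2) (u t) <= `|M0|.
  have [_ _ E] := HsP (uH t); have := uM0 t; rewrite E lee_fin => /le_trans; apply.
  exact: ler_norm.
have u2 (t : R) : L2 (u t) by have [] := HsP (uH t).
have q2 (t : R) : L2 (qDx delta (u t)).
  by have [f2 wf _] := HsP (uH t); have [] := qDx_symbol delta_gt0 f2 wf.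
have en t := local_energy_integral (t `^ b) (u2 t) (q2 t).
apply: limf_einf_eq0 => [t|e T0 e0].
  by apply: integral_ge0 => x _; rewrite lee_fin addr_ge0 ?sqr_ge0// exprn_ge0.
(* otherwise the local energy stays above [e] from [T0] on *)
apply/not_exists2P => small.
have big (t : R) : T0 <= t -> e <= local_energy (t `^ b) (u t) + local_energy (t `^ b) (qDx delta (u t)).
  move=> Tt; have := small t; case=> //; rewrite en lte_fin; by move/negP; rewrite -leNgt.
set M := `|M0| + 1.
have M1 : 1 <= M by rewrite lerDr.
have [S [Lam [c [tau [eta [[S0 ST] lamL [c0 tau0] [eta0 eta1 etaM] [ve bnd]]]]]]] :=
  virial_parameters T0 e0 M1 b_gt0 b_lt.
case/andP: lamL => lam0 lamL.
have Tp : 0 < S / 2 by rewrite divr_gt0.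
have TE : 2 * (S / 2) = S by rewrite mulrC mulfVK.
have [v vs vu] := ILW_solution_approx u_sol S0 eta0.
have ue (t : R) : S / 2 <= t <= 2 * (S / 2) ->
    e <= local_energy (S `^ b) (u t) + local_energy (S `^ b) (qDx delta (u t)).
  rewrite TE => /andP[t1 t2]; have t0 : 0 < t by exact: lt_le_trans Tp t1.
  have tl : t `^ b <= S `^ b.
    by apply: ge0_ler_powR; rewrite ?nnegrE ?(ltW b_gt0) ?(ltW t0) ?(ltW S0).
  have tT : T0 <= t by apply: le_trans t1; rewrite ler_pdivlMr// mulrC.
  apply: (le_trans (big t tT)).
  exact: (lerD (local_energy_mono (u2 t) tl) (local_energy_mono (q2 t) tl)).
have uM (t : R) : wnrm (1 / 2) (u t) <= M - 1 by rewrite /M addrK.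
have vu' (t : R) : - (2 * (S / 2)) <= t <= 2 * (S / 2) -> wnrm (1 / 2) (fun x => v t x - u t x) <= eta.
  by rewrite TE; exact: vu.
have H := virial_growth delta_gt0 lam0 lamL c0 tau0 Tp M1 uH uM vs vu' eta1 etaM ue ve.
by have := lt_le_trans bnd H; rewrite ltxx.
Qed.
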